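(* Let $d\ge3$ be an integer. For every deterministic function $\beta$ such that $\lim_{s\to\infty}\beta(s)=\infty$, the conditional distributions $\mathbb{P}\left(Y_s\in\cdot\mid S_{N_s-1}^{x_1}\le s-\beta(s)\right)$ converge weakly, as $s\to\infty$, to the uniform distribution on $\mathbb{D}$.
   Context: Model. Let $\mathbb{S}=\{y\in\mathbb{R}^{d-1}: y_1^2+\dots+y_{d-1}^2=1\}$ and let $\mathbb{D}$ be the closed unit ball of $\mathbb{R}^{d-1}$ centered at $0$. For each $y\in\mathbb{S}$ fix (measurably in $y$) an orthogonal linear operator $U^y$ on $\mathbb{R}^{d-1}$ with $U^y(0,\dots,0,-1)=y$. Let $\Sigma$ be uniformly distributed on $\mathbb{S}$; for $k\ge1$ let $\Theta^{(k)}$ have density $\frac12\cos\theta$ on $[-\pi/2,\pi/2]$ and let $\Phi_1^{(k)},\dots,\Phi_{d-2}^{(k)}$ be uniform on $[-\pi/2,\pi/2]$; all these random variables are jointly independent. Put $$R_k=\frac{2\cos\Theta^{(k)}}{1-\left(\sin\Theta^{(k)}\cos\Phi_{d-2}^{(k)}\cdots\cos\Phi_1^{(k)}\right)^2},\qquad G^{(k)}=(0,\dots,0,-1)+R_k\,(w_2^{(k)},\dots,w_d^{(k)})\in\mathbb{R}^{d-1},$$ where $w_j^{(k)}=\sin\Theta^{(k)}\sin\Phi_{j-1}^{(k)}\prod_{i=j}^{d-2}\cos\Phi_i^{(k)}$ for $2\le j\le d-1$ (an empty product is $1$) and $w_d^{(k)}=\cos\Theta^{(k)}$. Define the chain $S_k=(S_k^{x_1},S_k^{x_{2,\dots,d}})\in\mathbb{R}\times\mathbb{S}$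 of reflection points by $S_0=(0,\Sigma)$ and, for $k\ge1$, $$S_k^{x_1}=S_{k-1}^{x_1}+R_k\sin\Theta^{(k)}\cos\Phi_1^{(k)}\cdots\cos\Phi_{d-2}^{(k)},\qquad S_k^{x_{2,\dots,d}}=U^{S_{k-1}^{x_{2,\dots,d}}}\left(G^{(k)}\right).$$ For $s>0$ let $N_s=\inf\{n>0:S_n^{x_1}>s\}$. The exit point of the light ray is $(s,Y_s)$, where $$Y_s=S_{N_s-1}^{x_{2,\dots,d}}+\frac{s-S_{N_s-1}^{x_1}}{S_{N_s}^{x_1}-S_{N_s-1}^{x_1}}\left(S_{N_s}^{x_{2,\dots,d}}-S_{N_s-1}^{x_{2,\dots,d}}\right).$$ *)

(* Defs.v *)
From HB Require Import structures.
From mathcomp Require Import all_boot all_order all_algebra.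
From mathcomp Require Import all_classical all_reals all_analysis.

Set Implicit Arguments.
Unset Strict Implicit.
Unset Printing Implicit Defensive.

Import Order.TTheory GRing.Theory Num.Theory.
Import numFieldTopology.Exports numFieldNormedType.Exports.

Local Open Scope classical_set_scope.
Local Open Scope ring_scope.

(* The column space R^n with its Borel sigma-algebra. *)
Notation borel_cV R n := (g_sigma_algebraType (@open 'cV[R]_n)).

Section euclidean.
Context {R : realType}.

(* The norm of the library on matrices is the sup norm, hence the explicit
   Euclidean one. *)
Definition sqnorm n (v : 'cV[R]_n) : R := \sum_(i < n) v i 0 ^+ 2.

Definition usphere n : set 'cV[R]_n := [set v | sqnorm v = 1].

Definition uball n : set 'cV[R]_n := [set v | sqnorm v <= 1].

(* n-dimensional Lebesgue measure, as an iterated product measure; it is only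
   meaningful on Borel sets. *)
Fixpoint volume (n : nat) : set 'cV[R]_n -> \bar R :=
  match n with
  | 0 => fun A => (\1_A 0 : R)%:E
  | n'.+1 => fun A =>
      (\int[@lebesgue_measure R]_x
         @volume n' [set v | A (col_mx (x%:M : 'cV[R]_1) v)])%E
  end.

Definition uball_uniform n (A : set 'cV[R]_n) : \bar R :=
  (volume (A `&` @uball n) * ((fine (volume (@uball n)))^-1)%:E)%E.

(* Surface measure on the sphere is defined by integration in polar
   coordinates: up to the factor n, the measure of A is the volume of the
   truncated cone over A. *)
Definition usphere_uniform n (A : set 'cV[R]_n) : \bar R :=
  (volume [set v | exists (r : R) y, [/\ (0 < r <= 1)%R, usphere y, A y & v = r *: y]]
   * ((fine (volume (@uball n)))^-1)%:E)%E.

Definition orthogonal_mx n (M : 'M[R]_n) : Prop := M^T *m M = 1%:M.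

End euclidean.

Section probability_notions.
Context {R : realType} {disp : measure_display} {T : measurableType disp}.
Variable P : probability T R.

(* Set functions are only compared on measurable sets, since the value of a
   measure elsewhere is a junk value. *)
Definition has_law disp' (T' : measurableType disp') (X : T -> T')
    (nu : set T' -> \bar R) : Prop :=
  forall A, measurable A -> P (X @^-1` A) = nu A.

Definition mutually_independent (I : eqType) (E : I -> set (set T)) : Prop :=
  forall (J : seq I) (A : I -> set T), uniq J ->
    (forall i, i \in J -> E i (A i)) ->
    P (\bigcap_(i in [set` J]) A i) = (\prod_(i <- J) P (A i))%E.

Definition generated disp' (T' : measurableType disp') (X : T -> T') :
    set (set T) :=
  preimage_set_system setT X measurable.

Definition cond_law (B : set T) T' (Y : T -> T') (A : set T') : \bar R :=
  (P (Y @^-1` A `&` B) * ((fine (P B))^-1)%:E)%E.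

End probability_notions.

Definition weakly_cvg {R : realType} n (mu : R -> set 'cV[R]_n -> \bar R)
    (nu : set 'cV[R]_n -> \bar R) : Prop :=
  forall f : 'cV[R]_n -> R, continuous f ->
    (exists M, forall x, `|f x| <= M) ->
    (\int[mu s : set (borel_cV R n) -> \bar R]_x (f x)%:E)%E @[s --> +oo]
      --> (\int[nu : set (borel_cV R n) -> \bar R]_x (f x)%:E)%E.

Section one_step.
Context {R : realType}.

Definition halfpi_itv : set R := `[- (pi / 2), pi / 2]%classic.

Definition theta_law (A : set R) : \bar R :=
  (\int[@lebesgue_measure R]_(x in A `&` halfpi_itv) (cos x / 2)%:E)%E.

Definition phi_law (A : set R) : \bar R :=
  (\int[@lebesgue_measure R]_(x in A)
     (uniform_pdf (- (pi / 2)) (pi / 2) x)%:E)%E.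

(* m stands for d - 2, and phi i for the angle of index i + 1. *)
Variables (m : nat) (theta : R) (phi : 'I_m -> R).

Definition axial_dir : R := sin theta * \prod_(i < m) cos (phi i).

(* Row j is w_(j + 2); the last row is w_d. *)
Definition transverse_dir : 'cV[R]_m.+1 :=
  \col_(j < m.+1)
    match unlift ord_max j with
    | Some i => sin theta * sin (phi i) * \prod_(l < m | (i < l)%N) cos (phi l)
    | None => cos theta
    end.

Definition chord_length : R := 2 * cos theta / (1 - axial_dir ^+ 2).

Definition south_pole : 'cV[R]_m.+1 := - delta_mx ord_max 0.

Definition axial_step : R := chord_length * axial_dir.

Definition transverse_landing : 'cV[R]_m.+1 :=
  south_pole + chord_length *: transverse_dir.

End one_step.

Section light_ray.
Context {R : realType} {m : nat} {T : Type}.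
Variable U : 'cV[R]_m.+1 -> 'M[R]_m.+1.
Variable Sigma : T -> 'cV[R]_m.+1.
(* Theta k and Phi k are the angles of the (k + 1)-st reflection. *)
Variables (Theta : nat -> T -> R) (Phi : nat -> 'I_m -> T -> R).

Fixpoint reflection (k : nat) (w : T) : R * 'cV[R]_m.+1 :=
  match k with
  | 0 => (0, Sigma w)
  | k'.+1 =>
      let: (x, y) := reflection k' w in
      let theta := Theta k' w in
      let phi i := Phi k' i w in
      (x + axial_step theta phi, U y *m transverse_landing theta phi)
  end.

(* The infimum of the empty set, infinity, is encoded by 0, which is not
   otherwise a value. *)
Definition first_passage (s : R) (w : T) : nat :=
  if pselect (exists n, (0 < n)%N && (s < (reflection n w).1)) is left h
  then ex_minn h else 0%N.

Definition exit_point (s : R) (w : T) : 'cV[R]_m.+1 :=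
  let n := first_passage s w in
  let: (x0, y0) := reflection n.-1 w in
  let: (x1, y1) := reflection n w in
  y0 + ((s - x0) / (x1 - x0)) *: (y1 - y0).

(* The event that the last reflection point before level s exists and lies
   below level s - b. *)
Definition early_last_reflection (s b : R) : set T :=
  [set w | (0 < first_passage s w)%N /\
           (reflection (first_passage s w).-1 w).1 <= s - b].

End light_ray.

(* A measurable choice, for each y on the sphere, of an orthogonal operator
   mapping the south pole to y. *)
Definition frame_choice {R : realType} m (U : 'cV[R]_m.+1 -> 'M[R]_m.+1) : Prop :=
  (forall y, usphere y -> orthogonal_mx (U y) /\ U y *m south_pole m = y) /\
  (forall i j, measurable_fun (usphere (n := m.+1) : set (borel_cV R m.+1))
     (fun y : borel_cV R m.+1 => U y i j)).

(* The sigma-algebras generated by the initial point (None), the polar angles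
   (inl k) and the other angles (inr (k, i)). *)
Definition angle_sigma_algebras {R : realType} m disp (T : measurableType disp)
    (Sigma : T -> borel_cV R m.+1) (Theta : nat -> T -> R)
    (Phi : nat -> 'I_m -> T -> R) (a : option (nat + nat * 'I_m)) :
    set (set T) :=
  match a with
  | None => generated Sigma
  | Some (inl k) => generated (Theta k)
  | Some (inr (k, i)) => generated (Phi k i)
  end.

(* Main.v *)
Require Import Defs.
From HB Require Import structures.
From mathcomp Require Import all_boot all_order all_algebra.
From mathcomp Require Import all_classical all_reals all_analysis.
From mathcomp Require Import measurable_realfun ring lra.

(* Given that the last reflection below level s happens at (x, y), at distance
   u = s - x from the level, a step crosses the level only if its slope is of
   order 1/u.  The rescaled slope of a step has an explicit density, and for
   large u it makes the exit point p have, up to a factor in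
   [(u^2 / (u^2 + 4))^d, 1], the sub-density c u^-d (1 - y . p) on the unit ball,
   with c independent of u and y.  Flipping the signs of the angles Phi shows
   that the mean of the next reflection point given the past is proportional to
   the current one, and the same flip works jointly with the axial steps; since
   the initial point is centered, so is y jointly with any function of the
   axial trajectory.  Hence the term y . p disappears after averaging, and for
   u >= beta(s) the law of the exit point has constant density on the ball up to
   a factor tending to 1. *)

Set Implicit Arguments.
Unset Strict Implicit.
Unset Printing Implicit Defensive.

Import Order.TTheory GRing.Theory Num.Theory.
Import numFieldTopology.Exports numFieldNormedType.Exports.

Local Open Scope classical_set_scope.
Local Open Scope ring_scope.

(** * Borel measures on column spaces *)

Section borel_column_spaces.
Context {R : realType}.

(** Rotate the frame so that [y] becomes the south pole and let [q] be the displacement from the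
    pole to the exit point: it is [u] times the transverse direction divided by the axial one. Its
    coordinates have the form [c * tan Phi], and [c * (cos Theta / sin Theta)] for the last one,
    where the scale [c] depends on the coordinates already treated; so the density is computed one
    coordinate at a time. Its leading term is proportional to the last coordinate of [q], the
    distance from [p] to the tangent hyperplane at [y], which is [1 - y . p]. The 4 bounds the
    squared length of [q], which joins two points of the unit ball. The axial trajectory itself is
    never analysed. It enters only through the sum over [n] of the means of [(s - X_n)^-d] while the
    walk survives. The bounds for all nonnegative test functions share this sum, and for the
    constant 1 they bound the probability of the conditioning event. Hence the sum cancels in the
    conditional mean, once it is known to be positive and finite. *)

Lemma measurable_coord n (i : 'I_n) (j : 'I_1) :
  measurable_fun setT (fun v : borel_cV R n => v i j).
Proof.
apply: (measurability _ (RGenOpens.measurableE R)) => _ [_ [a [b ->] <-]].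
rewrite setTI; apply: sub_sigma_algebra.
apply: (@open_comp _ _ (fun v : 'cV[R]_n => v i j)); last exact: interval_open.
by move=> v _; exact: coord_continuous.
Qed.

Lemma continuous_measurable_cV n (f : 'cV[R]_n -> R) : continuous f ->
  measurable_fun setT (f : borel_cV R n -> R).
Proof.
move=> cf; apply: (measurability _ (RGenOpens.measurableE R)) => _ [_ [a [b ->] <-]].
rewrite setTI; apply: sub_sigma_algebra.
by apply: open_comp; [move=> v _; exact: cf | exact: interval_open].
Qed.

(** Every open set is a countable union of sup-norm boxes with rational centers and radii [1/(k+1)],
    and the preimage of a box involves the coordinates only. *)
Lemma measurable_cVP d (T : measurableType d) n (f : T -> borel_cV R n) :
  (forall i, measurable_fun setT (fun x => f x i 0)) -> measurable_fun setT f.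
Proof.
move=> mf; apply: (@measurability _ _ T (borel_cV R n) setT f (@open 'cV[R]_n)) => [//|].
move=> _ [W oW <-].
rewrite setTI.
pose box (q : 'cV[rat]_n * nat) : set 'cV[R]_n :=
  [set v | forall i, `|ratr (q.1 i 0) - v i 0| < q.2.+1%:R^-1].
rewrite (_ : f @^-1` W = \bigcup_q (f @^-1` (if `[< box q `<=` W >] then box q else set0))).
  apply: countable_bigcupT_measurable => [|q]; first exact: countableP.
  case: asboolP => [_|_]; last by rewrite preimage_set0.
  rewrite (_ : _ @^-1` _ =
    \bigcap_i ((fun x => `|ratr (q.1 i 0) - f x i 0|) @^-1` `]-oo, q.2.+1%:R^-1[)).
    apply: fin_bigcap_measurable => // i _; rewrite -[X in measurable X]setTI.
    have mfi : measurable_fun setT (fun x => `|ratr (q.1 i 0) - f x i 0|).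
      apply: (measurableT_comp (@normr_measurable R setT)).
      exact: measurable_funB.
    exact: mfi.
  apply/seteqP; split => x /= H; first by move=> i _; rewrite /= in_itv/=; exact: H.
  by move=> i; have := H i I; rewrite /= in_itv.
apply/seteqP; split => x /=; last first.
  by move=> [q _]; case: asboolP => // h; exact: h.
move=> Wfx; have : nbhs (f x : 'cV[R]_n) W by apply: open_nbhs_nbhs.
move=> /nbhs_ballP [e /= e0 eW].
(* A rational center within [1/(k+1) < e/2] of [f x] gives a box that contains [f x] and stays in
   the [e]-ball around it, hence in [W]. *)
pose k := Num.truncn (2 / e); have ke : k.+1%:R^-1 < e / 2.
  rewrite -[e / 2]invrK ltf_pV2 ?posrE ?invr_gt0 ?divr_gt0//.
  by rewrite invf_div; exact: Num.Theory.truncnS_gt.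
have k0 : 0 < k.+1%:R^-1 :> R by rewrite invr_gt0.
have /choice[q qE] (i : 'I_n) : exists q : rat, `|ratr q - f x i 0| < k.+1%:R^-1.
  have /rat_in_itvoo[q] : f x i 0 - k.+1%:R^-1 < f x i 0 + k.+1%:R^-1.
    by rewrite ltrD2l gtrN.
  rewrite in_itv/= => /andP[q1 q2]; exists q.
  by rewrite ltr_distl q1 q2.
exists (\col_i q i, k) => //=; case: asboolP => [_ i|].
  by rewrite mxE; exact: qE.
case => v vB; apply: eW; split=> // i j; rewrite (ord1 j) /ball /=.
have := vB i; rewrite mxE /= => vq.
rewrite distrC (le_lt_trans (ler_distD (ratr (q i)) _ _))// distrC.
by rewrite (splitr e) ltrD// (lt_trans _ ke)// qE.
Qed.

Definition vcons n (x : R) (v : 'cV[R]_n) : 'cV[R]_n.+1 :=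
  col_mx (x%:M : 'cV_1) v.

Definition vtail n (v : 'cV[R]_n.+1) : 'cV[R]_n := \col_i v (lift ord0 i) 0.

Lemma vcons0 n x (v : 'cV[R]_n) j : vcons x v ord0 j = x.
Proof.
rewrite (ord1 j) /vcons (_ : ord0 = lshift n (ord0 : 'I_1)); last exact/val_inj.
by rewrite (@col_mxEu _ 1 n 1) mxE eqxx.
Qed.

Lemma vconsS n x (v : 'cV[R]_n) i j : vcons x v (lift ord0 i) j = v i j.
Proof.
rewrite /vcons (_ : lift ord0 i = rshift 1 i); last exact/val_inj.
by rewrite (@col_mxEd _ 1 n 1).
Qed.

Lemma vtailE n (v : 'cV[R]_n.+1) i j : vtail v i j = v (lift ord0 i) 0.
Proof. by rewrite mxE. Qed.

Lemma vconsK n x (v : 'cV[R]_n) : vtail (vcons x v) = v.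
Proof. by apply/colP => i; rewrite vtailE vconsS. Qed.

Lemma vcons_eta n (v : 'cV[R]_n.+1) : vcons (v ord0 0) (vtail v) = v.
Proof.
apply/colP => i; have [j ->|->] := unliftP ord0 i; last by rewrite vcons0.
by rewrite vconsS vtailE.
Qed.

Lemma measurable_vcons d (T : measurableType d) n (f : T -> R)
    (g : T -> borel_cV R n) : measurable_fun setT f -> measurable_fun setT g ->
  measurable_fun setT (fun x => vcons (f x) (g x) : borel_cV R n.+1).
Proof.
move=> mf mg; apply: measurable_cVP => i; have [j ->|->] := unliftP ord0 i; last first.
  by under eq_fun do rewrite vcons0.
under eq_fun do rewrite vconsS.
exact: (measurableT_comp (measurable_coord j 0)).
Qed.

Lemma measurable_vtail n :
  measurable_fun setT (@vtail n : borel_cV R n.+1 -> borel_cV R n).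
Proof.
apply: measurable_cVP => i; under eq_fun do rewrite vtailE.
exact: measurable_coord.
Qed.

End borel_column_spaces.

(** * Images of measures *)

Section image_measures.
Local Open Scope ereal_scope.
Context d d' (T : measurableType d) (T' : measurableType d') {R : realType}.

(** The proof [mf] is an argument so that the measure and probability structures declared below can
    be inferred from the term alone. *)
Definition image_measure (m : set T -> \bar R) (f : T -> T')
  (mf : measurable_fun setT f) : set T' -> \bar R := fun A => m (f @^-1` A).

Variables (m : {measure set T -> \bar R}) (f : T -> T').
Hypothesis mf : measurable_fun setT f.

Let image0 : image_measure m mf set0 = 0.
Proof. by rewrite /image_measure preimage_set0 measure0. Qed.

Let image_ge0 A : 0 <= image_measure m mf A.
Proof. exact: measure_ge0. Qed.

Let image_sigma_additive : semi_sigma_additive (image_measure m mf).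
Proof.
move=> F mF tF mUF; rewrite /image_measure preimage_bigcup.
apply: measure_semi_sigma_additive.
- by move=> n; rewrite -[X in measurable X]setTI; exact: mf.
- apply/trivIsetP => /= i j _ _ ij; rewrite -preimage_setI.
  by move/trivIsetP : tF => /(_ _ _ _ _ ij) ->//; rewrite preimage_set0.
- by rewrite -preimage_bigcup -[X in measurable X]setTI; exact: mf.
Qed.

HB.instance Definition _ := isMeasure.Build _ _ _ (image_measure m mf)
  image0 image_ge0 image_sigma_additive.

Lemma ge0_integral_image (g : T' -> \bar R) : measurable_fun setT g ->
  (forall y, 0 <= g y) -> \int[image_measure m mf]_y g y = \int[m]_x g (f x).
Proof.
move=> mg g0; have -> : \int[image_measure m mf]_y g y =
    \int[pushforward m f]_(y in setT) g y by [].
by rewrite ge0_integral_pushforward// preimage_setT.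
Qed.

End image_measures.

Section image_probability.
Context d d' (T : measurableType d) (T' : measurableType d') {R : realType}.
Variables (P : probability T R) (f : T -> T') (mf : measurable_fun setT f).

Let image_setT : image_measure P mf setT = 1%E.
Proof. by rewrite /image_measure preimage_setT probability_setT. Qed.

HB.instance Definition _ := Measure_isProbability.Build _ _ _
  (image_measure P mf) image_setT.

End image_probability.

(** * Finite products of measures on the line *)

Section product_measures.
Context {R : realType}.

Lemma measurable_vcons_pair n :
  measurable_fun setT (fun p : measurableTypeR R * borel_cV R n => vcons p.1 p.2 : borel_cV R n.+1).
Proof. exact: measurable_vcons. Qed.

Section cons_measure.
Local Open Scope ereal_scope.
Variables (n : nat) (m1 : {sigma_finite_measure set (measurableTypeR R) -> \bar R}).
Variable m2 : {sigma_finite_measure set (borel_cV R n) -> \bar R}.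

Definition cons_measure : set (borel_cV R n.+1) -> \bar R :=
  image_measure (m1 \x m2) (@measurable_vcons_pair n).

HB.instance Definition _ := Measure.on cons_measure.

Lemma cons_measure_rect (A : set (measurableTypeR R)) (B : set (borel_cV R n)) :
  measurable A -> measurable B ->
  cons_measure [set v : 'cV[R]_n.+1 | A (v ord0 ord0) /\ B (vtail v)] = m1 A * m2 B.
Proof.
move=> mA mB; rewrite -product_measure1E//.
rewrite /cons_measure /image_measure; congr (product_measure1 _ _ _).
by apply/seteqP; split => -[x v] /=; rewrite vcons0 vconsK.
Qed.

Let cons_sigma_finite : sigma_finite setT cons_measure.
Proof.
have /sigma_finiteP[F [FT ndF Foo]] := sigma_finiteT m1.
have /sigma_finiteP[G [GT ndG Goo]] := sigma_finiteT m2.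
exists (fun k => [set v : 'cV[R]_n.+1 | F k (v ord0 ord0) /\ G k (vtail v)]).
  apply/esym/seteqP; split => // v _.
  have : (\bigcup_k F k) (v ord0 ord0) by rewrite -FT.
  have : (\bigcup_k G k) (vtail v) by rewrite -GT.
  move=> [k _ Gk] [j _ Fj]; exists (maxn j k) => //; split.
  - by move: (v ord0 ord0) Fj; exact/subsetPset/ndF/leq_maxl.
  - by move: (vtail v) Gk; exact/subsetPset/ndG/leq_maxr.
move=> k; have [mF Fk] := Foo k; have [mG Gk] := Goo k; split.
  apply: measurableI.
    by rewrite -[X in measurable X]setTI; exact: measurable_coord.
  by rewrite -[X in measurable X]setTI; exact: measurable_vtail.
rewrite cons_measure_rect//.
by rewrite lte_mul_pinfty// ge0_fin_numE.
Qed.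

HB.instance Definition _ := Measure_isSigmaFinite.Build _ _ _ cons_measure
  cons_sigma_finite.

End cons_measure.

(** The factors form a sequence indexed by [nat], so that its tail [mu \o S] serves the recursion in
    every dimension; in dimension 0 the only column has mass 1. *)
Fixpoint prodm n (mu : nat -> {sigma_finite_measure set (measurableTypeR R) -> \bar R}) :
    {sigma_finite_measure set (borel_cV R n) -> \bar R} :=
  match n with
  | 0 => dirac (0 : borel_cV R 0)
  | n'.+1 => cons_measure (mu 0) (prodm n' (mu \o S))
  end.

(** This iterated-integral form is the one in which [volume] is defined. *)
Lemma prodm_sections n (mu : nat -> {sigma_finite_measure set (measurableTypeR R) -> \bar R})
    (A : set (borel_cV R n.+1)) :
  (prodm n.+1 mu A = \int[mu 0%N]_x prodm n (mu \o S) [set v | A (vcons x v)])%E.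
Proof.
rewrite /= /cons_measure /image_measure /product_measure1 /=.
apply: eq_integral => x _ /=; congr (_ _).
by apply/seteqP; split => v; rewrite /xsection/= inE.
Qed.

Lemma integral_prodmS n (mu : nat -> {sigma_finite_measure set (measurableTypeR R) -> \bar R})
    (g : borel_cV R n.+1 -> \bar R) : measurable_fun setT g ->
  (forall v, 0 <= g v)%E ->
  (\int[prodm n.+1 mu]_v g v =
   \int[mu 0%N]_x \int[prodm n (mu \o S)]_v g (vcons x v))%E.
Proof.
move=> mg g0; rewrite /= ge0_integral_image//.
rewrite (fubini_tonelli1 (fun p : measurableTypeR R * borel_cV R n => g (vcons p.1 p.2)))//.
by apply: (measurableT_comp mg); exact: measurable_vcons_pair.
Qed.

Lemma measurable_integral_vcons d (T : measurableType d) n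
    (m : {sigma_finite_measure set (borel_cV R n) -> \bar R})
    (g : T * borel_cV R n -> \bar R) : measurable_fun setT g ->
  (forall p, 0 <= g p)%E -> measurable_fun setT (fun x => \int[m]_v g (x, v))%E.
Proof. by move=> mg g0; exact: measurable_fun_fubini_tonelli_F. Qed.

End product_measures.

(** * Symmetries of Lebesgue measure and of product measures *)

Section lebesgue_invariance.
Context {R : realType}.
Local Notation leb := (@lebesgue_measure R).
Local Open Scope ereal_scope.

(** Lebesgue measure is determined by its values on half-open intervals, so it suffices that [h]
    preserves these. *)
Lemma lebesgue_measure_transport (h : measurableTypeR R -> measurableTypeR R)
    (mh : measurable_fun setT h) :
  (forall a b : R, leb (h @^-1` `]a, b]) = leb `]a, b]) ->
  forall g : measurableTypeR R -> \bar R, measurable_fun setT g ->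
    (forall x, 0 <= g x) -> \int[leb]_x g (h x) = \int[leb]_x g x.
Proof.
move=> hE g mg g0; rewrite -(ge0_integral_image leb mh mg g0).
apply: eq_measure_integral => A mA _.
apply/esym/lebesgue_measure_unique => // _ [[a b]] _ <-.
by rewrite -hE.
Qed.

Lemma ge0_integral_lebesgueN (g : measurableTypeR R -> \bar R) :
  measurable_fun setT g -> (forall x, 0 <= g x) ->
  \int[leb]_x g (- x)%R = \int[leb]_x g x.
Proof.
move=> mg g0; apply: (@lebesgue_measure_transport (@GRing.opp R)) => // a b.
rewrite opp_preimage_itvbndbnd !lebesgue_measure_itv/=.
by rewrite !lte_fin ltrN2 opprK addrC.
Qed.

Lemma ge0_integral_lebesgueD (c : R) (g : measurableTypeR R -> \bar R) :
  measurable_fun setT g -> (forall x, 0 <= g x) ->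
  \int[leb]_x g (x + c)%R = \int[leb]_x g x.
Proof.
move=> mg g0; apply: (@lebesgue_measure_transport (fun x : R => x + c)%R) => //.
  exact: measurable_funD.
move=> a b; rewrite (_ : _ @^-1` _ = `](a - c)%R, (b - c)%R]%classic).
  rewrite !lebesgue_measure_itv/= !lte_fin ltrD2r.
  by rewrite -!EFinD opprB addrA subrK.
by apply/seteqP; split => x /=; rewrite !in_itv/= ltrBlDr lerBrDr.
Qed.

End lebesgue_invariance.

Section product_measure_maps.
Context {R : realType}.

Definition vmap n (f : nat -> R -> R) (v : 'cV[R]_n) : 'cV[R]_n :=
  \col_i f i (v i 0).

Lemma vmap_vcons n f x (v : 'cV[R]_n) :
  vmap f (vcons x v) = vcons (f 0%N x) (vmap (fun i => f i.+1) v).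
Proof.
apply/colP => i; rewrite mxE; have [j ->|->] := unliftP ord0 i.
  by rewrite !vconsS mxE.
by rewrite !vcons0.
Qed.

Lemma measurable_vmap n (f : nat -> R -> R) :
  (forall i, (i < n)%N -> measurable_fun setT (f i)) ->
  measurable_fun setT (vmap f : borel_cV R n -> borel_cV R n).
Proof.
move=> mf; apply: measurable_cVP => i.
under eq_fun do rewrite mxE.
by apply: (measurableT_comp (mf i (ltn_ord i))); exact: measurable_coord.
Qed.

Lemma measurable_vcons2 n (x : R) :
  measurable_fun setT (vcons x : borel_cV R n -> borel_cV R n.+1).
Proof. exact: measurable_vcons. Qed.

(** Fubini, one coordinate at a time. Translation and negation of the volume and the sign changes of
    the angles are all instances. *)
Lemma integral_prodm_map n (f : nat -> R -> R)
    (mu nu : nat -> {sigma_finite_measure set (measurableTypeR R) -> \bar R}) :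
  (forall i, (i < n)%N -> measurable_fun setT (f i)) ->
  (forall i (g : measurableTypeR R -> \bar R), (i < n)%N ->
     measurable_fun setT g -> (forall x, 0 <= g x)%E ->
     \int[mu i]_x g (f i x) = \int[nu i]_x g x)%E ->
  forall g : borel_cV R n -> \bar R, measurable_fun setT g ->
    (forall v, 0 <= g v)%E ->
  (\int[prodm n mu]_v g (vmap f v) = \int[prodm n nu]_v g v)%E.
Proof.
elim: n f mu nu => [|n IH] f mu nu mf muf g mg g0.
  rewrite /= !integral_dirac//=; last first.
    by apply: (measurableT_comp mg); exact: measurable_vmap.
  by rewrite !diracT (flatmx0 (vmap _ _)).
rewrite !integral_prodmS//; last first.
  by apply: (measurableT_comp mg); exact: measurable_vmap.
transitivity (\int[mu 0%N]_x \int[prodm n (nu \o S)]_v g (vcons (f 0%N x) v))%E.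
  apply: eq_integral => x _; under eq_integral do rewrite vmap_vcons.
  apply: (IH (fun i => f i.+1) (mu \o S) (nu \o S) _ _ (fun v => g (vcons (f 0%N x) v))) => //.
  - by move=> i lin; exact: mf.
  - by move=> i h lin; exact: muf.
  - by apply: (measurableT_comp mg); exact: measurable_vcons2.
rewrite (muf 0%N (fun y => \int[prodm n (nu \o S)]_v g (vcons y v))%E)//.
- apply: (@measurable_integral_vcons _ _ _ _ _ (fun p => g (vcons p.1 p.2))) => //.
  by apply: (measurableT_comp mg); exact: measurable_vcons_pair.
- by move=> x; exact: integral_ge0.
Qed.

End product_measure_maps.

Section volume_measure.
Context {R : realType}.

Definition vol n : {sigma_finite_measure set (borel_cV R n) -> \bar R} :=
  prodm n (fun=> @lebesgue_measure R).

Lemma volumeE n (A : set (borel_cV R n)) : measurable A -> volume A = vol n A.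
Proof.
elim: n A => [//|n IH] A mA; rewrite [RHS]prodm_sections.
transitivity (\int[@lebesgue_measure R]_x volume [set v | A (vcons x v)])%E => //.
apply: eq_integral => x _; rewrite IH//.
by rewrite -[X in measurable X]setTI; exact: measurable_vcons2.
Qed.

Lemma integral_vol_shift n (c : 'cV[R]_n) (g : borel_cV R n -> \bar R) :
  measurable_fun setT g -> (forall v, 0 <= g v)%E ->
  (\int[vol n]_v g (v + c)%R = \int[vol n]_v g v)%E.
Proof.
(* [insub] recovers the coordinate of [c] from a natural index; indices out of range are not
   shifted. *)
move=> mg g0; pose f i x := x + (if insub i is Some j then c j 0 else 0).
rewrite -[RHS](@integral_prodm_map _ _ f (fun=> @lebesgue_measure R) (fun=> @lebesgue_measure R))//.
- apply: eq_integral => v _; congr (g _); apply/colP => i.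
  by rewrite !mxE /f valK.
- by move=> i _; exact: measurable_funD.
- by move=> i h _; exact: ge0_integral_lebesgueD.
Qed.

Lemma integral_vol_opp n (g : borel_cV R n -> \bar R) :
  measurable_fun setT g -> (forall v, 0 <= g v)%E ->
  (\int[vol n]_v g (- v)%R = \int[vol n]_v g v)%E.
Proof.
move=> mg g0; pose f (i : nat) (x : R) := - x.
rewrite -[RHS](@integral_prodm_map _ _ f (fun=> @lebesgue_measure R) (fun=> @lebesgue_measure R))//.
- apply: eq_integral => v _; congr (g _); apply/colP => i.
  by rewrite !mxE.
- by move=> i _; exact: measurable_funN.
- by move=> i h _; exact: ge0_integral_lebesgueN.
Qed.

End volume_measure.

Section measurable_vector_operations.
Context {R : realType} d (T : measurableType d).

Lemma measurable_natr_bool (b : T -> bool) : measurable_fun setT b ->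
  measurable_fun setT (fun x => (b x)%:R : R).
Proof.
move=> mb; rewrite (_ : (fun x => _) = (fun x => if b x then 1 else 0)).
  exact: measurable_fun_ifT.
by apply/funext => x; case: (b x).
Qed.

Lemma measurable_cVD n (f g : T -> borel_cV R n) : measurable_fun setT f ->
  measurable_fun setT g ->
  measurable_fun setT (fun x => (f x + g x)%R : borel_cV R n).
Proof.
move=> mf mg; apply: measurable_cVP => i; under eq_fun do rewrite mxE.
by apply: measurable_funD; exact: (measurableT_comp (measurable_coord _ _)).
Qed.

Lemma measurable_cVZ n (a : T -> R) (f : T -> borel_cV R n) :
  measurable_fun setT a -> measurable_fun setT f ->
  measurable_fun setT (fun x => (a x *: f x)%R : borel_cV R n).
Proof.
move=> ma mf; apply: measurable_cVP => i; under eq_fun do rewrite mxE.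
by apply: measurable_funM => //; exact: (measurableT_comp (measurable_coord _ _)).
Qed.

Lemma measurable_cVN n (f : T -> borel_cV R n) : measurable_fun setT f ->
  measurable_fun setT (fun x => (- f x)%R : borel_cV R n).
Proof.
move=> mf; apply: measurable_cVP => i; under eq_fun do rewrite mxE.
by apply: measurable_funN; exact: (measurableT_comp (measurable_coord _ _)).
Qed.

Lemma measurable_cVB n (f g : T -> borel_cV R n) : measurable_fun setT f ->
  measurable_fun setT g ->
  measurable_fun setT (fun x => (f x - g x)%R : borel_cV R n).
Proof. by move=> mf mg; apply: measurable_cVD => //; exact: measurable_cVN. Qed.

Lemma measurable_mulmx n (A : T -> 'M[R]_n) (f : T -> borel_cV R n) :
  (forall i j, measurable_fun setT (fun x => A x i j)) -> measurable_fun setT f ->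
  measurable_fun setT (fun x => (A x *m f x)%R : borel_cV R n).
Proof.
move=> mA mf; apply: measurable_cVP => i; under eq_fun do rewrite mxE.
apply: measurable_sum => j; apply: measurable_funM => //.
exact: (measurableT_comp (measurable_coord _ _)).
Qed.

Lemma measurable_sqnorm n (f : T -> borel_cV R n) : measurable_fun setT f ->
  measurable_fun setT (fun x => sqnorm (f x)).
Proof.
move=> mf; apply: measurable_sum => i; apply: measurable_funX.
exact: (measurableT_comp (measurable_coord _ _)).
Qed.

End measurable_vector_operations.

(** * Euclidean geometry, balls and spheres *)

Section dot_products.
Context {R : realType}.

Definition dotv n (u v : 'cV[R]_n) : R := \sum_(i < n) u i 0 * v i 0.

Lemma dotvE n (u v : 'cV[R]_n) : dotv u v = (u^T *m v) 0 0.
Proof. by rewrite mxE; apply: eq_bigr => i _; rewrite mxE. Qed.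

Lemma dotvv n (u : 'cV[R]_n) : dotv u u = sqnorm u.
Proof. by apply: eq_bigr => i _; rewrite expr2. Qed.

Lemma dotvDr n (u v w : 'cV[R]_n) : dotv u (v + w) = dotv u v + dotv u w.
Proof. by rewrite !dotvE mulmxDr mxE. Qed.

Lemma dotvZr n (a : R) (u v : 'cV[R]_n) : dotv u (a *: v) = a * dotv u v.
Proof. by rewrite !dotvE -scalemxAr mxE. Qed.

Lemma dotvC n (u v : 'cV[R]_n) : dotv u v = dotv v u.
Proof. by apply: eq_bigr => i _; rewrite mulrC. Qed.

Lemma dotvNr n (u v : 'cV[R]_n) : dotv u (- v) = - dotv u v.
Proof. by rewrite -scaleN1r dotvZr mulN1r. Qed.

Lemma dotv_orthogonal n (M : 'M[R]_n) (u v : 'cV[R]_n) : orthogonal_mx M ->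
  dotv (M *m u) (M *m v) = dotv u v.
Proof.
by move=> oM; rewrite !dotvE trmx_mul -mulmxA (mulmxA M^T) oM mul1mx.
Qed.

Lemma sqnorm_orthogonal n (M : 'M[R]_n) (u : 'cV[R]_n) : orthogonal_mx M ->
  sqnorm (M *m u) = sqnorm u.
Proof. by move=> oM; rewrite -!dotvv dotv_orthogonal. Qed.

Lemma sqnorm_ge0 n (u : 'cV[R]_n) : 0 <= sqnorm u.
Proof. by apply: sumr_ge0 => i _; exact: sqr_ge0. Qed.

Lemma sqnormD n (u v : 'cV[R]_n) :
  sqnorm (u + v) = sqnorm u + 2 * dotv u v + sqnorm v.
Proof. by rewrite -!dotvv dotvDr dotvC dotvDr (dotvC (u + v)) dotvDr (dotvC v u); ring. Qed.

Lemma dotv_le1 n (u v : 'cV[R]_n) : sqnorm u <= 1 -> sqnorm v <= 1 ->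
  `|dotv u v| <= 1.
Proof.
move=> u1 v1; have h1 := sqnorm_ge0 (u + v); have h2 := sqnorm_ge0 (u - v).
rewrite sqnormD in h1; rewrite sqnormD -[sqnorm (- v)]dotvv !dotvNr in h2.
rewrite (dotvC (- v)) dotvNr opprK dotvv in h2.
by rewrite ler_norml; apply/andP; split; lra.
Qed.

Lemma sqr_coord_le n (u : 'cV[R]_n) i : u i 0 ^+ 2 <= sqnorm u.
Proof.
by rewrite /sqnorm (bigD1 i)//= lerDl sumr_ge0// => j _; exact: sqr_ge0.
Qed.

Lemma measurable_dotv d (T : measurableType d) n (f g : T -> borel_cV R n) :
  measurable_fun setT f -> measurable_fun setT g ->
  measurable_fun setT (fun x => dotv (f x) (g x)).
Proof.
move=> mf mg; apply: measurable_sum => i.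
by apply: measurable_funM; exact: (measurableT_comp (measurable_coord _ _)).
Qed.

Lemma sqnorm_vcons n x (v : 'cV[R]_n) : sqnorm (vcons x v) = x ^+ 2 + sqnorm v.
Proof.
rewrite /sqnorm big_ord_recl vcons0; congr (_ + _).
by apply: eq_bigr => i _; rewrite vconsS.
Qed.

End dot_products.

Section balls.
Context {R : realType}.

Lemma measurable_sqnorm_id n : measurable_fun setT (fun v : borel_cV R n => sqnorm v).
Proof. exact: (@measurable_sqnorm R _ (borel_cV R n) n id). Qed.

Lemma measurable_uball n : measurable (@uball R n : set (borel_cV R n)).
Proof.
rewrite (_ : uball (n := n) = (fun v : borel_cV R n => sqnorm v) @^-1` `]-oo, 1]).
  by rewrite -[X in measurable X]setTI; exact: measurable_sqnorm_id.
by apply/seteqP; split => v; rewrite /= in_itv.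
Qed.

Lemma measurable_sqnorm_level n (r : R) :
  measurable ([set v | sqnorm v = r] : set (borel_cV R n)).
Proof.
rewrite (_ : mkset _ = (fun v : borel_cV R n => sqnorm v) @^-1` [set r]).
  by rewrite -[X in measurable X]setTI; exact: measurable_sqnorm_id.
by apply/seteqP; split.
Qed.

Lemma measurable_usphere n : measurable (@usphere R n : set (borel_cV R n)).
Proof. exact: measurable_sqnorm_level. Qed.

Definition cube n (r : R) : set 'cV[R]_n := [set v | forall i, `|v i 0| <= r].

Lemma cubeS n r : cube (n := n.+1) r =
  [set v : 'cV[R]_n.+1 | `[- r, r]%classic (v ord0 0) /\ cube r (vtail v)].
Proof.
apply/seteqP; split => v /=.
  move=> vr; split; first by rewrite /= in_itv/= -ler_norml.
  by move=> i; rewrite vtailE.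
move=> [v0 vt] i; have [j ->|->] := unliftP ord0 i.
  by have := vt j; rewrite vtailE.
by move: v0; rewrite /= in_itv/= -ler_norml.
Qed.

Lemma measurable_cube n r : measurable (cube r : set (borel_cV R n)).
Proof.
elim: n => [|n IH].
  by rewrite (_ : cube r = setT)//; apply/seteqP; split => // v _ [].
rewrite cubeS; apply: measurableI; rewrite -[X in measurable X]setTI.
  exact: measurable_coord.
exact: measurable_vtail.
Qed.

Lemma vol_cube n (r : R) : 0 <= r -> vol n (cube r) = ((2 * r) ^+ n)%:E.
Proof.
move=> r0; elim: n => [|n IH].
  rewrite /vol/= (_ : cube r = setT) ?diracT//.
  by apply/seteqP; split => // v _ [].
rewrite cubeS [LHS]cons_measure_rect//; last exact: measurable_cube.
transitivity (@lebesgue_measure R `[(- r)%R, r] * vol n (cube r))%E => //.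
rewrite IH lebesgue_measure_itv/= exprS EFinM; congr (_ * _)%E; rewrite lte_fin -EFinD opprK.
by case: ifPn => h; congr (_%:E); lra.
Qed.

Lemma coord_uball n (v : 'cV[R]_n) i : sqnorm v <= 1 -> `|v i 0| <= 1.
Proof.
move=> v1; rewrite -(@ler_pXn2r _ 2)// ?nnegrE// expr1n.
by rewrite real_normK ?num_real// (le_trans (sqr_coord_le _ _)).
Qed.

Lemma vol_uball_lty n : (vol n (@uball R n) < +oo)%E.
Proof.
apply: (@le_lt_trans _ _ (vol n (cube 1))); last by rewrite vol_cube// ltry.
apply: le_measure; rewrite ?inE; [exact: measurable_uball|exact: measurable_cube|].
by move=> v v1 i; exact: coord_uball.
Qed.

(** The cube of half-side [1/(n+1)] lies in the ball, because [n / (n+1)^2 <= 1]. *)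
Lemma vol_uball_gt0 n : (0 < vol n (@uball R n))%E.
Proof.
have r0 : 0 < n.+1%:R^-1 :> R by rewrite invr_gt0.
apply: (@lt_le_trans _ _ (vol n (cube n.+1%:R^-1))).
  by rewrite vol_cube ?ltW// lte_fin exprn_gt0// mulr_gt0.
apply: le_measure; rewrite ?inE; [exact: measurable_cube|exact: measurable_uball|].
move=> v vr /=; apply: (@le_trans _ _ (\sum_(i < n) n.+1%:R^-1)).
  apply: ler_sum => i _; rewrite -real_normK ?num_real//.
  apply: (@le_trans _ _ (n.+1%:R^-1 ^+ 2)).
    by rewrite ler_pXn2r ?nnegrE// ltW.
  by rewrite expr2 ler_piMl ?(ltW r0)// invf_le1// ler1n.
rewrite sumr_const card_ord -[_ *+ n]mulr_natr mulrC ler_pdivrMr// mul1r.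
by rewrite ler_nat.
Qed.

Lemma lebesgue_sqr_level (r : R) : @lebesgue_measure R [set x : R | x ^+ 2 = r] = 0%E.
Proof.
apply: countable_lebesgue_measure0; apply: finite_set_countable.
have [[a ar]|h] := pselect (exists a, a ^+ 2 = r); last first.
  by rewrite (_ : mkset _ = set0)// -subset0 => x xr; apply: h; exists x.
apply: (sub_finite_set _ (finite_set2 a (- a))) => x /= /eqP.
by rewrite -ar eqf_sqr => /orP[/eqP|/eqP]; [left|right].
Qed.

(** By Fubini: the section of a sphere at height [x] is a sphere of squared radius [r - x ^+ 2],
    possibly negative, whence the arbitrary [r]. The induction starts in dimension 1, where the
    level is finite; in dimension 0 the level [r = 0] has mass 1. *)
Lemma vol_sqnorm_level n (r : R) : vol n.+1 [set v | sqnorm v = r] = 0%E.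
Proof.
elim: n r => [|n IH] r; rewrite /vol prodm_sections.
  rewrite (eq_integral (fun x : measurableTypeR R => (\1_[set x : R | x ^+ 2 = r] x)%:E)).
    rewrite integral_indic//; first by rewrite setIT; exact: lebesgue_sqr_level.
    rewrite (_ : mkset _ = (fun x : measurableTypeR R => x ^+ 2) @^-1` [set r]).
      by rewrite -[X in measurable X]setTI; exact: exprn_measurable.
    by apply/seteqP; split.
  move=> x _; rewrite /vol/= diracE indicE; congr ((nat_of_bool _)%:R%:E).
  by apply/idP/idP; rewrite !inE /= sqnorm_vcons /sqnorm big_ord0 addr0.
apply: integral0_eq => x _; rewrite (_ : mkset _ = [set v | sqnorm v = r - x ^+ 2]).
  exact: IH.
apply/seteqP; split => v /=; rewrite sqnorm_vcons => h.
  by rewrite -h addrC addKr.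
by rewrite h addrC subrK.
Qed.

End balls.

Lemma integral_swap {R : realType} d1 d2 (T1 : measurableType d1)
    (T2 : measurableType d2) (m1 : {sigma_finite_measure set T1 -> \bar R})
    (m2 : {sigma_finite_measure set T2 -> \bar R}) (F : T1 -> T2 -> \bar R) :
  measurable_fun setT (fun p : T1 * T2 => F p.1 p.2) ->
  (forall x y, 0 <= F x y)%E ->
  (\int[m1]_x \int[m2]_y F x y = \int[m2]_y \int[m1]_x F x y)%E.
Proof.
by move=> mF F0; rewrite (fubini_tonelli (fun p => F p.1 p.2)).
Qed.

(** * Rotation invariance of the volume *)

Section rotation_invariance.
Context {R : realType} (n : nat) (M : 'M[R]_n).
Hypothesis oM : orthogonal_mx M.
Local Open Scope ereal_scope.

Let measurable_M (f : borel_cV R n -> \bar R) : measurable_fun setT f ->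
  measurable_fun setT (fun v : borel_cV R n => f (M *m v)%R).
Proof.
move=> mf; apply: (measurableT_comp mf).
by apply: (measurable_mulmx (f := id)) => // i j.
Qed.

(* The argument for uniqueness of Haar measure: both sides equal the integral of
   f(Mx) g(y + Mx) over pairs (x, y). *)
Lemma integral_orthogonal_exchange (f g : borel_cV R n -> \bar R) :
  measurable_fun setT f -> (forall v, 0 <= f v) ->
  measurable_fun setT g -> (forall v, 0 <= g v) ->
  (\int[vol n]_v f (M *m v)%R) * \int[vol n]_v g v =
  (\int[vol n]_v g (M *m v)%R) * \int[vol n]_v f v.
Proof.
move=> mf f0 mg g0.
have mMfst : measurable_fun setT
    (fun p : borel_cV R n * borel_cV R n => (M *m p.1)%R : borel_cV R n).
  by apply: measurable_mulmx => // i j.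
have mMsnd : measurable_fun setT
    (fun p : borel_cV R n * borel_cV R n => (M *m p.2)%R : borel_cV R n).
  by apply: measurable_mulmx => // i j.
have If0 : 0 <= \int[vol n]_v f v by exact: integral_ge0.
have Ig0 : 0 <= \int[vol n]_v g v by exact: integral_ge0.
transitivity (\int[vol n]_x (f (M *m x)%R * \int[vol n]_y g y)).
  by rewrite (ge0_integralZr _ measurableT (measurable_M mf) _ Ig0).
transitivity (\int[vol n]_x (g (M *m x)%R * \int[vol n]_y f y)); last first.
  by rewrite (ge0_integralZr _ measurableT (measurable_M mg) _ If0).
transitivity (\int[vol n]_x \int[vol n]_y (f (M *m x)%R * g (y + M *m x)%R)).
  apply: eq_integral => x _; rewrite -(integral_vol_shift (M *m x) mg)//.
  rewrite -ge0_integralZl//.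
  by apply: (measurableT_comp mg); exact: measurable_cVD.
rewrite integral_swap; last 2 first.
- apply: emeasurable_funM; [exact: (measurableT_comp mf)|].
  by apply: (measurableT_comp mg); exact: measurable_cVD.
- by move=> x y; exact: mule_ge0.
(* For fixed [y], replace [x] by [x - M^T y]; since [M M^T = 1], the shift by [y] moves from the
   argument of [g] to that of [f]. *)
transitivity (\int[vol n]_y \int[vol n]_x (f (M *m x - y)%R * g (M *m x)%R)).
  apply: eq_integral => y _.
  rewrite -(@integral_vol_shift _ _ (- (M^T *m y))%R (fun x => f (M *m x)%R * g (y + M *m x)%R))//.
  - apply: eq_integral => x _; rewrite mulmxDr mulmxN mulmxA.
    by rewrite (mulmx1C oM) mul1mx (addrC (M *m x)%R) addNKr addrC.
  - apply: emeasurable_funM; [exact: measurable_M|].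
    apply: (measurableT_comp mg); apply: measurable_cVD => //.
    by apply: (measurable_mulmx (f := id)) => // i j.
  - by move=> v; exact: mule_ge0.
rewrite integral_swap; last 2 first.
- apply: emeasurable_funM; [|exact: (measurableT_comp mg)].
  by apply: (measurableT_comp mf); exact: measurable_cVB.
- by move=> x y; exact: mule_ge0.
(* For fixed [x], the integral of [f (Mx - y)] in [y] is that of [f], by negation and a translation
   by [- Mx]. *)
apply: eq_integral => x _; rewrite muleC -(integral_vol_opp mf)//.
rewrite -(@integral_vol_shift _ _ (- (M *m x))%R (fun y => f (- y)%R))//; last first.
  by apply: (measurableT_comp mf); exact: measurable_cVN.
rewrite muleC ge0_integralZr//; last first.
  by apply: (measurableT_comp mf); exact: measurable_cVB.
rewrite muleC; congr (_ * _); apply: eq_integral => y _.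
by rewrite opprB.
Qed.

(** In the exchange identity take for [g] the indicator of the unit ball: it is invariant under [M],
    and its integral is positive and finite, so it cancels. *)
Lemma integral_vol_orthogonal (f : borel_cV R n -> \bar R) :
  measurable_fun setT f -> (forall v, 0 <= f v) ->
  \int[vol n]_v f (M *m v)%R = \int[vol n]_v f v.
Proof.
move=> mf f0; pose g (v : borel_cV R n) : \bar R := (\1_(@uball R n) v)%:E.
have gE : \int[vol n]_v g v = vol n (@uball R n).
  by rewrite integral_indic ?setIT//; exact: measurable_uball.
have mg : measurable_fun setT g.
  by apply/measurable_EFinP/measurable_indic; exact: measurable_uball.
have g0 v : 0 <= g v by rewrite lee_fin.
have := integral_orthogonal_exchange mf f0 mg g0.
have -> : \int[vol n]_v g (M *m v)%R = \int[vol n]_v g v.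
  apply: eq_integral => v _; rewrite /g !indicE; congr ((nat_of_bool _)%:R%:E).
  by apply/idP/idP; rewrite !inE /uball/= sqnorm_orthogonal.
rewrite gE.
have b0 := @vol_uball_gt0 R n; have boo := @vol_uball_lty R n.
have bfin : vol n (@uball R n) \is a fin_num by rewrite ge0_fin_numE.
rewrite [RHS]muleC => H; apply/eqP.
rewrite eq_le -(lee_pmul2r bfin b0) H lexx /=.
by rewrite -(lee_pmul2r bfin b0) H lexx.
Qed.

End rotation_invariance.

(** * Laws of the angles and of the slope *)

Section density_measures.
Local Open Scope ereal_scope.
Context d (T : measurableType d) {R : realType}.

Definition dens (m : set T -> \bar R) (rho : T -> R)
    (mrho : measurable_fun setT rho) (rho0 : forall x, (0 <= rho x)%R) :
  set T -> \bar R := fun A => \int[m]_(x in A) (rho x)%:E.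

Variables (m : {measure set T -> \bar R}) (rho : T -> R).
Hypotheses (mrho : measurable_fun setT rho) (rho0 : forall x, (0 <= rho x)%R).

Let erho0 x : 0 <= (rho x)%:E. Proof. by rewrite lee_fin. Qed.
Let emrho : measurable_fun setT (fun x => (rho x)%:E).
Proof. exact/measurable_EFinP. Qed.

Let densm0 : dens m mrho rho0 set0 = 0.
Proof. by rewrite /dens integral_set0. Qed.

Let densm_ge0 A : 0 <= dens m mrho rho0 A.
Proof. exact: integral_ge0. Qed.

Let densm_sigma_additive : semi_sigma_additive (dens m mrho rho0).
Proof.
move=> F mF tF mUF; rewrite /dens; apply: cvg_toP.
  apply: ereal_nondecreasing_is_cvgn => k l kl.
  by apply: lee_sum_nneg_natr => // j _ _; exact: integral_ge0.
by rewrite ge0_integral_bigcup//; exact/measurable_funTS/emrho.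
Qed.

HB.instance Definition _ := isMeasure.Build _ _ _ (dens m mrho rho0)
  densm0 densm_ge0 densm_sigma_additive.

Let integral_dens_indic (E : set T) : measurable E ->
  \int[dens m mrho rho0]_x (\1_E x)%:E = \int[m]_x ((rho x)%:E * (\1_E x)%:E).
Proof.
move=> mE; rewrite integral_indic//= /dens setIT integral_mkcond.
by rewrite epatch_indic.
Qed.

Import HBNNSimple.

Let integral_dens_nnsfun (f : {nnsfun T >-> R}) :
  \int[dens m mrho rho0]_x (f x)%:E = \int[m]_x ((rho x)%:E * (f x)%:E).
Proof.
under [LHS]eq_integral do rewrite fimfunE -fsumEFin//.
rewrite [LHS]ge0_integral_fsum//; last 2 first.
  - by move=> r; exact/measurable_EFinP/measurableT_comp.
  - by move=> n x _; rewrite EFinM nnfun_muleindic_ge0.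
under [RHS]eq_integral.
  move=> x _; rewrite fimfunE -fsumEFin// ge0_mule_fsumr; last first.
    by move=> r; rewrite EFinM nnfun_muleindic_ge0.
  over.
rewrite [RHS]ge0_integral_fsum//; last 2 first.
  - move=> r; apply: emeasurable_funM => //.
    by apply/measurable_EFinP; do 2 apply/measurableT_comp => //.
  - by move=> n x _; rewrite EFinM mule_ge0//; exact: nnfun_muleindic_ge0.
apply: eq_fsbigr => r _.
transitivity (r%:E * \int[m]_x ((rho x)%:E * (\1_(f @^-1` [set r]) x)%:E)).
  have -> : \int[dens m mrho rho0]_x (r * \1_(f @^-1` [set r]) x)%:E =
      r%:E * \int[dens m mrho rho0]_x (\1_(f @^-1` [set r]) x)%:E.
    by rewrite integralZl_indic_nnsfun.
  by rewrite integral_dens_indic.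
have [r0|r0] := leP 0%R r.
  rewrite -ge0_integralZl//; last 2 first.
    - apply: emeasurable_funM => //.
      by apply/measurable_EFinP; exact: measurable_indic.
    - by move=> x _; rewrite mule_ge0// lee_fin.
  by apply: eq_integral => x _; rewrite EFinM muleCA.
rewrite preimage_nnfun0// !integral0_eq ?mule0// => x _;
  by rewrite indicE in_set0 !(mulr0, mule0).
Qed.

Lemma ge0_integral_dens (g : T -> \bar R) :
  measurable_fun setT g -> (forall x, 0 <= g x) ->
  \int[dens m mrho rho0]_x g x = \int[m]_x ((rho x)%:E * g x).
Proof.
move=> mg g0; pose g_ := nnsfun_approx measurableT mg.
transitivity (limn (fun n => \int[dens m mrho rho0]_x (g_ n x)%:E)).
  rewrite -monotone_convergence//=.
  - apply: eq_integral => ? /[!inE] xD; apply/esym/cvg_lim => //=.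
    exact: cvg_nnsfun_approx.
  - by move=> n; exact/measurable_EFinP/measurable_funTS.
  - by move=> n ? _; rewrite lee_fin.
  - by move=> ? _ ? ? mn; rewrite lee_fin; exact/lefP/nd_nnsfun_approx.
transitivity (limn (fun n => \int[m]_x ((rho x)%:E * (g_ n x)%:E))).
  by congr (limn _); apply/funext => n; rewrite integral_dens_nnsfun.
rewrite -monotone_convergence//=.
- apply: eq_integral => x _; apply/cvg_lim => //=.
  by apply: cvgeZl => //; exact: cvg_nnsfun_approx.
- by move=> n; apply: emeasurable_funM => //; exact/measurable_EFinP.
- by move=> n x _; rewrite mule_ge0// lee_fin.
- move=> x _ k l kl; rewrite lee_wpmul2l// lee_fin.
  exact/lefP/nd_nnsfun_approx.
Qed.

End density_measures.

Section laws_on_the_line.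
Context {R : realType}.
Local Notation leb := (@lebesgue_measure R).

Lemma measurable_invr : measurable_fun setT (@GRing.inv R).
Proof.
rewrite (_ : @GRing.inv R = (fun x => if x == 0 then 0 else x^-1)); last first.
  by apply/funext => x; case: eqP => // ->; rewrite invr0.
apply: measurable_fun_if => //; first exact: measurable_fun_eqr.
rewrite setTI; apply: open_continuous_measurable_fun.
  rewrite (_ : _ @^-1` _ = ~` [set 0]); first exact/closed_openC/closed_eq.
  by apply/seteqP; split => x /=; case: eqP.
by move=> x; rewrite inE /= => /eqP/eqP; case: eqP => // /eqP x0 _; exact: inv_continuous.
Qed.

Lemma measurable_funV d (T : measurableType d) (f : T -> R) :
  measurable_fun setT f -> measurable_fun setT (fun x => (f x)^-1).
Proof. by move=> mf; apply: (measurableT_comp measurable_invr). Qed.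

Lemma measurable_sqrtr : measurable_fun setT (@Num.sqrt R).
Proof. by apply: continuous_measurable_fun; exact: sqrt_continuous. Qed.

Lemma measurable_cos : measurable_fun setT (@cos R).
Proof. by apply: continuous_measurable_fun; exact: continuous_cos. Qed.

Lemma measurable_sin : measurable_fun setT (@sin R).
Proof. by apply: continuous_measurable_fun; exact: continuous_sin. Qed.

Lemma measurable_tan : measurable_fun setT (@tan R).
Proof.
apply: measurable_funM; first exact: measurable_sin.
by apply: measurable_funV; exact: measurable_cos.
Qed.

Lemma measurable_atan : measurable_fun setT (@atan R).
Proof. by apply: continuous_measurable_fun => x; exact: continuous_atan. Qed.

Lemma measure_itv_unique (m1 m2 : {measure set (measurableTypeR R) -> \bar R}) :
  (m1 setT < +oo)%E ->
  (forall a b : R, a < b -> m1 `]a, b]%classic = m2 `]a, b]%classic) ->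
  forall A, measurable A -> m1 A = m2 A.
Proof.
move=> m1oo m12.
apply: (@measure_unique _ R (measurableTypeR R) (@ocitv R)
  (fun k => `](- k%:R), k%:R]%classic)) => //.
- exact: ocitvI.
- by move=> k; exact: is_ocitv.
- apply/seteqP; split => // x _; exists (Num.truncn `|x|).+1 => //=.
  rewrite in_itv/=; have := Num.Theory.truncnS_gt `|x|.
  by rewrite ltr_norml => /andP[-> /ltW].
- by move=> A /ocitvP[->|[[a b]] /= ab ->]; rewrite ?measure0// m12.
- by move=> k; apply: le_lt_trans m1oo; apply: le_measure; rewrite ?inE.
Qed.

Lemma integral_itv_derive (F f : R -> R) (a b : R) : a < b ->
  (forall x : R, is_derive x 1 F (f x)) -> continuous f ->
  (\int[leb]_(x in `]a, b]) (f x)%:E)%E = (F b - F a)%:E.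
Proof.
move=> ab dF cf.
have mf : measurable_fun [set: measurableTypeR R] f by exact: continuous_measurable_fun.
rewrite integral_itv_obnd_cbnd; last first.
  by apply: measurable_funTS; apply/measurable_EFinP.
have cF x : {for x, continuous F}.
  by apply: differentiable_continuous; apply/derivable1_diffP; have [] := dF x.
rewrite (continuous_FTC2 ab (F := F)) ?EFinB//.
- by move=> x; apply: continuous_subspaceT.
- split.
  + by move=> x _; have [] := dF x.
  + by apply: cvg_at_right_filter; exact: cF.
  + by apply: cvg_at_left_filter; exact: cF.
- by move=> x _; rewrite derive1E; exact: derive_val.
Qed.

(** Both sides only see [D], since [g] vanishes off it. The image of [m] under [h] and the measure
    of density [f], both cut down to [D] ([m1] and [m2]), agree on half-open intervals, hence on
    Borel sets, because [m1] is finite. *)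
Lemma integral_law_density (m : {measure set (measurableTypeR R) -> \bar R})
    (h : measurableTypeR R -> measurableTypeR R) (f : R -> R) (D : set R) :
  (m setT < +oo)%E -> measurable_fun setT h -> measurable_fun setT f ->
  (forall x, 0 <= f x) -> measurable (D : set (measurableTypeR R)) ->
  (forall a b : R, a < b ->
     m (h @^-1` (`]a, b] `&` D)) = (\int[leb]_(x in `]a, b]%classic `&` D) (f x)%:E)%E) ->
  forall g : measurableTypeR R -> \bar R, measurable_fun setT g ->
    (forall x, 0 <= g x)%E -> (forall x, ~ D x -> g x = 0%E) ->
  (\int[m]_x g (h x) = \int[leb]_x ((f x)%:E * g x))%E.
Proof.
move=> moo mh mf f0 mD mE g mg g0 gD.
pose iD x : R := \1_D x.
have miD : measurable_fun [set: measurableTypeR R] iD by exact: measurable_indic.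
have iD0 x : 0 <= iD x by rewrite /iD indicE.
pose fD x : R := f x * iD x.
have mfD : measurable_fun [set: measurableTypeR R] fD by exact: measurable_funM.
have fD0 x : 0 <= fD x by exact: mulr_ge0.
pose m1 := dens (image_measure m mh) miD iD0.
pose m2 := dens leb mfD fD0.
have iDg x : ((iD x)%:E * g x = g x)%E.
  rewrite /iD indicE; case: (boolP (x \in D)) => [|xD]; first by rewrite mul1e.
  by rewrite mul0e gD//; apply/set_mem; rewrite in_setC.
transitivity (\int[m1]_x g x)%E.
  rewrite ge0_integral_dens//; under [RHS]eq_integral do rewrite iDg.
  by rewrite -(ge0_integral_image m mh mg g0).
transitivity (\int[m2]_x g x)%E; last first.
  rewrite ge0_integral_dens//; apply: eq_integral => x _.
  by rewrite /fD EFinM -muleA iDg.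
have m1E A : measurable A -> m1 A = m (h @^-1` (A `&` D)).
  by move=> mA; rewrite /m1 /dens integral_indic// setIC.
have m2E A : measurable A -> m2 A = (\int[leb]_(x in A `&` D) (f x)%:E)%E.
  move=> mA; rewrite /m2 /dens integral_mkcondr; apply: eq_integral => x _.
  by rewrite /fD /iD patchE indicE; case: ifP => _; rewrite ?mulr1 ?mulr0.
apply: eq_measure_integral => A mA _; apply: measure_itv_unique => //.
  apply: le_lt_trans moo; rewrite [leLHS](m1E setT)//.
  apply: le_measure; rewrite ?inE// setTI.
  by rewrite -[X in measurable X]setTI; exact: (mh measurableT _ mD).
by move=> a b ab; rewrite [LHS]m1E// [RHS]m2E// mE.
Qed.

End laws_on_the_line.

Lemma measure_setI_conull d (T : measurableType d) (R : realType)
    (m : {measure set T -> \bar R}) (K B : set T) :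
  measurable K -> measurable B -> m (~` K) = 0%E -> m B = m (B `&` K).
Proof.
move=> mK mB mK0; rewrite (measureDI m mB mK) [X in (X + _)%E](_ : _ = 0%E) ?add0e//.
apply: (@subset_measure0 _ _ _ m _ (~` K)) => //.
- exact: measurableD.
- exact: measurableC.
Qed.

Section angle_laws.
Context {R : realType}.
Local Notation leb := (@lebesgue_measure R).

Lemma halfpi_gt0 : 0 < pi / 2 :> R.
Proof. by rewrite divr_gt0// pi_gt0. Qed.

Lemma Nhalfpi_lt : - (pi / 2) < pi / 2 :> R.
Proof. by have := halfpi_gt0; lra. Qed.

Definition phi_prob : probability (measurableTypeR R) R := uniform_prob Nhalfpi_lt.

Lemma phi_lawE (A : set R) : phi_law A = phi_prob A.
Proof. by []. Qed.

Definition theta_pdf (x : R) : R := cos x / 2 * \1_(@halfpi_itv R) x.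

Lemma measurable_theta_pdf : measurable_fun [set: measurableTypeR R] theta_pdf.
Proof.
apply: measurable_funM; last by apply: measurable_indic; exact: measurable_itv.
by apply: measurable_funM => //; exact: measurable_cos.
Qed.

Lemma theta_pdf_ge0 x : 0 <= theta_pdf x.
Proof.
rewrite /theta_pdf indicE; case: (boolP (_ \in _)) => [|_]; last by rewrite mulr0.
by rewrite inE /halfpi_itv/= in_itv/= => h; rewrite mulr1 divr_ge0// cos_ge0_pihalf.
Qed.

Lemma is_deriveMl (k : R) (f : R -> R) (x d : R) : is_derive x 1 f d ->
  is_derive x 1 (fun y => k * f y) (k * d).
Proof. exact: is_deriveZ. Qed.

Definition theta_meas : set (measurableTypeR R) -> \bar R :=
  dens leb measurable_theta_pdf theta_pdf_ge0.

HB.instance Definition _ := Measure.on theta_meas.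

Lemma theta_lawE (A : set R) : theta_law A = theta_meas A.
Proof.
rewrite /theta_law /theta_meas /dens integral_mkcondr; apply: eq_integral => x _.
by rewrite /theta_pdf patchE indicE; case: ifP => _; rewrite ?mulr1 ?mulr0.
Qed.

Lemma theta_meas_itv (a b : R) : - (pi / 2) <= a -> a < b -> b <= pi / 2 ->
  theta_meas `]a, b]%classic = ((sin b - sin a) / 2)%:E.
Proof.
move=> a1 ab b1; rewrite -theta_lawE /theta_law setIidl; last first.
  move=> x /=; rewrite /halfpi_itv/= !in_itv/= => /andP[ax xb].
  by rewrite (le_trans a1 (ltW ax)) (le_trans xb).
under eq_integral do rewrite mulrC.
rewrite (integral_itv_derive ab (F := fun x => 2^-1 * sin x)).
- by rewrite -mulrBr mulrC.
- by move=> x; apply: cvgM; [exact: cvg_cst|exact: continuous_cos].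
Qed.

Let theta_setT : theta_meas setT = 1%E.
Proof.
rewrite -theta_lawE /theta_law setTI /halfpi_itv.
rewrite -integral_itv_obnd_cbnd; last first.
  apply: measurable_funTS; apply/measurable_EFinP.
  by apply: measurable_funM => //; exact: measurable_cos.
have := theta_meas_itv (lexx _) Nhalfpi_lt (lexx _).
rewrite -theta_lawE /theta_law setIidl ?sinN ?sin_pihalf; last first.
  by move=> x /=; rewrite /halfpi_itv/= !in_itv/= => /andP[/ltW -> ->].
by move=> ->; congr (_%:E); lra.
Qed.

HB.instance Definition _ := Measure_isProbability.Build _ _ _ theta_meas theta_setT.

Definition theta_prob : probability (measurableTypeR R) R := theta_meas.

(** [pi] times the Cauchy density of scale [c], which is the derivative of [atan (x / c)]. *)
Definition cauchy_kernel (c x : R) : R := c / (c ^+ 2 + x ^+ 2).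

Lemma is_derive_atan_div (c x : R) : 0 < c ->
  is_derive x 1 (fun x => atan (x / c)) (cauchy_kernel c x).
Proof.
move=> c0; rewrite (_ : cauchy_kernel c x = (1 + (c^-1 * x) ^+ 2)^-1 * (c^-1 * 1)).
  rewrite (_ : (fun _ => _) = atan \o (fun x => c^-1 * x)); last first.
    by apply/funext => y /=; rewrite mulrC.
  exact: is_derive1_comp.
rewrite /cauchy_kernel mulr1 -invfM mulrDl mul1r exprMn exprVn.
field.
by rewrite !gt_eqF// ltr_pwDl ?sqr_ge0 ?mulr_gt0.
Qed.

Lemma cauchy_kernel_ge0 (c x : R) : 0 <= c -> 0 <= cauchy_kernel c x.
Proof. by move=> c0; rewrite divr_ge0// addr_ge0// sqr_ge0. Qed.

Lemma continuous_cauchy_kernel (c : R) : 0 < c -> continuous (cauchy_kernel c).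
Proof.
move=> c0 x; apply: cvgM; first exact: cvg_cst.
apply: cvgV.
  by rewrite gt_eqF// ltr_pwDl ?exprn_gt0// sqr_ge0.
by apply: cvgD; [exact: cvg_cst|exact: exprn_continuous].
Qed.

(** The endpoints are discarded because [tan] and [atan] are inverse to each other on the open
    interval. *)
Lemma phi_prob_conull : phi_prob (~` `]- (pi / 2), pi / 2[%classic) = 0%E.
Proof.
rewrite probability_setC// [X in (1 - X)%E](_ : _ = 1%E) ?subee//.
rewrite -phi_lawE /phi_law integral_uniform_pdf setIidl; last first.
  by move=> x /=; rewrite !in_itv/= => /andP[/ltW -> /ltW ->].
rewrite (eq_integral (fun=> (pi^-1)%:E)); last first.
  move=> x; rewrite inE /= in_itv/= => /andP[x1 x2].
  by rewrite /uniform_pdf (ltW x1) (ltW x2) /=; congr (_^-1%:E); lra.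
rewrite integral_cst//= lebesgue_measure_itv/= lte_fin Nhalfpi_lt.
rewrite -EFinD -EFinM; congr (_%:E).
by rewrite opprK -splitr mulVf// gt_eqF// pi_gt0.
Qed.

(** [c * tan Phi] is Cauchy of scale [c]: it lies in []a, b]] exactly when the uniform angle lies in
    []atan (a / c), atan (b / c)]]. *)
Lemma integral_phi_tan (c : R) (g : measurableTypeR R -> \bar R) : 0 < c ->
  measurable_fun setT g -> (forall x, 0 <= g x)%E ->
  (\int[phi_prob]_x g (c * tan x)%R =
   \int[leb]_x ((pi^-1 * cauchy_kernel c x)%:E * g x))%E.
Proof.
move=> c0 mg g0; apply: (integral_law_density (D := setT)) => //; last by move=> x /(_ I).
- exact: (le_lt_trans (probability_le1 phi_prob measurableT) (ltry 1)).
- by apply: measurable_funM => //; exact: measurable_tan.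
- apply: measurable_funM => //; apply: continuous_measurable_fun.
  exact: continuous_cauchy_kernel.
- by move=> x; rewrite mulr_ge0 ?invr_ge0 ?pi_ge0// cauchy_kernel_ge0// ltW.
- move=> a b ab; rewrite !setIT.
have dF (x : R) : is_derive x 1 (fun x => pi^-1 * atan (x / c)) (pi^-1 * cauchy_kernel c x).
  by apply: is_deriveMl; exact: is_derive_atan_div.
have cf : continuous (fun x => pi^-1 * cauchy_kernel c x).
  by move=> x; apply: cvgM; [exact: cvg_cst|exact: continuous_cauchy_kernel].
rewrite (integral_itv_derive ab dF cf).
transitivity (phi_prob `]atan (a / c), atan (b / c)]%classic); last first.
  rewrite -phi_lawE /phi_law integral_uniform_pdf setIidl; last first.
    move=> x /=; rewrite !in_itv/= => /andP[ax xb].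
    by rewrite (ltW (lt_trans (atan_gtNpi2 _) ax)) (ltW (le_lt_trans xb (atan_ltpi2 _))).
  rewrite (eq_integral (fun=> (pi^-1)%:E)); last first.
    move=> x; rewrite inE /= in_itv/= => /andP[ax xb].
    rewrite /uniform_pdf (ltW (lt_trans (atan_gtNpi2 _) ax)).
    rewrite (ltW (le_lt_trans xb (atan_ltpi2 _))) /=; congr (_^-1%:E); lra.
  rewrite integral_cst//= lebesgue_measure_itv/= lte_fin lt_atan ?ltr_pM2r ?invr_gt0//.
  by rewrite -EFinD -EFinM mulrBr.
transitivity (phi_prob (((fun x => c * tan x) @^-1` `]a, b]%classic) `&`
    `](- (pi / 2)), (pi / 2)[%classic)).
  apply: measure_setI_conull; last exact: phi_prob_conull.
    exact: measurable_itv.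
  rewrite -[X in measurable X]setTI.
  suff mh : measurable_fun [set: measurableTypeR R] (fun x => c * tan x).
    by apply: mh => //; exact: measurable_itv.
  by apply: measurable_funM => //; exact: measurable_tan.
congr (_ _); apply/seteqP; split => x /=; rewrite !in_itv/=.
  move=> [/andP[ax xb] /andP[x1 x2]]; rewrite -(@tanK _ x) ?in_itv/= ?x1//.
  apply/andP; split; [apply: lt_atan; rewrite ltr_pdivrMr|
    apply: le_atan; rewrite ler_pdivlMr]; by rewrite // mulrC.
move=> /andP[ax xb].
have xK : x \in `](- (pi / 2)), (pi / 2)[.
  by rewrite in_itv/= (lt_trans (atan_gtNpi2 _) ax) (le_lt_trans xb (atan_ltpi2 _)).
have K (y : R) : atan y \in `](- (pi / 2)), (pi / 2)[.
  by rewrite in_itv/= atan_gtNpi2 atan_ltpi2.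
split; last by move: xK; rewrite in_itv.
rewrite -(ltr_tan (K _) xK) atanK ltr_pdivrMr// mulrC in ax.
rewrite leNgt -(ltr_tan (K _) xK) atanK -leNgt ler_pdivlMr// mulrC in xb.
by rewrite ax.
Qed.

End angle_laws.

(** * Law of the cotangent of the polar angle *)

Section polar_angle_law.
Context {R : realType}.
Local Notation leb := (@lebesgue_measure R).

Lemma theta_probE (A : set R) : theta_prob A = theta_law A.
Proof. by rewrite theta_lawE. Qed.

(** Density of [c * (cos Theta / sin Theta)], used for positive [x]: there
    [Theta = pi/2 - atan (x / c)], so the angle density [cos Theta / 2] becomes
    [sin (atan (x / c)) / 2] and the Jacobian is [cauchy_kernel c x]. The absolute value keeps the
    formula nonnegative everywhere. *)
Definition polar_kernel (c x : R) : R :=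
  2^-1 * (`|sin (atan (x / c))| * cauchy_kernel c x).

Lemma polar_kernel_ge0 (c x : R) : 0 <= c -> 0 <= polar_kernel c x.
Proof.
move=> c0; apply: mulr_ge0; first by rewrite invr_ge0.
by apply: mulr_ge0 => //; exact: cauchy_kernel_ge0.
Qed.

Lemma continuous_atan_div (c : R) : 0 < c -> continuous (fun x : R => atan (x / c)).
Proof.
move=> c0 x; apply: differentiable_continuous; apply/derivable1_diffP.
by have [] := is_derive_atan_div x c0.
Qed.

Lemma continuous_sin_atan_div (c : R) : 0 < c ->
  continuous (fun x : R => sin (atan (x / c))).
Proof.
move=> c0 x; have h : {for x, continuous (@sin R \o (fun y : R => atan (y / c)))}.
  apply: continuous_comp; [exact: continuous_atan_div|exact: continuous_sin].
exact: h.
Qed.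

Lemma theta_prob_cot_itv (c a b : R) : 0 < c -> 0 <= a -> a < b ->
  theta_prob ((fun x => c * (cos x / sin x)) @^-1` `]a, b]%classic) =
  ((cos (atan (a / c)) - cos (atan (b / c))) / 2)%:E.
Proof.
move=> c0 a0 ab.
have K (y : R) : atan y \in `](- (pi / 2)), (pi / 2)[.
  by rewrite in_itv/= atan_gtNpi2 atan_ltpi2.
have atan_ge0 (y : R) : 0 <= y -> 0 <= atan y.
  by move=> y0; rewrite -[0 in leLHS]atan0 le_atan.
have ab_ : atan (a / c) < atan (b / c) by rewrite lt_atan// ltr_pM2r ?invr_gt0.
have Ea0 : 0 <= atan (a / c) by apply: atan_ge0; rewrite divr_ge0// ltW.
have b2 := atan_ltpi2 (b / c).
(* The cotangent [tan (pi/2 - x)] is decreasing, hence an interval closed on the left; [a >= 0]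
   confines it to positive angles. *)
have ET : (fun x => c * (cos x / sin x)) @^-1` `]a, b]%classic `&` @halfpi_itv R =
    `[pi / 2 - atan (b / c), pi / 2 - atan (a / c)[%classic.
  have cotE x : cos x / sin x = tan (pi / 2 - x).
    by rewrite /tan sinD cosD cosN sinN sin_pihalf cos_pihalf; congr (_ / _); ring.
  apply/seteqP; split => x /=; rewrite /halfpi_itv/= !in_itv/= cotE.
    move=> [/andP[ax xb] /andP[x1 x2]].
    have t0 : 0 < tan (pi / 2 - x) by rewrite -(pmulr_rgt0 _ c0) (le_lt_trans a0).
    (* For angles [x <= 0] in the range, [cos x / sin x] is at most 0; at [x = 0] this is the
       convention [0^-1 = 0]. *)
    have x0 : 0 < x.
      rewrite ltNge; apply/negP => x0; move: t0; apply/negP; rewrite -leNgt -cotE.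
      rewrite mulr_ge0_le0 ?cos_ge0_pihalf ?x1// invr_le0 -oppr_ge0 -sinN.
      by apply: sin_ge0_pi; apply/andP; split; have := @pi_gt0 R; lra.
    have yK : pi / 2 - x \in `](- (pi / 2)), (pi / 2)[.
      rewrite in_itv/=; apply/andP; split; last lra.
      by have := @pi_gt0 R; lra.
    have h1 : a / c < tan (pi / 2 - x) by rewrite ltr_pdivrMr// mulrC.
    have h2 : tan (pi / 2 - x) <= b / c by rewrite ler_pdivlMr// mulrC.
    have := lt_atan h1; have := le_atan h2; rewrite !tanK// => h3 h4.
    by apply/andP; split; lra.
  move=> /andP[xb xa].
  have yK : pi / 2 - x \in `](- (pi / 2)), (pi / 2)[.
    by rewrite in_itv/=; apply/andP; split; have := @pi_gt0 R; lra.
  have h1 : atan (a / c) < pi / 2 - x by lra.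
  have h2 : pi / 2 - x <= atan (b / c) by lra.
  rewrite -(ltr_tan (K _) yK) atanK ltr_pdivrMr// mulrC in h1.
  rewrite leNgt -(ltr_tan (K _) yK) atanK -leNgt ler_pdivlMr// mulrC in h2.
  rewrite h1 h2; split => //.
  by apply/andP; split; have := @pi_gt0 R; lra.
rewrite theta_probE /theta_law ET.
rewrite integral_itv_bndo_bndc; last first.
  apply: measurable_funTS; apply/measurable_EFinP.
  by apply: measurable_funM => //; exact: measurable_cos.
rewrite -integral_itv_obnd_cbnd; last first.
  apply: measurable_funTS; apply/measurable_EFinP.
  by apply: measurable_funM => //; exact: measurable_cos.
set u := pi / 2 - atan (b / c); set v := pi / 2 - atan (a / c).
have uv : u < v by rewrite /u /v; lra.
have v2 : v <= pi / 2 by rewrite /v; lra.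
have u1 : - (pi / 2) <= u by rewrite /u; have := @pi_gt0 R; lra.
have := theta_meas_itv u1 uv v2; rewrite -theta_lawE /theta_law setIidl.
  move=> ->; congr ((_ - _) / 2)%:E;
  by rewrite /u /v sinD sinN cosN sin_pihalf cos_pihalf mul1r mul0r addr0.
move=> x /=; rewrite /halfpi_itv/= !in_itv/= => /andP[ux xv].
by rewrite (le_trans u1 (ltW ux)) (le_trans xv).
Qed.

Lemma integral_theta_cot (c : R) (g : measurableTypeR R -> \bar R) : 0 < c ->
  measurable_fun setT g -> (forall x, 0 <= g x)%E ->
  (forall x : R, x <= 0 -> g x = 0%E) ->
  (\int[theta_prob]_x g (c * (cos x / sin x))%R =
   \int[leb]_x ((polar_kernel c x)%:E * g x))%E.
Proof.
move=> c0 mg g0 gN.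
have cpk : continuous (polar_kernel c).
  move=> x; apply: cvgM; first exact: cvg_cst.
  apply: cvgM; last exact: continuous_cauchy_kernel.
  apply: cvg_norm.
  exact: continuous_sin_atan_div.
apply: (integral_law_density (D := `]0, +oo[%classic)) => //.
- exact: (le_lt_trans (probability_le1 theta_prob measurableT) (ltry 1)).
- apply: measurable_funM => //; apply: measurable_funM; first exact: measurable_cos.
  by apply: measurable_funV; exact: measurable_sin.
- exact: continuous_measurable_fun.
- by move=> x; rewrite polar_kernel_ge0// ltW.
- move=> a b ab.
  have [b0|b0] := leP b 0.
    have -> : `]a, b] `&` `]0, +oo[ = set0 :> set R.
      rewrite -subset0 => x /= []; rewrite !in_itv/= andbT => /andP[_ xb] x0.
      by move: (lt_le_trans x0 xb); rewrite ltNge b0.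
    by rewrite preimage_set0 measure0 integral_set0.
  have -> : `]a, b] `&` `]0, +oo[ = `]Num.max a 0, b]%classic :> set R.
    apply/seteqP; split => x /=; rewrite !in_itv/= andbT gt_max.
      by move=> [/andP[-> ->] ->].
    by move=> /andP[/andP[-> ->] ->].
  have mb : Num.max a 0 < b by rewrite gt_max ab b0.
  have m0 : 0 <= Num.max a 0 by rewrite le_max lexx orbT.
  transitivity ((cos (atan (Num.max a 0 / c)) - cos (atan (b / c))) / 2)%:E.
    exact: theta_prob_cot_itv.
  pose F (x : R) := - 2^-1 * cos (atan (x / c)).
  pose f (x : R) := - 2^-1 * (- sin (atan (x / c)) * cauchy_kernel c x).
  have dF (x : R) : is_derive x 1 F (f x).
    apply: is_deriveMl; apply: is_derive1_comp; exact: is_derive_atan_div.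
  have cf : continuous f.
    move=> x; apply: cvgM; first exact: cvg_cst.
    apply: cvgM; last exact: continuous_cauchy_kernel.
    apply: cvgN.
    exact: continuous_sin_atan_div.
  have := integral_itv_derive mb dF cf.
  rewrite (eq_integral (fun x : measurableTypeR R => (polar_kernel c x)%:E)) => [->|x].
    by congr (_%:E); rewrite /F; lra.
  rewrite inE /= in_itv/= => /andP[mx _]; congr (_%:E).
  rewrite /polar_kernel /f ger0_norm; first by ring.
  apply: sin_ge0_pi; apply/andP; split.
    by rewrite -[0 in leLHS]atan0 le_atan// divr_ge0// ?ltW// (le_lt_trans m0).
  by have := atan_ltpi2 (x / c); have := @pi_gt0 R; lra.
- by move=> x /= /negP; rewrite in_itv/= andbT -leNgt; exact: gN.
Qed.

Lemma integral_phi_opp (g : measurableTypeR R -> \bar R) :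
  measurable_fun setT g -> (forall x, 0 <= g x)%E ->
  (\int[phi_prob]_x g (- x)%R = \int[phi_prob]_x g x)%E.
Proof.
move=> mg g0; have mgN : measurable_fun [set: measurableTypeR R] (fun x => g (- x)).
  by apply: (measurableT_comp mg).
rewrite !integral_uniform//; congr (_ * _)%E.
rewrite [LHS]integral_mkcond [RHS]integral_mkcond/=.
rewrite -[RHS]ge0_integral_lebesgueN.
- apply: eq_integral => x _; rewrite !patchE.
  suff -> : (x \in `[- (pi / 2), pi / 2]%classic) =
            (- x \in `[- (pi / 2), pi / 2]%classic) by [].
  by apply/idP/idP; rewrite !inE /= !in_itv/= => /andP[h1 h2]; apply/andP; split; lra.
- apply/(measurable_restrictT _ _).1 => //.
  exact: measurable_funTS.
- by move=> x; rewrite patchE; case: ifP.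
Qed.

Lemma integral_theta_opp (g : measurableTypeR R -> \bar R) :
  measurable_fun setT g -> (forall x, 0 <= g x)%E ->
  (\int[theta_prob]_x g (- x)%R = \int[theta_prob]_x g x)%E.
Proof.
move=> mg g0; have mgN : measurable_fun [set: measurableTypeR R] (fun x => g (- x)).
  by apply: (measurableT_comp mg).
rewrite /theta_prob !ge0_integral_dens//.
rewrite -[RHS]ge0_integral_lebesgueN.
- apply: eq_integral => x _; congr (_%:E * _)%E.
  rewrite /theta_pdf cosN !indicE; congr (_ * (nat_of_bool _)%:R).
  by apply/idP/idP; rewrite !inE /halfpi_itv/= !in_itv/= => /andP[h1 h2]; apply/andP; split; lra.
- apply: emeasurable_funM => //; apply/measurable_EFinP.
  exact: measurable_theta_pdf.
- by move=> x; rewrite mule_ge0// lee_fin theta_pdf_ge0.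
Qed.

End polar_angle_law.

Lemma eq_integral_conull d (T : measurableType d) (R : realType)
    (m : {measure set T -> \bar R}) (K : set T) (f g : T -> \bar R) :
  measurable K -> m (~` K) = 0%E -> measurable_fun setT f -> measurable_fun setT g ->
  (forall x, K x -> f x = g x) -> (\int[m]_x f x = \int[m]_x g x)%E.
Proof.
move=> mK mK0 mf mg fg; apply: ae_eq_integral => //.
exists (~` K); split => //; first exact: measurableC.
by move=> x /= fgx Kx; apply: fgx => _; exact: fg.
Qed.

(** * Density of the rescaled slope *)

Section change_of_variables.
Context {R : realType}.

Definition angle_meas m (j : nat) :
    {sigma_finite_measure set (measurableTypeR R) -> \bar R} :=
  if (j < m)%N then @phi_prob R else @theta_prob R.

Definition angle_law m : {sigma_finite_measure set (borel_cV R m.+1) -> \bar R} :=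
  prodm m.+1 (angle_meas m).

(* [scaled_slope m c] maps the angles to [c] times the transverse direction
   divided by the axial one; peeling off the first angle only rescales [c]. *)
Fixpoint scaled_slope m (c : R) : 'cV[R]_m.+1 -> 'cV[R]_m.+1 :=
  match m with
  | 0 => fun v => vcons (c * (cos (v ord0 0) / sin (v ord0 0))) 0
  | m'.+1 => fun v =>
      vcons (c * tan (v ord0 0)) (scaled_slope (c / cos (v ord0 0)) (vtail v))
  end.

(** Density of [scaled_slope c] at points with positive last coordinate. The first coordinate
    [x = c * tan phi] is Cauchy of scale [c], and the scale left for the others is [c / cos phi],
    that is, the square root of [c^2 + x^2]. *)
Fixpoint slope_pdf m (c : R) : 'cV[R]_m.+1 -> R :=
  match m with
  | 0 => fun q => polar_kernel c (q ord0 0)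
  | m'.+1 => fun q => pi^-1 * cauchy_kernel c (q ord0 0) *
      slope_pdf (Num.sqrt (c ^+ 2 + q ord0 0 ^+ 2)) (vtail q)
  end.

Lemma measurable_cauchy_kernel d (T : measurableType d) (c x : T -> R) :
  measurable_fun setT c -> measurable_fun setT x ->
  measurable_fun setT (fun t => cauchy_kernel (c t) (x t)).
Proof.
move=> mc mx; apply: measurable_funM => //; apply: measurable_funV.
by apply: measurable_funD; exact: measurable_funX.
Qed.

Lemma measurable_polar_kernel d (T : measurableType d) (c x : T -> R) :
  measurable_fun setT c -> measurable_fun setT x ->
  measurable_fun setT (fun t => polar_kernel (c t) (x t)).
Proof.
move=> mc mx; apply: measurable_funM => //; apply: measurable_funM; last first.
  exact: measurable_cauchy_kernel.
apply: (measurableT_comp (@normr_measurable R setT)).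
apply: (measurableT_comp measurable_sin); apply: (measurableT_comp measurable_atan).
by apply: measurable_funM => //; exact: measurable_funV.
Qed.

Lemma measurable_scaled_slope d (T : measurableType d) m (c : T -> R)
    (v : T -> borel_cV R m.+1) : measurable_fun setT c -> measurable_fun setT v ->
  measurable_fun setT (fun t => scaled_slope (c t) (v t) : borel_cV R m.+1).
Proof.
have mv0 n (w : T -> borel_cV R n.+1) : measurable_fun setT w ->
    measurable_fun setT (fun t => w t ord0 0).
  by move=> mw; exact: (measurableT_comp (measurable_coord ord0 0)).
elim: m c v => [|m IH] c v mc mv /=; apply: measurable_vcons => //.
- apply: measurable_funM => //; apply: measurable_funM.
    by apply: (measurableT_comp measurable_cos); exact: mv0.
  by apply: measurable_funV; apply: (measurableT_comp measurable_sin); exact: mv0.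
- apply: measurable_funM => //.
  by apply: (measurableT_comp measurable_tan); exact: mv0.
- apply: IH; last exact: (measurableT_comp (@measurable_vtail R m.+1) mv).
  apply: measurable_funM => //; apply: measurable_funV.
  by apply: (measurableT_comp measurable_cos); exact: mv0.
Qed.

Lemma measurable_slope_pdf d (T : measurableType d) m (c : T -> R)
    (q : T -> borel_cV R m.+1) : measurable_fun setT c -> measurable_fun setT q ->
  measurable_fun setT (fun t => slope_pdf (c t) (q t)).
Proof.
have mq0 n (w : T -> borel_cV R n.+1) : measurable_fun setT w ->
    measurable_fun setT (fun t => w t ord0 0).
  by move=> mw; exact: (measurableT_comp (measurable_coord ord0 0)).
elim: m c q => [|m IH] c q mc mq /=.
  by apply: measurable_polar_kernel => //; exact: mq0.
apply: measurable_funM.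
  by apply: measurable_funM => //; apply: measurable_cauchy_kernel => //; exact: mq0.
apply: IH; last exact: (measurableT_comp (@measurable_vtail R m.+1) mq).
apply: (measurableT_comp measurable_sqrtr).
by apply: measurable_funD; apply: measurable_funX => //; exact: mq0.
Qed.

Lemma slope_pdf_ge0 m (c : R) (q : 'cV[R]_m.+1) : 0 <= c -> 0 <= slope_pdf c q.
Proof.
elim: m c q => [|m IH] c q c0 /=; first exact: polar_kernel_ge0.
apply: mulr_ge0; last by apply: IH; exact: sqrtr_ge0.
by apply: mulr_ge0; [rewrite invr_ge0 pi_ge0|exact: cauchy_kernel_ge0].
Qed.

(** Induction on [m]: for a fixed first angle [x], the inner integral is a function [Psi] of
    [c * tan x] alone, to which the Cauchy law applies. The condition on [g] is handed down to the
    last coordinate, where [integral_theta_cot] treats the positive half-line. *)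
Lemma integral_scaled_slope m (c : R) (g : borel_cV R m.+1 -> \bar R) : 0 < c ->
  measurable_fun setT g -> (forall q, 0 <= g q)%E ->
  (forall q : 'cV[R]_m.+1, q ord_max 0 <= 0 -> g q = 0%E) ->
  (\int[angle_law m]_v g (scaled_slope c v) =
   \int[vol m.+1]_q ((slope_pdf c q)%:E * g q))%E.
Proof.
elim: m c g => [|m IH] c g c0 mg g0 gN.
  have mrg : measurable_fun setT (fun q : borel_cV R 1 => (slope_pdf c q)%:E * g q)%E.
    apply: emeasurable_funM => //; apply/measurable_EFinP.
    exact: (measurable_slope_pdf (c := cst c) (q := id)).
  have mqg : measurable_fun setT (fun v : borel_cV R 1 => g (scaled_slope c v)).
    apply: (measurableT_comp mg).
    exact: (measurable_scaled_slope (c := cst c) (v := id)).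
  rewrite !integral_prodmS//; last first.
    by move=> v; rewrite mule_ge0// lee_fin slope_pdf_ge0// ltW.
  transitivity (\int[theta_prob]_x g (vcons (c * (cos x / sin x))%R 0%R))%E.
    apply: eq_integral => x _; rewrite integral_dirac//; last first.
      by apply: (measurableT_comp mqg); exact: measurable_vcons2.
    by rewrite diracT mul1e /= vcons0.
  rewrite (integral_theta_cot (g := fun x => g (vcons x 0)))//; last 2 first.
  - by apply: (measurableT_comp mg); exact: measurable_vcons.
  - move=> x x0; apply: gN.
    by rewrite (_ : ord_max = ord0) ?vcons0//; exact/val_inj.
  apply: eq_integral => x _; rewrite integral_dirac//; last first.
    apply: (measurableT_comp mrg); exact: measurable_vcons2.
  by rewrite diracT mul1e /= vcons0.
have mqg : measurable_fun setT (fun v : borel_cV R m.+2 => g (scaled_slope c v)).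
  apply: (measurableT_comp mg).
  exact: (measurable_scaled_slope (c := cst c) (v := id)).
have mrg : measurable_fun setT (fun q : borel_cV R m.+2 => (slope_pdf c q)%:E * g q)%E.
  apply: emeasurable_funM => //; apply/measurable_EFinP.
  exact: (measurable_slope_pdf (c := cst c) (q := id)).
have rg0 (q : borel_cV R m.+2) : (0 <= (slope_pdf c q)%:E * g q)%E.
  by rewrite mule_ge0// lee_fin slope_pdf_ge0// ltW.
rewrite !integral_prodmS//.
pose Psi (z : measurableTypeR R) := (\int[vol m.+1]_q
  ((slope_pdf (Num.sqrt (c ^+ 2 + z ^+ 2)) q)%:E * g (vcons z q)))%E.
have mPsi : measurable_fun setT Psi.
  pose F (p : measurableTypeR R * borel_cV R m.+1) :=
    ((slope_pdf (Num.sqrt (c ^+ 2 + p.1 ^+ 2)) p.2)%:E * g (vcons p.1 p.2))%E.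
  apply: (@measurable_integral_vcons _ _ _ _ _ F).
    apply: emeasurable_funM.
      apply/measurable_EFinP; apply: measurable_slope_pdf => //.
      apply: (measurableT_comp measurable_sqrtr).
      by apply: measurable_funD => //; apply: measurable_funX.
    by apply: (measurableT_comp mg); exact: measurable_vcons_pair.
  by move=> p; rewrite mule_ge0// lee_fin slope_pdf_ge0// sqrtr_ge0.
have Psi0 z : (0 <= Psi z)%E.
  by apply: integral_ge0 => q _; rewrite mule_ge0// lee_fin slope_pdf_ge0// sqrtr_ge0.
transitivity (\int[@phi_prob R]_x Psi (c * tan x)%R)%E.
  transitivity (\int[@phi_prob R]_x
    \int[angle_law m]_v g (scaled_slope c (vcons x v)))%E; first by [].
  apply: (@eq_integral_conull _ _ _ (@phi_prob R) `](- (pi / 2)), (pi / 2)[%classic).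
  - exact: measurable_itv.
  - exact: phi_prob_conull.
  - apply: (@measurable_integral_vcons _ _ _ _ _ (fun p => g (scaled_slope c (vcons p.1 p.2)))) => //.
    by apply: (measurableT_comp mqg); exact: measurable_vcons_pair.
  - apply: (measurableT_comp mPsi).
    by apply: measurable_funM => //; exact: measurable_tan.
  move=> x /=; rewrite in_itv/= => xK; have cx0 := cos_gt0_pihalf xK.
  rewrite /Psi.
  (* [1 + tan^2 = cos^-2], and [cos x > 0] on the open interval. *)
  have -> : Num.sqrt (c ^+ 2 + (c * tan x) ^+ 2) = c / cos x.
    rewrite exprMn -[X in X + _]mulr1 -mulrDr -cos2_tan2 ?gt_eqF//.
    by rewrite -exprVn -exprMn sqrtr_sqr ger0_norm// divr_ge0// ltW.
  have cc0 : 0 < c / cos x by rewrite divr_gt0.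
  rewrite -IH//.
  - apply: eq_integral => v _.
    by rewrite /= vcons0 vconsK.
  - by apply: (measurableT_comp mg); exact: measurable_vcons2.
  - move=> q q0; apply: gN; rewrite (_ : ord_max = lift ord0 ord_max).
      by rewrite vconsS.
    exact/val_inj.
rewrite integral_phi_tan//; apply: eq_integral => x _.
rewrite /Psi -ge0_integralZl//; last 3 first.
- apply: emeasurable_funM.
    by apply/measurable_EFinP; exact: (measurable_slope_pdf (c := cst _) (q := id)).
  by apply: (measurableT_comp mg); exact: measurable_vcons2.
- by move=> q _; rewrite mule_ge0// lee_fin slope_pdf_ge0// sqrtr_ge0.
- by rewrite lee_fin mulr_ge0 ?invr_ge0 ?pi_ge0// cauchy_kernel_ge0// ltW.
by apply: eq_integral => q _; rewrite /= vcons0 vconsK muleA EFinM.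
Qed.

End change_of_variables.

(** * Two-sided bounds on the slope density for large scales *)

Section slope_pdf_bounds.
Context {R : realType}.

(** A factor [1/2] from the polar density and [1/pi] from each of the [m] uniform angles. *)
Definition slope_cst m : R := 2^-1 * pi^-1 ^+ m.

Lemma slope_cst_gt0 m : 0 < slope_cst m.
Proof. by rewrite mulr_gt0 ?invr_gt0// exprn_gt0// invr_gt0 pi_gt0. Qed.

Lemma slope_cstS m : slope_cst m.+1 = pi^-1 * slope_cst m.
Proof. by rewrite /slope_cst exprS mulrCA. Qed.

Lemma sin_atan (x : R) : sin (atan x) = x * (Num.sqrt (1 + x ^+ 2))^-1.
Proof.
have cx : cos (atan x) != 0.
  by rewrite gt_eqF// cos_gt0_pihalf// atan_gtNpi2 atan_ltpi2.
by rewrite -cos_atan -[x in x * _]atanK /tan -mulrA mulVf// mulr1.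
Qed.

(** Peeling off a coordinate raises the scale from [c] to some [c1 >= c] and contributes, besides
    [pi^-1], exactly the factor [(c / c1) ^+ m.+4 <= 1]. At the bottom, the sine is at most [x / c]
    and the kernel at most [1 / c]. *)
Lemma slope_pdf_le m (c : R) (q : 'cV[R]_m.+1) : 0 < c -> 0 <= q ord_max 0 ->
  slope_pdf c q * c ^+ m.+2 <= slope_cst m * q ord_max 0.
Proof.
elim: m c q => [|m IH] c q c0 q0 /=.
  rewrite (_ : ord0 = ord_max); last exact/val_inj.
  set x := q ord_max 0 in q0 *.
  have xc0 : 0 <= x / c by rewrite divr_ge0// ltW.
  have s1 : 1 <= Num.sqrt (1 + (x / c) ^+ 2).
    by rewrite -[leLHS]sqrtr1 ler_sqrt ?lerDl ?sqr_ge0// addr_ge0// sqr_ge0.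
  have s0 := lt_le_trans ltr01 s1.
  rewrite /polar_kernel sin_atan ger0_norm; last first.
    by rewrite mulr_ge0// invr_ge0 ltW.
  rewrite /slope_cst expr0 mulr1 -[leLHS]mulrA ler_pM2l ?invr_gt0//.
  have D0 : 0 < c ^+ 2 + x ^+ 2 by rewrite ltr_pwDl ?exprn_gt0// sqr_ge0.
  rewrite (_ : _ * c ^+ 2 = x * ((Num.sqrt (1 + (x / c) ^+ 2))^-1 *
    (c ^+ 2 / (c ^+ 2 + x ^+ 2)))); last first.
    rewrite /cauchy_kernel; field.
    by rewrite !gt_eqF//=.
  rewrite ler_piMr// mulr_ile1 ?invr_ge0 ?(ltW s0) ?invf_le1//.
    by rewrite divr_ge0 ?sqr_ge0// ltW.
  by rewrite ler_pdivrMr// mul1r lerDl sqr_ge0.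
set x := q ord0 0; set c1 := Num.sqrt _.
have D0 : 0 < c ^+ 2 + x ^+ 2 by rewrite ltr_pwDl ?exprn_gt0// sqr_ge0.
have c10 : 0 < c1 by rewrite sqrtr_gt0.
have c1E : c1 ^+ 2 = c ^+ 2 + x ^+ 2 by rewrite sqr_sqrtr// ltW.
have cc1 : c <= c1.
  by rewrite -(@ler_pXn2r _ 2)// ?nnegrE ?(ltW c10) ?(ltW c0)// c1E lerDl sqr_ge0.
have qm : vtail q ord_max 0 = q ord_max 0.
  by rewrite vtailE; congr (q _ _); exact/val_inj.
have := IH c1 (vtail q) c10; rewrite qm => /(_ q0) IH1.
rewrite /cauchy_kernel -c1E.
rewrite (_ : _ * c ^+ m.+3 = pi^-1 * (slope_pdf c1 (vtail q) * c1 ^+ m.+2) *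
   (c / c1) ^+ m.+4); last first.
  rewrite expr_div_n (exprS c m.+3) (_ : c1 ^+ m.+4 = c1 ^+ 2 * c1 ^+ m.+2).
    by move: (pi^-1 : R) => ip; field; rewrite !gt_eqF ?exprn_gt0.
  by rewrite -exprD.
have r1 : (c / c1) ^+ m.+4 <= 1.
  by rewrite exprn_ile1 ?divr_ge0 ?(ltW c0) ?(ltW c10)// ler_pdivrMr// mul1r.
have r0 : 0 <= (c / c1) ^+ m.+4.
  by rewrite exprn_ge0// divr_ge0 ?(ltW c0) ?(ltW c10).
rewrite slope_cstS -[leLHS]mulrA -[leRHS]mulrA ler_pM2l ?invr_gt0 ?pi_gt0//.
have P0 : 0 <= slope_cst m * q ord_max 0 by rewrite mulr_ge0// ltW// slope_cst_gt0.
apply: (@le_trans _ _ (slope_cst m * q ord_max 0 * (c / c1) ^+ m.+4)).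
  by rewrite ler_wpM2r.
by rewrite ler_piMr.
Qed.

(** The same recursion. Moving a coordinate from [q] into the scale preserves [c ^+ 2 + sqnorm q],
    so a single ratio controls all the factors. *)
Lemma slope_pdf_ge m (c : R) (q : 'cV[R]_m.+1) : 0 < c -> 0 <= q ord_max 0 ->
  slope_cst m * q ord_max 0 * (c ^+ 2 / (c ^+ 2 + sqnorm q)) ^+ m.+2 <=
  slope_pdf c q * c ^+ m.+2.
Proof.
elim: m c q => [|m IH] c q c0 q0 /=.
  rewrite /sqnorm big_ord1 (_ : ord0 = ord_max); last exact/val_inj.
  set x := q ord_max 0 in q0 *.
  have xc0 : 0 <= x / c by rewrite divr_ge0// ltW.
  have s1 : 1 <= Num.sqrt (1 + (x / c) ^+ 2).
    by rewrite -[leLHS]sqrtr1 ler_sqrt ?lerDl ?sqr_ge0// addr_ge0// sqr_ge0.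
  have s0 := lt_le_trans ltr01 s1.
  rewrite /polar_kernel sin_atan ger0_norm; last first.
    by rewrite mulr_ge0// invr_ge0 ltW.
  rewrite /slope_cst expr0 mulr1 -[leLHS]mulrA -[leRHS]mulrA ler_pM2l ?invr_gt0//.
  have D0 : 0 < c ^+ 2 + x ^+ 2 by rewrite ltr_pwDl ?exprn_gt0// sqr_ge0.
  rewrite [leRHS](_ : _ = x * ((Num.sqrt (1 + (x / c) ^+ 2))^-1 *
    (c ^+ 2 / (c ^+ 2 + x ^+ 2)))); last first.
    rewrite /cauchy_kernel; field.
    by rewrite !gt_eqF//=.
  rewrite ler_wpM2l// [leLHS]expr2 ler_wpM2r//.
    by rewrite divr_ge0 ?sqr_ge0// ltW.
  have -> : c ^+ 2 / (c ^+ 2 + x ^+ 2) = (Num.sqrt (1 + (x / c) ^+ 2) ^+ 2)^-1.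
    rewrite sqr_sqrtr; last by rewrite addr_ge0// sqr_ge0.
    by field; rewrite !gt_eqF//= ltr_pwDl ?sqr_ge0 ?mulr_gt0.
  by rewrite lef_pV2 ?posrE ?exprn_gt0// expr2 ler_peMl// ltW.
set x := q ord0 0; set c1 := Num.sqrt _.
have D0 : 0 < c ^+ 2 + x ^+ 2 by rewrite ltr_pwDl ?exprn_gt0// sqr_ge0.
have c10 : 0 < c1 by rewrite sqrtr_gt0.
have c1E : c1 ^+ 2 = c ^+ 2 + x ^+ 2 by rewrite sqr_sqrtr// ltW.
have cc1 : c <= c1.
  by rewrite -(@ler_pXn2r _ 2)// ?nnegrE ?(ltW c10) ?(ltW c0)// c1E lerDl sqr_ge0.
have qm : vtail q ord_max 0 = q ord_max 0.
  by rewrite vtailE; congr (q _ _); exact/val_inj.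
have := IH c1 (vtail q) c10; rewrite qm => /(_ q0) IH1.
have sE : c1 ^+ 2 + sqnorm (vtail q) = c ^+ 2 + sqnorm q.
  by rewrite -[in RHS](vcons_eta q) sqnorm_vcons c1E addrA.
rewrite sE in IH1; set C := c ^+ 2 + sqnorm q in IH1 *.
have C0 : 0 < C by rewrite ltr_pwDl ?exprn_gt0// sqnorm_ge0.
rewrite /cauchy_kernel -c1E.
rewrite [leRHS](_ : _ = pi^-1 * (slope_pdf c1 (vtail q) * c1 ^+ m.+2) *
   (c / c1) ^+ m.+4); last first.
  rewrite expr_div_n (exprS c m.+3) (_ : c1 ^+ m.+4 = c1 ^+ 2 * c1 ^+ m.+2).
    by move: (pi^-1 : R) => ip; field; rewrite !gt_eqF ?exprn_gt0.
  by rewrite -exprD.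
rewrite slope_cstS -[in leLHS](mulrA pi^-1) -[leLHS]mulrA -[leRHS]mulrA.
rewrite ler_pM2l ?invr_gt0 ?pi_gt0//.
have P0 : 0 <= slope_cst m * q ord_max 0 by rewrite mulr_ge0// ltW// slope_cst_gt0.
have t0 : 0 <= c / c1 by rewrite divr_ge0// ltW.
have t1 : c / c1 <= 1 by rewrite ler_pdivrMr// mul1r.
apply: (@le_trans _ _ (slope_cst m * q ord_max 0 * (c1 ^+ 2 / C) ^+ m.+2 *
    (c / c1) ^+ m.+4)); last first.
  by rewrite ler_wpM2r// exprn_ge0.
rewrite -[leRHS]mulrA ler_wpM2l//.
have e0 : 0 <= c ^+ 2 / C by rewrite divr_ge0 ?sqr_ge0// ltW.
have e1 : c ^+ 2 / C <= 1 by rewrite ler_pdivrMr// mul1r lerDl sqnorm_ge0.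
(* One of the [m + 3] factors [c^2 / C] is dropped. The others contain [c / c1] to the power
   [2m + 4], which is at most the available power [m + 4], since [c / c1 <= 1]. *)
rewrite exprS; apply: (@le_trans _ _ ((c ^+ 2 / C) ^+ m.+2)).
  by rewrite ler_piMl// exprn_ge0.
have -> : c ^+ 2 / C = c1 ^+ 2 / C * (c / c1) ^+ 2 by field; rewrite !gt_eqF.
rewrite exprMn ler_wpM2l ?exprn_ge0 ?divr_ge0 ?sqr_ge0 ?(ltW C0)//.
rewrite -exprM; apply: ler_wiXn2l => //.
by rewrite mulnC muln2 -addnn !addnS !addSn !ltnS leq_addr.
Qed.

End slope_pdf_bounds.

(** * Geometry and asymptotics of one step *)

(* The last row of an angle vector is the polar angle. *)
Definition vtheta {R : realType} m (v : 'cV[R]_m.+1) : R := v ord_max 0.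

Definition vphi {R : realType} m (v : 'cV[R]_m.+1) (i : 'I_m) : R :=
  v (lift ord_max i) 0.

Notation vstep v := (axial_step (vtheta v) (vphi v)).
Notation vlanding v := (transverse_landing (vtheta v) (vphi v)).

Section reflection_geometry.
Context {R : realType}.

Notation vaxial v := (axial_dir (vtheta v) (vphi v)).
Notation vtransverse v := (transverse_dir (vtheta v) (vphi v)).
Lemma vtheta_vcons m x (v : 'cV[R]_m.+1) : vtheta (vcons x v) = vtheta v.
Proof.
rewrite /vtheta (_ : ord_max = lift ord0 ord_max) ?vconsS//; exact/val_inj.
Qed.

Lemma vphi_vcons0 m x (v : 'cV[R]_m.+1) : vphi (vcons x v) ord0 = x.
Proof.
rewrite /vphi (_ : lift ord_max ord0 = ord0) ?vcons0//; exact/val_inj.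
Qed.

Lemma lift_max_lift0 m (i : 'I_m) :
  lift (ord_max : 'I_m.+2) (lift ord0 i) = lift ord0 (lift ord_max i : 'I_m.+1).
Proof. by apply: ord_inj; rewrite lift_max !lift0 lift_max. Qed.

Lemma vphi_vconsS m x (v : 'cV[R]_m.+1) i :
  vphi (vcons x v) (lift ord0 i) = vphi v i.
Proof.
by rewrite /vphi lift_max_lift0 vconsS.
Qed.

Lemma axial_dir_vcons m x (v : 'cV[R]_m.+1) :
  vaxial (vcons x v) = cos x * vaxial v.
Proof.
rewrite /axial_dir vtheta_vcons big_ord_recl vphi_vcons0 mulrCA.
by under eq_bigr do rewrite vphi_vconsS.
Qed.

Lemma transverse_dir_vcons m x (v : 'cV[R]_m.+1) :
  vtransverse (vcons x v) = vcons (sin x * vaxial v) (vtransverse v).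
Proof.
apply/colP => i; rewrite mxE; have [j ->|->] := unliftP ord0 i.
  rewrite vconsS mxE; have [l ->|->] := unliftP ord_max j.
    rewrite -lift_max_lift0 liftK vtheta_vcons vphi_vconsS; congr (_ * _).
    rewrite big_mkcond big_ord_recl/= mul1r [RHS]big_mkcond.
    by apply: eq_bigr => k _; rewrite vphi_vconsS /= /bump/= !add1n ltnS.
  rewrite (_ : lift ord0 ord_max = ord_max); last exact/val_inj.
  by rewrite unlift_none vtheta_vcons.
rewrite vcons0 (_ : ord0 = lift ord_max ord0); last exact/val_inj.
rewrite liftK vtheta_vcons vphi_vcons0 /axial_dir -mulrA mulrCA.
congr (_ * (_ * _)); rewrite big_mkcond big_ord_recl/= mul1r.
by apply: eq_bigr => k _; rewrite vphi_vconsS.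
Qed.

Lemma transverse_dir_last m (v : 'cV[R]_m.+1) :
  vtransverse v ord_max 0 = cos (vtheta v).
Proof. by rewrite mxE unlift_none. Qed.

(** These are spherical coordinates: the axial and transverse parts form a unit vector. *)
Lemma sqnorm_transverse_dir m (v : 'cV[R]_m.+1) :
  sqnorm (vtransverse v) = 1 - vaxial v ^+ 2.
Proof.
elim: m v => [|m IH] v.
  rewrite /sqnorm big_ord1 (_ : ord0 = ord_max); last exact/val_inj.
  rewrite transverse_dir_last /axial_dir big_ord0 mulr1.
  by rewrite -(cos2Dsin2 (vtheta v)) addrK.
rewrite -(vcons_eta v) transverse_dir_vcons sqnorm_vcons IH axial_dir_vcons.
by rewrite !exprMn sin2cos2; ring.
Qed.

Lemma scaled_slopeE m (c : R) (v : 'cV[R]_m.+1) : vaxial v != 0 ->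
  scaled_slope c v = (c / vaxial v) *: vtransverse v.
Proof.
elim: m c v => [|m IH] c v /=.
  move=> _; apply/colP => i; have -> : i = ord_max by apply: ord_inj; case: i => -[].
  rewrite [RHS]mxE transverse_dir_last /axial_dir big_ord0 mulr1.
  rewrite /vtheta (_ : ord_max = ord0) ?vcons0; last exact/val_inj.
  by rewrite mulrA mulrAC.
have wE : vaxial v = cos (v ord0 0) * vaxial (vtail v).
  by rewrite -[in LHS](vcons_eta v) axial_dir_vcons.
have tE : vtransverse v =
    vcons (sin (v ord0 0) * vaxial (vtail v)) (vtransverse (vtail v)).
  by rewrite -[in LHS](vcons_eta v) transverse_dir_vcons.
rewrite wE tE mulf_eq0 => /norP[cx wx]; rewrite IH//; apply/colP => i; rewrite [RHS]mxE.
have [j ->|->] := unliftP ord0 i; last first.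
  by rewrite !vcons0 /tan; field; rewrite cx wx.
by rewrite !vconsS [LHS]mxE [in RHS]invfM [c * (_ * _)]mulrA.
Qed.

(** Valid also for a vanishing axial direction, since [0^-1 = 0] makes inversion multiplicative
    everywhere. *)
Lemma scaled_slope_last m (c : R) (v : 'cV[R]_m.+1) :
  scaled_slope c v ord_max 0 = c * cos (vtheta v) / vaxial v.
Proof.
elim: m c v => [|m IH] c v /=.
  rewrite (_ : ord_max = ord0) ?vcons0; last exact/val_inj.
  rewrite /axial_dir big_ord0 mulr1 /vtheta (_ : ord_max = ord0); last exact/val_inj.
  by rewrite mulrA.
rewrite (_ : ord_max = lift ord0 ord_max) ?vconsS ?IH; last exact/val_inj.
rewrite -[in RHS](vcons_eta v) axial_dir_vcons vtheta_vcons [in RHS]invfM.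
by rewrite mulrA; congr (_ * _); rewrite mulrAC.
Qed.

Lemma dotv_south_pole m (w : 'cV[R]_m.+1) : dotv (south_pole m) w = - w ord_max 0.
Proof.
rewrite /dotv (bigD1 ord_max)//= big1 ?addr0.
  by rewrite !mxE !eqxx mulN1r.
by move=> i im; rewrite !mxE (negbTE im) oppr0 mul0r.
Qed.

Lemma sqnorm_south_pole m : sqnorm (@south_pole R m) = 1.
Proof. by rewrite -dotvv dotv_south_pole !mxE !eqxx opprK. Qed.

Lemma sqnorm_south_poleD m (w : 'cV[R]_m.+1) :
  sqnorm (south_pole m + w) = 1 - 2 * w ord_max 0 + sqnorm w.
Proof. by rewrite sqnormD sqnorm_south_pole dotv_south_pole mulrN. Qed.

Lemma chord_length_sqr m (v : 'cV[R]_m.+1) :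
  chord_length (vtheta v) (vphi v) ^+ 2 * (1 - vaxial v ^+ 2) =
  2 * chord_length (vtheta v) (vphi v) * cos (vtheta v).
Proof.
rewrite /chord_length; have [->|D0] := eqVneq (1 - vaxial v ^+ 2) 0.
  by rewrite invr0 !mulr0 mul0r.
by field.
Qed.

Lemma sqnormZ n (a : R) (u : 'cV[R]_n) : sqnorm (a *: u) = a ^+ 2 * sqnorm u.
Proof. by rewrite /sqnorm mulr_sumr; apply: eq_bigr => i _; rewrite mxE exprMn. Qed.

(** [chord_length] solves the quadratic equation that brings the ray back to the cylinder. When its
    denominator vanishes it is 0, and the landing point is the south pole itself. *)
Lemma sqnorm_transverse_landing m (v : 'cV[R]_m.+1) : sqnorm (vlanding v) = 1.
Proof.
rewrite sqnorm_south_poleD mxE transverse_dir_last.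
rewrite sqnormZ sqnorm_transverse_dir chord_length_sqr; ring.
Qed.

Lemma axial_dir_sqr_le1 m (v : 'cV[R]_m.+1) : vaxial v ^+ 2 <= 1.
Proof. by rewrite -subr_ge0 -sqnorm_transverse_dir sqnorm_ge0. Qed.

(** The straight ray stays inside the cylinder until it lands, and at axial distance [u] its
    transverse position is [south_pole m + scaled_slope u v]. For a nonpositive axial direction both
    sides fail: the step is at most 0, and so is the last coordinate of the slope. *)
Lemma lt_axial_step m (u : R) (v : 'cV[R]_m.+1) : 0 < u -> 0 <= cos (vtheta v) ->
  (u < vstep v) = (sqnorm (south_pole m + scaled_slope u v) < 1).
Proof.
move=> u0 c0; rewrite sqnorm_south_poleD scaled_slope_last.
have R0 : 0 <= chord_length (vtheta v) (vphi v).
  by rewrite /chord_length divr_ge0 ?mulr_ge0// subr_ge0 axial_dir_sqr_le1.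
have [w0|w0] := leP (vaxial v) 0.
  have -> : (u < vstep v) = false.
    apply/negbTE; rewrite -leNgt (le_trans _ (ltW u0))//.
    by rewrite /axial_step mulr_ge0_le0.
  apply/esym/negbTE; rewrite -leNgt -addrA lerDl addrC subr_ge0.
  rewrite (@le_trans _ _ 0) ?sqnorm_ge0//.
  by rewrite mulr_ge0_le0// mulr_ge0_le0 ?invr_le0// mulr_ge0// ltW.
rewrite scaled_slopeE ?gt_eqF// sqnormZ sqnorm_transverse_dir.
rewrite /axial_step /chord_length; set w := vaxial v in w0 *.
have w1 : w ^+ 2 <= 1 by exact: axial_dir_sqr_le1.
rewrite -addrA gtrDl addrC subr_lt0 expr_div_n.
have -> : 2 * (u * cos (vtheta v) / w) = u / w ^+ 2 * (2 * cos (vtheta v) * w).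
  by field; rewrite gt_eqF.
have -> : u ^+ 2 / w ^+ 2 * (1 - w ^+ 2) = u / w ^+ 2 * (u * (1 - w ^+ 2)).
  by field; rewrite gt_eqF.
rewrite ltr_pM2l ?divr_gt0 ?exprn_gt0//.
(* If the axial direction has square 1, the transverse direction vanishes and with it
   [cos (vtheta v)]; then both inequalities read [u < 0]. *)
have [D0|D0] := eqVneq (1 - w ^+ 2) 0.
  have := sqr_coord_le (vtransverse v) ord_max.
  rewrite sqnorm_transverse_dir -/w D0 transverse_dir_last.
  rewrite le_eqVlt ltNge sqr_ge0 orbF sqrf_eq0 => /eqP ->.
  by rewrite !(mulr0, mul0r) ltxx ltNge (ltW u0).
have {}D0 : 0 < 1 - w ^+ 2 by rewrite lt_def D0 subr_ge0.
by rewrite mulrAC ltr_pdivlMr.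
Qed.

(** The chord length cancels: [u / vstep v] times the transverse displacement is [u] over the axial
    direction, times the transverse direction. *)
Lemma interpolated_landing m (M : 'M[R]_m.+1) (u : R) (v : 'cV[R]_m.+1) :
  0 < u -> u < vstep v ->
  M *m south_pole m + (u / vstep v) *: (M *m vlanding v - M *m south_pole m) =
  M *m (south_pole m + scaled_slope u v).
Proof.
move=> u0 uv; have : vstep v != 0 by rewrite gt_eqF// (lt_trans u0).
rewrite /axial_step mulf_eq0 => /norP[R0 w0].
rewrite -mulmxBr /transverse_landing [X in X - _]addrC addrK scalemxAr.
rewrite -mulmxDr scaled_slopeE// scalerA; congr (_ *m (_ + _ *: _)).
by field; rewrite R0 w0.
Qed.

End reflection_geometry.

Section measurable_reflection_step.
Context {R : realType} d (T : measurableType d) (m : nat).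
Variables (th : T -> R) (ph : 'I_m -> T -> R).
Hypotheses (mth : measurable_fun setT th).
Hypotheses (mph : forall i, measurable_fun setT (ph i)).

Lemma measurable_axial_dir :
  measurable_fun setT (fun t => axial_dir (th t) (ph^~ t)).
Proof.
apply: measurable_funM; first exact: (measurableT_comp measurable_sin).
by apply: measurable_prod => i _; exact: (measurableT_comp measurable_cos).
Qed.

Lemma measurable_chord_length :
  measurable_fun setT (fun t => chord_length (th t) (ph^~ t)).
Proof.
apply: measurable_funM.
  by apply: measurable_funM => //; exact: (measurableT_comp measurable_cos).
apply: measurable_funV; apply: measurable_funB => //.
by apply: measurable_funX; exact: measurable_axial_dir.
Qed.

Lemma measurable_axial_step :
  measurable_fun setT (fun t => axial_step (th t) (ph^~ t)).
Proof.
by apply: measurable_funM; [exact: measurable_chord_length|exact: measurable_axial_dir].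
Qed.

Lemma measurable_transverse_landing :
  measurable_fun setT (fun t => transverse_landing (th t) (ph^~ t) : borel_cV R m.+1).
Proof.
apply: measurable_cVD => //; apply: measurable_cVZ; first exact: measurable_chord_length.
apply: measurable_cVP => j; under eq_fun do rewrite mxE.
case: (unlift ord_max j) => [i|]; last exact: (measurableT_comp measurable_cos).
apply: measurable_funM.
  by apply: measurable_funM; apply: (measurableT_comp measurable_sin).
rewrite (_ : (fun t => _) = (fun t => \prod_(l < m) if (i < l)%N then cos (ph l t) else 1)).
  apply: measurable_prod => l _; case: (i < l)%N => //.
  exact: (measurableT_comp measurable_cos).
by apply/funext => t; rewrite big_mkcond.
Qed.

End measurable_reflection_step.

(** * Crossing a large gap in one step *)

Section one_step_asymptotics.
Context {R : realType} (m : nat).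

Lemma measurable_vtheta : measurable_fun setT (@vtheta R m : borel_cV R m.+1 -> R).
Proof. exact: measurable_coord. Qed.

Lemma measurable_vphi i : measurable_fun setT ((@vphi R m)^~ i : borel_cV R m.+1 -> R).
Proof. exact: measurable_coord. Qed.

Lemma measurable_vstep d (T : measurableType d) (v : T -> borel_cV R m.+1) :
  measurable_fun setT v -> measurable_fun setT (fun t => vstep (v t)).
Proof.
move=> mv; apply: measurable_axial_step.
  exact: (measurableT_comp measurable_vtheta).
by move=> i; exact: (measurableT_comp (measurable_vphi i)).
Qed.

Lemma measurable_vlanding d (T : measurableType d) (v : T -> borel_cV R m.+1) :
  measurable_fun setT v ->
  measurable_fun setT (fun t => vlanding (v t) : borel_cV R m.+1).
Proof.
move=> mv; apply: measurable_transverse_landing.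
  exact: (measurableT_comp measurable_vtheta).
by move=> i; exact: (measurableT_comp (measurable_vphi i)).
Qed.

(** Gives [cos (vtheta v) >= 0] almost everywhere, as [lt_axial_step] requires. *)
Lemma angle_law_conull k :
  angle_law k [set v : 'cV[R]_k.+1 | ~ (@halfpi_itv R) (vtheta v)] = 0%E.
Proof.
elim: k => [|k IH]; rewrite /angle_law prodm_sections.
  transitivity (\int[@theta_prob R]_x (\1_(~` @halfpi_itv R) x)%:E)%E.
    apply: eq_integral => x _; rewrite /= diracE indicE; congr ((nat_of_bool _)%:R%:E).
    apply/idP/idP; rewrite !inE /vtheta (_ : ord_max = ord0) /= ?vcons0//;
    exact/val_inj.
  rewrite integral_indic//; last by apply: measurableC; exact: measurable_itv.
  rewrite setIT -[LHS]theta_lawE /theta_law.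
  by rewrite (_ : ~` _ `&` _ = set0) ?integral_set0// setICl.
apply: integral0_eq => x _; rewrite -[RHS]IH; congr (_ _).
by apply/seteqP; split => v /=; rewrite vtheta_vcons.
Qed.

Variables (M : 'M[R]_m.+1) (f : borel_cV R m.+1 -> R) (u : R).
Hypotheses (oM : orthogonal_mx M) (mf : measurable_fun setT f).
Hypotheses (f0 : forall p, 0 <= f p) (u0 : 0 < u).

Definition overshoot_exit (v : 'cV[R]_m.+1) : 'cV[R]_m.+1 :=
  M *m south_pole m + (u / vstep v) *: (M *m vlanding v - M *m south_pole m).

(* Up to a constant, the limit mean of [f] at the exit point when the last
   reflection is at [y]. *)
Definition exit_mean (y : 'cV[R]_m.+1) : \bar R :=
  (\int[vol m.+1]_p ((sqnorm p < 1)%R%:R * (1 - dotv y p) * f p)%R%:E)%E.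

(** The test function seen from the south pole: [q] is the displacement from the pole to the exit
    point, before the rotation [M]. *)
Let h (q : borel_cV R m.+1) : R :=
  (sqnorm (south_pole m + q) < 1)%R%:R * f (M *m (south_pole m + q)).

Let mMS : measurable_fun setT
  (fun q : borel_cV R m.+1 => M *m (south_pole m + q) : borel_cV R m.+1).
Proof. by apply: measurable_mulmx => // ; exact: measurable_cVD. Qed.

Let mh : measurable_fun setT h.
Proof.
apply: measurable_funM; last by apply: (measurableT_comp mf); exact: mMS.
apply: measurable_natr_bool; apply: measurable_fun_ltr => //.
by apply: measurable_sqnorm; exact: measurable_cVD.
Qed.

Let h0 q : 0 <= h q. Proof. by rewrite mulr_ge0. Qed.

(** The open ball lies strictly above its tangent hyperplane at the south pole. This is the
    vanishing condition of [integral_scaled_slope]. *)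
Let hN (q : 'cV[R]_m.+1) : q ord_max 0 <= 0 -> h q = 0.
Proof.
move=> q0; rewrite /h ltNge sqnorm_south_poleD.
rewrite (_ : 1 <= _) ?mul0r// -addrA lerDl addrC subr_ge0.
by rewrite (le_trans _ (sqnorm_ge0 q))// mulr_ge0_le0.
Qed.

(** Substitute [p = M (e + q)], with [e] the south pole and [y = M e]: then
    [q ord_max 0 = - e . q = 1 - y . p], and the volume is invariant under rotation and
    translation. *)
Let exit_meanE : (\int[vol m.+1]_q (q ord_max 0 * h q)%R%:E =
  exit_mean (M *m south_pole m))%E.
Proof.
pose F (p : borel_cV R m.+1) :=
  ((sqnorm p < 1)%R%:R * (1 - dotv (M *m south_pole m) p) * f p)%:E.
have mF : measurable_fun setT F.
  apply/measurable_EFinP; apply: measurable_funM => //; apply: measurable_funM.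
    apply: measurable_natr_bool; apply: measurable_fun_ltr => //.
    exact: measurable_sqnorm.
  by apply: measurable_funB => //; exact: measurable_dotv.
have F0 p : (0 <= F p)%E.
  rewrite lee_fin; have [p1|p1] := ltP (sqnorm p) 1; last by rewrite mul0r mul0r.
  rewrite mul1r mulr_ge0// subr_ge0 (le_trans (ler_norm _))//.
  by rewrite dotv_le1 ?(ltW p1)// sqnorm_orthogonal// sqnorm_south_pole.
rewrite /exit_mean -[RHS](integral_vol_orthogonal oM mF F0).
rewrite -(@integral_vol_shift _ _ (south_pole m) (fun q => F (M *m q)))//; last first.
  by apply: (measurableT_comp mF); exact: measurable_mulmx.
apply: eq_integral => q _; rewrite /F /h (addrC q) sqnorm_orthogonal//.
rewrite dotv_orthogonal// dotvDr dotvv sqnorm_south_pole dotv_south_pole.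
by congr (_%:E); ring.
Qed.

(** By [lt_axial_step] and [interpolated_landing], the left integrand is almost everywhere a
    function of the slope alone, whose density is known. *)
Let overshootE : (\int[angle_law m]_v ((u < vstep v)%R%:R * f (overshoot_exit v))%R%:E =
  \int[vol m.+1]_q (slope_pdf u q * h q)%R%:E)%E.
Proof.
transitivity (\int[angle_law m]_v (h (scaled_slope u v))%:E)%E.
  apply: (@eq_integral_conull _ _ _ (angle_law m)
    [set v : borel_cV R m.+1 | (@halfpi_itv R) (vtheta v)]).
  - by rewrite -[X in measurable X]setTI; apply: measurable_vtheta => //; exact: measurable_itv.
  - exact: angle_law_conull.
  - apply/measurable_EFinP; apply: measurable_funM.
      apply: measurable_natr_bool; apply: measurable_fun_ltr => //.
      exact: measurable_vstep.
    apply: (measurableT_comp mf); apply: measurable_cVD => //; apply: measurable_cVZ.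
      by apply: measurable_funM => //; apply: measurable_funV; exact: measurable_vstep.
    apply: measurable_cVB => //; apply: measurable_mulmx => //.
    exact: measurable_vlanding.
  - apply/measurable_EFinP; apply: (measurableT_comp mh).
    exact: (measurable_scaled_slope (c := cst u) (v := id)).
  - move=> v /=; rewrite /halfpi_itv/= in_itv/= => vK; congr (_%:E).
    rewrite /h -lt_axial_step ?cos_ge0_pihalf//.
    have [uv|] := ltP u (vstep v); last by rewrite !mul0r.
    by rewrite /overshoot_exit interpolated_landing.
rewrite (integral_scaled_slope (g := fun q => (h q)%:E))//.
- exact/measurable_EFinP.
- by move=> q q0; rewrite hN.
Qed.

Let mslope : measurable_fun setT (fun q : borel_cV R m.+1 => slope_pdf u q).
Proof. exact: (measurable_slope_pdf (c := cst u) (q := id)). Qed.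

Let mlast : measurable_fun setT (fun q : borel_cV R m.+1 => q ord_max 0).
Proof. exact: measurable_coord. Qed.

Let lasth0 (q : 'cV[R]_m.+1) : 0 <= q ord_max 0 * h q.
Proof.
have [q0|q0] := leP (q ord_max 0) 0; first by rewrite hN ?mulr0.
by rewrite mulr_ge0// ltW.
Qed.

Lemma overshoot_le :
  ((u ^+ m.+2)%R%:E *
    \int[angle_law m]_v ((u < vstep v)%R%:R * f (overshoot_exit v))%R%:E <=
   (slope_cst m)%:E * exit_mean (M *m south_pole m))%E.
Proof.
rewrite overshootE -exit_meanE -!ge0_integralZl//; last 6 first.
- by apply/measurable_EFinP; exact: measurable_funM.
- by move=> q _; rewrite lee_fin lasth0.
- by rewrite lee_fin ltW// slope_cst_gt0.
- by apply/measurable_EFinP; exact: measurable_funM.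
- by move=> q _; rewrite lee_fin mulr_ge0// slope_pdf_ge0// ltW.
- by rewrite lee_fin exprn_ge0// ltW.
apply: ge0_le_integral => //.
- by move=> q _; rewrite -EFinM lee_fin mulr_ge0 ?exprn_ge0 ?(ltW u0)// mulr_ge0// slope_pdf_ge0// ltW.
- by apply/measurable_EFinP; apply: measurable_funM => //; exact: measurable_funM.
- by apply/measurable_EFinP; apply: measurable_funM => //; exact: measurable_funM.
move=> q _; rewrite -!EFinM lee_fin (mulrA _ (slope_pdf u q)) (mulrA _ (q ord_max 0)).
have [q0|q0] := leP (q ord_max 0) 0; first by rewrite hN ?mulr0.
by rewrite ler_wpM2r// mulrC slope_pdf_le// ltW.
Qed.

Lemma overshoot_ge :
  ((slope_cst m * (u ^+ 2 / (u ^+ 2 + 4)) ^+ m.+2)%R%:E *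
      exit_mean (M *m south_pole m) <=
   (u ^+ m.+2)%R%:E *
    \int[angle_law m]_v ((u < vstep v)%R%:R * f (overshoot_exit v))%R%:E)%E.
Proof.
have r0 : 0 <= u ^+ 2 / (u ^+ 2 + 4) by rewrite divr_ge0 ?addr_ge0 ?sqr_ge0.
have D0 : 0 < u ^+ 2 + 4 by rewrite ltr_wpDl ?sqr_ge0.
rewrite overshootE -exit_meanE -!ge0_integralZl//; last 6 first.
- by apply/measurable_EFinP; exact: measurable_funM.
- by move=> q _; rewrite lee_fin mulr_ge0// slope_pdf_ge0// ltW.
- by rewrite lee_fin exprn_ge0// ltW.
- by apply/measurable_EFinP; exact: measurable_funM.
- by move=> q _; rewrite lee_fin lasth0.
- by rewrite lee_fin mulr_ge0 ?exprn_ge0// ltW// slope_cst_gt0.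
apply: ge0_le_integral => //.
- by move=> q _; rewrite -EFinM lee_fin mulr_ge0// mulr_ge0 ?exprn_ge0// ltW// slope_cst_gt0.
- by apply/measurable_EFinP; apply: measurable_funM => //; exact: measurable_funM.
- by apply/measurable_EFinP; apply: measurable_funM => //; exact: measurable_funM.
move=> q _; rewrite -!EFinM lee_fin (mulrA _ (slope_pdf u q)) (mulrA _ (q ord_max 0)).
have [q0|q0] := leP (q ord_max 0) 0; first by rewrite hN ?mulr0.
rewrite /h; have [q1|q1] := ltP (sqnorm (south_pole m + q)) 1; last first.
  by rewrite mul0r !mulr0.
rewrite mul1r ler_wpM2r// [leRHS]mulrC.
apply: le_trans (slope_pdf_ge u0 (ltW q0)).
rewrite [leLHS]mulrAC ler_wpM2l//; first exact: mulr_ge0 (ltW (slope_cst_gt0 _)) (ltW q0).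
(* Origin of the 4: membership in the ball gives [sqnorm q < 2 * q ord_max 0], and
   [q ord_max 0 ^+ 2 <= sqnorm q] then forces [q ord_max 0 < 2]. *)
have q2 : sqnorm q <= 4.
  move: q1; rewrite sqnorm_south_poleD -addrA gtrDl => q1.
  have l2 : q ord_max 0 ^+ 2 <= sqnorm q by exact: sqr_coord_le.
  nra.
have Q0 : 0 < u ^+ 2 + sqnorm q by rewrite ltr_pwDl ?exprn_gt0 ?sqnorm_ge0.
have r'0 : 0 <= u ^+ 2 / (u ^+ 2 + sqnorm q) by rewrite divr_ge0 ?sqr_ge0// ltW.
rewrite ler_pXn2r ?nnegrE// ler_wpM2l ?sqr_ge0//.
by rewrite lef_pV2 ?posrE// lerD2l.
Qed.

End one_step_asymptotics.

(** * The Markov chain of reflection points *)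

Section independent_vectors.
Context {R : realType} d (T : measurableType d) (P : probability T R).

Definition vec n (X : nat -> T -> R) (w : T) : 'cV[R]_n := \col_(i < n) X i w.

Lemma vecS n X w : vec n.+1 X w = vcons (X 0%N w) (vec n (X \o S) w).
Proof.
apply/colP => i; rewrite mxE; have [j ->|->] := unliftP ord0 i.
  by rewrite vconsS mxE.
by rewrite vcons0.
Qed.

Lemma measurable_vec n (X : nat -> T -> R) : (forall i, measurable_fun setT (X i)) ->
  measurable_fun setT (vec n X : T -> borel_cV R n).
Proof.
by move=> mX; apply: measurable_cVP => i; under eq_fun do rewrite mxE; exact: mX.
Qed.

(** [E] is arbitrary so that the induction can absorb the event that the first coordinate lies in a
    given Borel set. The law, conditional on [E], of the first coordinate and the tail is then a
    product on rectangles, hence the product measure. *)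
Lemma independent_vec n (X : nat -> T -> R)
    (mu : nat -> {sigma_finite_measure set (measurableTypeR R) -> \bar R}) (E : set T) :
  (forall i, measurable_fun setT (X i)) -> (forall i, mu i setT = 1%E) ->
  measurable E ->
  (forall B : nat -> set (measurableTypeR R), (forall i, measurable (B i)) ->
    P (E `&` [set w | forall i, (i < n)%N -> B i (X i w)]) =
    P E * \prod_(i < n) mu i (B i))%E ->
  forall C : set (borel_cV R n), measurable C ->
    P (E `&` vec n X @^-1` C) = (P E * prodm n mu C)%E.
Proof.
elim: n X mu E => [|n IH] X mu E mX mu1 mE indE C mC.
  rewrite /= diracE; have [C0|C0] := boolP (0 \in C).
    rewrite (_ : vec 0 X @^-1` C = setT) ?setIT ?mule1//.
    by apply/seteqP; split => // w _ /=; rewrite (flatmx0 (vec 0 X w)); exact/set_mem.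
  rewrite (_ : vec 0 X @^-1` C = set0) ?setI0 ?measure0 ?mule0//.
  apply/seteqP; split => // w /=; rewrite (flatmx0 (vec 0 X w)) => /mem_set.
  by rewrite (negbTE C0).
(* Null events are set apart because the conditional law divides by [P E]. *)
have [PE0|PE0] := eqVneq (P E) 0%E.
  rewrite PE0 mul0e; apply: (@subset_measure0 _ _ _ P _ E) => //.
  by apply: measurableI => //; rewrite -[X in measurable X]setTI; exact: measurable_vec.
have PEfin : P E \is a fin_num by exact: fin_num_measure.
pose e := fine (P E); have e0 : 0 < e by rewrite fine_gt0// lt0e PE0 measure_ge0 -ge0_fin_numE.
have PEe : P E = e%:E by rewrite fineK.
have e'0 : 0 <= e^-1 by rewrite invr_ge0 ltW.
pose Z (w : T) : measurableTypeR R * borel_cV R n := (X 0%N w, vec n (X \o S) w).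
have mZ : measurable_fun setT Z.
  by apply: measurable_fun_pair; [exact: mX|apply: measurable_vec => i; exact: mX].
pose m' := mscale (NngNum e'0) (image_measure (mrestr P mE) mZ).
have mXi (i : nat) (B : set (measurableTypeR R)) : measurable B -> measurable (X i @^-1` B).
  by move=> mB; rewrite -[X in measurable X]setTI; exact: mX.
have rect A B : measurable A -> measurable B -> m' (A `*` B) = (mu 0%N A * prodm n (mu \o S) B)%E.
  move=> mA mB; rewrite /m' /mscale/= /image_measure /mrestr.
  have -> : Z @^-1` (A `*` B) `&` E = (E `&` X 0%N @^-1` A) `&` vec n (X \o S) @^-1` B.
    by apply/seteqP; split => w /= => [[[a b] c]|[[a b] c]].
  have PEA : P (E `&` X 0%N @^-1` A) = (P E * mu 0%N A)%E.
    have := indE (fun i => if i == 0%N then A else setT).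
    rewrite big_ord_recl/= big1 ?mule1; last by move=> i _; exact: mu1.
    move=> <-; last by move=> i; case: (i == 0%N).
    by congr (P (_ `&` _)); apply/seteqP; split => w /=; [move=> Aw []|move=> /(_ 0%N erefl)].
  rewrite (IH (X \o S) (mu \o S))//.
  - by rewrite PEA PEe !muleA -EFinM mulVf ?gt_eqF// mul1e.
  - by move=> i; exact: mX.
  - by move=> i; exact: mu1.
  - by apply: measurableI => //; exact: mXi.
  - move=> B' mB'; rewrite PEA.
    have := indE (fun i => if i is i'.+1 then B' i' else A).
    rewrite big_ord_recl/= muleA => <-; last by case=> [|i]//; exact: mB'.
    congr (P _); apply/seteqP; split => w /=.
      by move=> [[Ew Aw] Bw]; split => // -[|i]//= ; rewrite ltnS; exact: Bw.
    move=> [Ew Bw]; split; first by split=> //; exact: (Bw 0%N).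
    by move=> i lin; exact: (Bw i.+1).
have mC' : measurable ((fun p : measurableTypeR R * borel_cV R n =>
    vcons p.1 p.2 : borel_cV R n.+1) @^-1` C).
  by rewrite -[X in measurable X]setTI; exact: measurable_vcons_pair.
have -> : prodm n.+1 mu C = m' ((fun p : measurableTypeR R * borel_cV R n =>
    vcons p.1 p.2 : borel_cV R n.+1) @^-1` C).
  exact: (product_measure_unique rect mC').
rewrite /m' /mscale/= /image_measure /mrestr PEe muleA -EFinM mulfV ?gt_eqF// mul1e.
congr (P _); rewrite setIC; congr (_ `&` _).
by apply/seteqP; split => w /=; rewrite vecS.
Qed.

End independent_vectors.

Section reflection_chain.
Context {R : realType} {m : nat} {T : Type}.
Variable U : 'cV[R]_m.+1 -> 'M[R]_m.+1.
Variable Sigma : T -> 'cV[R]_m.+1.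
Variables (Theta : nat -> T -> R) (Phi : nat -> 'I_m -> T -> R).

Definition angles (k : nat) (w : T) : 'cV[R]_m.+1 :=
  \col_j if unlift ord_max j is Some i then Phi k i w else Theta k w.

Lemma vtheta_angles k w : vtheta (angles k w) = Theta k w.
Proof. by rewrite /vtheta mxE unlift_none. Qed.

Lemma vphi_angles k w : vphi (angles k w) = fun i => Phi k i w.
Proof. by apply/funext => i; rewrite /vphi mxE liftK. Qed.

Lemma reflectionS k w : reflection U Sigma Theta Phi k.+1 w =
  ((reflection U Sigma Theta Phi k w).1 + vstep (angles k w),
   U (reflection U Sigma Theta Phi k w).2 *m vlanding (angles k w)).
Proof. by rewrite /= vtheta_angles vphi_angles; case: reflection. Qed.

Hypothesis hU : frame_choice U.
Hypothesis hSigma : forall w, usphere (Sigma w).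

Lemma usphere_reflection k w : usphere (reflection U Sigma Theta Phi k w).2.
Proof.
elim: k => [|k IH]; first exact: hSigma.
rewrite reflectionS /usphere/= sqnorm_orthogonal ?sqnorm_transverse_landing//.
by have [/(_ _ IH)[]] := hU.
Qed.

Lemma frame_orthogonal k w :
  orthogonal_mx (U (reflection U Sigma Theta Phi k w).2).
Proof. by have [/(_ _ (usphere_reflection k w))[]] := hU. Qed.

Lemma frame_south_pole k w :
  U (reflection U Sigma Theta Phi k w).2 *m south_pole m =
  (reflection U Sigma Theta Phi k w).2.
Proof. by have [/(_ _ (usphere_reflection k w))[]] := hU. Qed.

End reflection_chain.

Section measurable_reflection.
Context {R : realType} {m : nat} d (T : measurableType d).
Variable U : 'cV[R]_m.+1 -> 'M[R]_m.+1.
Variable Sigma : T -> 'cV[R]_m.+1.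
Variables (Theta : nat -> T -> R) (Phi : nat -> 'I_m -> T -> R).
Hypothesis hU : frame_choice U.
Hypothesis hSigma : forall w, usphere (Sigma w).
Hypothesis mSigma : measurable_fun setT (Sigma : T -> borel_cV R m.+1).

Lemma measurable_angles k : measurable_fun setT (Theta k) ->
  (forall i, measurable_fun setT (Phi k i)) ->
  measurable_fun setT (angles Theta Phi k : T -> borel_cV R m.+1).
Proof.
move=> mT mP; apply: measurable_cVP => j; under eq_fun do rewrite mxE.
by case: (unlift ord_max j).
Qed.

Lemma measurable_frame (y : T -> borel_cV R m.+1) i j : measurable_fun setT y ->
  (forall w, usphere (y w)) -> measurable_fun setT (fun w => U (y w) i j).
Proof.
move=> my ys; have [_ mU] := hU.
apply: (@measurable_comp _ _ _ T (borel_cV R m.+1) R (@usphere R m.+1)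
  (fun y => U y i j) setT y) => //; first exact: measurable_usphere.
by move=> _ [w _ <-]; exact: ys.
Qed.

(** Phrased with the angles of the first [k] steps, so that it applies to the sigma-algebra of the
    past as well as to that of the sample space. *)
Lemma measurable_reflection k :
  (forall j, (j < k)%N -> measurable_fun setT (Theta j)) ->
  (forall j i, (j < k)%N -> measurable_fun setT (Phi j i)) ->
  measurable_fun setT (fun w => (reflection U Sigma Theta Phi k w).1) /\
  measurable_fun setT
    (fun w => (reflection U Sigma Theta Phi k w).2 : borel_cV R m.+1).
Proof.
elim: k => [|k IH] mT mP; first by [].
have [m1 m2] : measurable_fun setT (fun w => (reflection U Sigma Theta Phi k w).1) /\
    measurable_fun setT
      (fun w => (reflection U Sigma Theta Phi k w).2 : borel_cV R m.+1).
  by apply: IH => *; [apply: mT|apply: mP]; exact: ltnW.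
have mA : measurable_fun setT (angles Theta Phi k : T -> borel_cV R m.+1).
  by apply: measurable_angles => *; [exact: mT|exact: mP].
split; under eq_fun do rewrite reflectionS/=.
  by apply: measurable_funD => //; exact: measurable_vstep.
apply: measurable_mulmx; last exact: measurable_vlanding.
by move=> i j; apply: measurable_frame => // w; exact: usphere_reflection.
Qed.

End measurable_reflection.

(** * Independence of the next angles from the past *)

Section markov_property.
Context {R : realType} {m : nat} {disp : measure_display} {T : measurableType disp}.
Variable P : probability T R.
Variable Sigma : {RV P >-> borel_cV R m.+1}.
Variables (Theta : nat -> {RV P >-> R}) (Phi : nat -> 'I_m -> {RV P >-> R}).
Hypothesis hTheta : forall k, has_law P (Theta k) theta_law.
Hypothesis hPhi : forall k i, has_law P (Phi k i) phi_law.
Hypothesis hind : mutually_independent P (angle_sigma_algebras Sigma Theta Phi).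

Let index : eqType := option (nat + nat * 'I_m).

Definition angle_index k (r : 'I_m.+1) : index :=
  if unlift ord_max r is Some i then Some (inr (k, i)) else Some (inl k).

Definition angle_indices k : seq index := [seq angle_index k r | r <- enum 'I_m.+1].

Fixpoint past_indices k : seq index :=
  if k is k'.+1 then past_indices k' ++ angle_indices k' else [:: None].

Let before k (a : index) : bool :=
  match a with
  | None => true
  | Some (inl j) => (j < k)%N
  | Some (inr (j, _)) => (j < k)%N
  end.

Let before_angle_index j k r : before k (angle_index j r) = (j < k)%N.
Proof. by rewrite /angle_index; case: unliftP. Qed.

Lemma angle_index_inj k : injective (angle_index k).
Proof.
move=> r s; rewrite /angle_index.
by case: unliftP => [i ->|->]; case: unliftP => [j ->|->] // [->].
Qed.

Let past_before k a : a \in past_indices k -> before k a.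
Proof.
elim: k => [|k IH] /=; first by rewrite inE => /eqP ->.
rewrite mem_cat => /orP[/IH|/mapP[r _ ->]]; last by rewrite before_angle_index.
by case: a {IH} => // -[j|[j i]] /= /ltnW; rewrite ltnS.
Qed.

Let uniq_angle_indices k : uniq (angle_indices k).
Proof. by rewrite map_inj_uniq ?enum_uniq//; exact: angle_index_inj. Qed.

Let uniq_past k : uniq (past_indices k).
Proof.
elim: k => [//|k IH] /=; rewrite cat_uniq IH uniq_angle_indices andbT /=.
apply/hasPn => _ /mapP[r _ ->]; apply/negP => /past_before.
by rewrite before_angle_index ltnn.
Qed.

(** A pi-system that generates the sigma-algebra of [Sigma] and the angles of the first [k]
    reflections. *)
Definition past_events k : set (set T) := [set E | exists A : index -> set T,
  (forall a, angle_sigma_algebras Sigma Theta Phi a (A a)) /\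
  E = \bigcap_(a in [set` past_indices k]) A a].

Let sigmaI a A B : angle_sigma_algebras Sigma Theta Phi a A ->
  angle_sigma_algebras Sigma Theta Phi a B ->
  angle_sigma_algebras Sigma Theta Phi a (A `&` B).
Proof.
case: a => [[j|[j i]]|] /= [C mC <-] [D mD <-]; exists (C `&` D);
  rewrite ?setTI ?preimage_setI//; exact: measurableI.
Qed.

Let sigma_measurable a A : angle_sigma_algebras Sigma Theta Phi a A -> measurable A.
Proof.
case: a => [[j|[j i]]|] /= [C mC <-]; rewrite setTI -[X in measurable X]setTI;
  exact: measurable_funPT.
Qed.

Let sigmaT a : angle_sigma_algebras Sigma Theta Phi a setT.
Proof. by case: a => [[j|[j i]]|] /=; exists setT => //; rewrite setTI. Qed.

Lemma past_events_measurable k : past_events k `<=` measurable.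
Proof.
move=> _ [A [sA ->]]; apply: fin_bigcap_measurable => // a _.
exact: (sigma_measurable (sA a)).
Qed.

Lemma past_measurable k F : (<<s past_events k >>) F -> measurable F.
Proof.
apply: smallest_sub; [exact: sigma_algebra_measurable|exact: past_events_measurable].
Qed.

Lemma past_eventsI k : setI_closed (past_events k).
Proof.
move=> _ _ [A [sA ->]] [B [sB ->]]; exists (fun a => A a `&` B a); split.
  by move=> a; exact: sigmaI.
by rewrite bigcapI.
Qed.

Lemma past_eventsT k : past_events k setT.
Proof.
by exists (fun=> setT); split => //; apply/seteqP; split => // w _ a _.
Qed.

Let past_index j k r : (j < k)%N -> angle_index j r \in past_indices k.
Proof.
elim: k => [//|k IH]; rewrite ltnS leq_eqVlt /= mem_cat => /orP[/eqP ->|/IH ->//].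
by apply/orP; right; apply: map_f; rewrite mem_enum.
Qed.

Let past_None k : None \in past_indices k.
Proof. by elim: k => [//|k IH] /=; rewrite mem_cat IH. Qed.

Let past_event a k E : a \in past_indices k ->
  angle_sigma_algebras Sigma Theta Phi a E -> past_events k E.
Proof.
move=> ak sE; exists (fun b => if b == a then E else setT); split.
  by move=> b; case: eqP => [->//|_]; exact: sigmaT.
apply/seteqP; split => w.
  by move=> Ew b _; case: eqP.
by move=> /(_ _ ak); rewrite eqxx.
Qed.

(** The sample space with the sigma-algebra of the past, so that being determined by the past
    becomes ordinary measurability. *)
Definition pastType k := g_sigma_algebraType (past_events k).

Lemma past_measurable_Sigma k :
  measurable_fun setT (Sigma : pastType k -> borel_cV R m.+1).
Proof.
move=> _ C mC; rewrite setTI; apply: sub_sigma_algebra.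
by apply: (past_event (past_None k)); exists C; rewrite ?setTI.
Qed.

Lemma past_measurable_Theta j k : (j < k)%N ->
  measurable_fun setT (Theta j : pastType k -> R).
Proof.
move=> jk _ C mC; rewrite setTI; apply: sub_sigma_algebra.
apply: (past_event (past_index ord_max jk)).
by rewrite /angle_index unlift_none; exists C; rewrite ?setTI.
Qed.

Lemma past_measurable_Phi j i k : (j < k)%N ->
  measurable_fun setT (Phi j i : pastType k -> R).
Proof.
move=> jk _ C mC; rewrite setTI; apply: sub_sigma_algebra.
apply: (past_event (past_index (lift ord_max i) jk)).
by rewrite /angle_index liftK; exists C; rewrite ?setTI.
Qed.

Let coordE k (r : 'I_m.+1) : (fun w => angles Theta Phi k w r 0) =
  if unlift ord_max r is Some i then (Phi k i : T -> R) else (Theta k : T -> R).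
Proof. by apply/funext => w; rewrite mxE; case: (unlift _ _). Qed.

Let measurable_angle k (r : 'I_m.+1) :
  measurable_fun setT (fun w => angles Theta Phi k w r 0).
Proof. by rewrite coordE; case: (unlift _ _) => [i|]; exact: measurable_funPT. Qed.

(** For fixed [B] both sides are finite measures in [F]. They agree on the pi-system [past_events]
    by mutual independence, hence on the sigma-algebra it generates. *)
Lemma past_angles_independent k (F : set T) (B : 'I_m.+1 -> set R) :
  (<<s past_events k >>) F -> (forall r, measurable (B r)) ->
  P (F `&` [set w | forall r, B r (angles Theta Phi k w r 0)]) =
  (P F * \prod_(r < m.+1) P [set w | B r (angles Theta Phi k w r 0%R)])%E.
Proof.
move=> sF mB; set G := [set w | _].
have mBr r : measurable [set w | B r (angles Theta Phi k w r 0)].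
  by rewrite -[X in measurable X]setTI; exact: measurable_angle.
have mG : measurable G.
  rewrite (_ : G = \bigcap_r [set w | B r (angles Theta Phi k w r 0)]).
    by apply: fin_bigcap_measurable => // r _.
  by apply/seteqP; split => w /=; [move=> h r _; exact: h|move=> h r; exact: h].
pose c := fine (\prod_(r < m.+1) P [set w | B r (angles Theta Phi k w r 0%R)])%E.
have c0 : 0 <= c by rewrite fine_ge0// prode_ge0.
have cE : (c%:E = \prod_(r < m.+1) P [set w | B r (angles Theta Phi k w r 0%R)])%E.
  by rewrite fineK// prode_fin_num// => r _; exact: fin_num_measure.
rewrite -cE muleC.
apply: (@g_sigma_algebra_measure_unique _ R T (past_events k) _ (fun=> setT)
  _ _ (mrestr P mG) (mscale (NngNum c0) P)) => //.
- exact: past_events_measurable.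
- by move=> _; exact: past_eventsT.
- by apply/seteqP; split => // w _; exists 0%N.
- exact: past_eventsI.
- move=> _ [A [sA ->]]; transitivity (c%:E * P (\bigcap_(a in [set` past_indices k]) A a))%E; last by [].
  rewrite cE /mrestr.
  (* Outside the past the event imposes [B]; within [past_indices k.+1] this concerns the angles of
     index [k] only. *)
  pose A' (a : index) : set T := if a \in past_indices k then A a else
    match a with
    | None => setT
    | Some (inl j) => Theta j @^-1` B ord_max
    | Some (inr (j, i)) => Phi j i @^-1` B (lift ord_max i)
    end.
  have A'p a : a \in past_indices k -> A' a = A a by rewrite /A' => ->.
  have A'n r : A' (angle_index k r) = [set w | B r (angles Theta Phi k w r 0)].
    rewrite /A'; case: ifPn => [/past_before|_].
      by rewrite before_angle_index ltnn.
    rewrite /angle_index; case: unliftP => [i ->|->]; apply/seteqP; split => w /=;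
      by rewrite mxE ?liftK ?unlift_none.
  have sA' a : angle_sigma_algebras Sigma Theta Phi a (A' a).
    rewrite /A'; case: ifP => // _; case: a => [[j|[j i]]|] /=.
    - by exists (B ord_max); rewrite ?setTI.
    - by exists (B (lift ord_max i)); rewrite ?setTI.
    - exact: (sigmaT None).
  have := hind (uniq_past k.+1) (fun a _ => sA' a).
  rewrite [in RHS]/= big_cat/= big_map big_enum/=.
  rewrite (eq_bigr (fun r => P [set w | B r (angles Theta Phi k w r 0)])); last first.
    by move=> r _; rewrite A'n.
  rewrite (eq_big_seq (fun a => P (A a))); last by move=> a ak; rewrite A'p.
  rewrite -(hind (uniq_past k) (fun a _ => sA a)) muleC => <-.
  congr (P _); apply/seteqP; split => w.
    move=> [Aw Gw] a /=; rewrite mem_cat => /orP[ak|/mapP[r _ ->]].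
      by rewrite A'p//; exact: Aw.
    by rewrite A'n; exact: Gw.
  move=> Aw; split.
    by move=> a /= ak; rewrite -A'p//; apply: Aw; rewrite /= mem_cat ak.
  move=> r; have : A' (angle_index k r) w by apply: Aw => /=; exact: (past_index r (ltnSn k)).
  by rewrite A'n.
- move=> _.
  exact: (le_lt_trans (probability_le1 P (measurableI _ _ measurableT mG)) (ltry 1)).
Qed.

Lemma angle_distribution k (r : 'I_m.+1) (B : set (measurableTypeR R)) :
  measurable B -> P [set w | B (angles Theta Phi k w r 0)] = angle_meas m r B.
Proof.
move=> mB; rewrite /angle_meas.
have [i ->|->] := unliftP ord_max r.
  rewrite lift_max ltn_ord -[RHS]phi_lawE -(hPhi k i)//; congr (P _).
  by apply/seteqP; split => w /=; rewrite mxE liftK.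
rewrite ltnn -[RHS]theta_lawE -(hTheta k)//; congr (P _).
by apply/seteqP; split => w /=; rewrite mxE unlift_none.
Qed.

Lemma past_angles_law k (F : set T) (C : set (borel_cV R m.+1)) :
  (<<s past_events k >>) F -> measurable C ->
  P (F `&` angles Theta Phi k @^-1` C) = (P F * angle_law m C)%E.
Proof.
move=> sF mC.
pose X (i : nat) (w : T) : R :=
  if insub i : option 'I_m.+1 is Some r then angles Theta Phi k w r 0 else 0.
have vX : vec m.+1 X = angles Theta Phi k.
  by apply/funext => w; apply/colP => r; rewrite mxE /X valK.
rewrite -vX; apply: independent_vec => //.
- move=> i; rewrite /X; case: insub => [r|] //; exact: measurable_angle.
- by move=> i; rewrite /angle_meas; case: ifP => _; exact: probability_setT.
- exact: past_measurable sF.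
- move=> B mB.
  transitivity (P F * \prod_(r < m.+1) P [set w | B r (angles Theta Phi k w r 0%R)])%E.
    rewrite -(@past_angles_independent k F (fun r => B r) sF (fun r => mB r)).
    congr (P (_ `&` _)).
    apply/seteqP; split => w /= h.
      by move=> r; have := h r (ltn_ord r); rewrite /X valK.
    by move=> i im; have := h (Ordinal im); rewrite /X insubT.
  by congr (_ * _)%E; apply: eq_bigr => r _; rewrite angle_distribution.
Qed.

Lemma measurable_pastType k : measurable_fun setT (id : T -> pastType k).
Proof. by move=> _ F sF; rewrite setTI; exact: (past_measurable sF). Qed.

(** The joint law of the past and the next angles is a product, so the past may be frozen while
    these angles are integrated out. Every use of the Markov property goes through this identity. *)
Lemma integral_past_angles k (F : pastType k * borel_cV R m.+1 -> \bar R) :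
  measurable_fun setT F -> (forall p, 0 <= F p)%E ->
  (\int[P]_w F (w, angles Theta Phi k w) = \int[P]_w \int[angle_law m]_v F (w, v))%E.
Proof.
move=> mF F0.
have mZ : measurable_fun setT
    (fun w => (w, angles Theta Phi k w) : pastType k * borel_cV R m.+1).
  apply: measurable_fun_pair; first exact: (@measurable_pastType k).
  by apply: measurable_cVP => r; exact: measurable_angle.
pose P' : probability (pastType k) R :=
  @image_measure _ _ T (pastType k) R P id (@measurable_pastType k).
transitivity (\int[image_measure P mZ]_p F p)%E.
  by rewrite ge0_integral_image.
transitivity (\int[(P' \x angle_law m)%E]_p F p)%E.
  apply: eq_measure_integral => A mA _; apply/esym.
  apply: product_measure_unique => // C D mC mD.
  exact: past_angles_law.
rewrite fubini_tonelli1// ge0_integral_image//.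
  exact: measurable_fun_fubini_tonelli_F.
by move=> w; exact: integral_ge0.
Qed.

End markov_property.

(** * Symmetries of the initial point and of the angles *)

Section uniform_direction.
Context {R : realType} (n : nat).

Definition cone (A : set 'cV[R]_n) : set 'cV[R]_n :=
  [set v | exists (r : R) y, [/\ (0 < r <= 1)%R, usphere y, A y & v = r *: y]].

(** The existential is replaced by the radial projection, which is measurable. *)
Lemma coneE (A : set 'cV[R]_n) : cone A =
  [set v | sqnorm v != 0] `&` uball (n := n) `&`
  [set v | A ((Num.sqrt (sqnorm v))^-1 *: v)].
Proof.
apply/seteqP; split => v /=.
  move=> [r [y [/andP[r0 r1] sy Ay ->]]].
  have vE : sqnorm (r *: y) = r ^+ 2 by rewrite sqnormZ (sy : sqnorm y = 1) mulr1.
  have r1' : r ^+ 2 <= 1 by rewrite expr_le1// ltW.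
  have rr : r^-1 * r = 1 by rewrite mulVf// gt_eqF.
  rewrite /uball/= vE sqrtr_sqr gtr0_norm// scalerA rr scale1r.
  by split=> //; split=> //; rewrite expf_eq0/= gt_eqF.
move=> [[v0 v1] Av]; have s0 : 0 < sqnorm v by rewrite lt_def v0 sqnorm_ge0.
exists (Num.sqrt (sqnorm v)), ((Num.sqrt (sqnorm v))^-1 *: v); split => //.
- rewrite sqrtr_gt0 s0/= -[leRHS]sqrtr1 ler_sqrt//.
- by rewrite /usphere/= sqnormZ exprVn sqr_sqrtr ?(ltW s0)// mulVf.
- by rewrite scalerA divff ?scale1r// gt_eqF// sqrtr_gt0.
Qed.

Lemma measurable_cone (A : set (borel_cV R n)) : measurable A ->
  measurable (cone A : set (borel_cV R n)).
Proof.
move=> mA; rewrite coneE; apply: measurableI; first apply: measurableI.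
- rewrite (_ : mkset _ = ~` [set v | sqnorm v = 0]).
    by apply: measurableC; exact: measurable_sqnorm_level.
  by apply/seteqP; split => v /= /eqP.
- exact: measurable_uball.
rewrite -[X in measurable X]setTI.
suff mf : measurable_fun setT (fun v : borel_cV R n =>
    (Num.sqrt (sqnorm v))^-1 *: v : borel_cV R n) by exact: mf.
apply: measurable_cVZ => //; apply: measurable_funV.
by apply: (measurableT_comp measurable_sqrtr); exact: measurable_sqnorm_id.
Qed.

Lemma usphere_uniform_opp (A : set (borel_cV R n)) : measurable A ->
  usphere_uniform ((fun v => - v) @^-1` A) = usphere_uniform A.
Proof.
have mopp : measurable_fun setT (fun v : borel_cV R n => - v : borel_cV R n).
  exact: (measurable_cVN (f := id)).
move=> mA; have mA' : measurable ((fun v : borel_cV R n => - v) @^-1` A).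
  by rewrite -[X in measurable X]setTI; exact: mopp.
rewrite /usphere_uniform; congr (_ * _)%E.
rewrite -!/(cone _) !volumeE; [|exact: measurable_cone..].
have -> : cone ((fun v : borel_cV R n => - v) @^-1` A) = (fun v => - v) @^-1` cone A.
  apply/seteqP; split => v /= [r [y [r01 sy Ay E]]].
    exists r, (- y); split => //; last by rewrite scalerN E.
    by move: sy; rewrite /usphere/= -scaleN1r sqnormZ sqrrN expr1n mul1r.
  exists r, (- y); split => //.
  - by move: sy; rewrite /usphere/= -scaleN1r sqnormZ sqrrN expr1n mul1r.
  - by rewrite /= opprK.
  - by rewrite scalerN -E opprK.
transitivity (\int[vol n]_v (\1_(cone A) (- v))%:E)%E.
  transitivity (\int[vol n]_v (\1_((fun v : borel_cV R n => - v) @^-1` cone A) v)%:E)%E.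
    rewrite integral_indic ?setIT//.
    rewrite -[X in measurable X]setTI.
    by apply: (mopp measurableT _ (measurable_cone mA)).
  by apply: eq_integral => v _.
rewrite (integral_vol_opp (g := fun v => (\1_(cone A) v)%:E)).
- by rewrite integral_indic ?setIT//; exact: measurable_cone.
- by apply/measurable_EFinP/measurable_indic; exact: measurable_cone.
- by move=> v; rewrite lee_fin indicE.
Qed.

(** The uniform law is symmetric under negation, hence centered. The mean is taken of the
    nonnegative function [1 + b . Sigma], which is the base case of [chain_barycenter]. *)
Lemma uniform_direction_mean d (T : measurableType d) (P : probability T R)
    (Sigma : T -> borel_cV R n) (b : 'cV[R]_n) :
  measurable_fun setT Sigma -> (forall w, usphere (Sigma w)) ->
  has_law P Sigma (@usphere_uniform R n) -> sqnorm b <= 1 ->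
  (\int[P]_w (1 + dotv b (Sigma w))%:E = 1)%E.
Proof.
move=> mS sS hS b1.
(* The absolute value changes nothing on the sphere and makes [g] nonnegative on the whole space, as
   the image formula requires. *)
pose g (y : borel_cV R n) : \bar R := `|1 + dotv b y|%:E.
have mg : measurable_fun setT g.
  apply/measurable_EFinP; apply: (measurableT_comp (@normr_measurable R setT)).
  by apply: measurable_funD => //; exact: measurable_dotv.
have g0 y : (0 <= g y)%E by rewrite lee_fin.
have bS w : `|dotv b (Sigma w)| <= 1 by rewrite dotv_le1// (sS w).
have gS w : g (Sigma w) = (1 + dotv b (Sigma w))%:E.
  rewrite /g ger0_norm//; have := bS w; rewrite ler_norml => /andP[? ?]; lra.
have gNS w : g (- Sigma w) = (1 - dotv b (Sigma w))%:E.
  rewrite /g dotvNr ger0_norm//; have := bS w; rewrite ler_norml => /andP[? ?]; lra.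
have mopp : measurable_fun setT (fun v : borel_cV R n => - v : borel_cV R n).
  exact: (measurable_cVN (f := id)).
have mgS : measurable_fun setT (fun w => g (Sigma w)) by exact: (measurableT_comp mg).
have mgNS : measurable_fun setT (fun w => g (- Sigma w)).
  by apply: (measurableT_comp mg); exact: (measurableT_comp mopp).
have E1 : (\int[P]_w g (- Sigma w)%R = \int[P]_w g (Sigma w))%E.
  rewrite -(ge0_integral_image P mS mg g0).
  have mNS : measurable_fun setT (fun w => - Sigma w : borel_cV R n).
    exact: (measurableT_comp mopp mS).
  rewrite -(ge0_integral_image P mNS mg g0).
  apply: eq_measure_integral => A mA _; transitivity (usphere_uniform A).
    rewrite -(usphere_uniform_opp mA); apply: hS.
    by rewrite -[X in measurable X]setTI; exact: mopp.
  exact/esym/(hS A mA).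
have E2 : (\int[P]_w g (Sigma w) + \int[P]_w g (- Sigma w)%R = (2%R : R)%:E)%E.
  rewrite -ge0_integralD//.
  rewrite (eq_integral (cst (2 : R)%:E)) => [|w _].
    by rewrite integral_cst//= probability_setT mule1.
  by rewrite gS gNS -EFinD; congr (_%:E); ring.
under eq_integral do rewrite -gS.
move: E2; rewrite E1; set I := (\int[P]_x _)%E.
have : (0 <= I)%E by exact: integral_ge0.
case: I => [r| |]//= _ [rr]; congr (_%:E); lra.
Qed.

End uniform_direction.

Section angle_flips.
Context {R : realType} (m : nat).

(** A symmetry of the angle law that keeps the axial step and the last coordinate of the landing
    point and reverses its other coordinates. *)
Definition flip_phi : 'cV[R]_m.+1 -> 'cV[R]_m.+1 :=
  vmap (fun i x => if (i < m)%N then - x else x).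

(** A symmetry of the angle law that reverses the axial step. *)
Definition flip_theta : 'cV[R]_m.+1 -> 'cV[R]_m.+1 :=
  vmap (fun i x => if (i < m)%N then x else - x).

Lemma integral_flip_phi (g : borel_cV R m.+1 -> \bar R) : measurable_fun setT g ->
  (forall v, 0 <= g v)%E ->
  (\int[angle_law m]_v g (flip_phi v) = \int[angle_law m]_v g v)%E.
Proof.
move=> mg g0; apply: integral_prodm_map => //.
- by move=> i _; case: (i < m)%N => //; exact: measurable_funN.
- move=> i h _ mh h0; rewrite /angle_meas; case: (i < m)%N => //.
  exact: integral_phi_opp.
Qed.

Lemma integral_flip_theta (g : borel_cV R m.+1 -> \bar R) : measurable_fun setT g ->
  (forall v, 0 <= g v)%E ->
  (\int[angle_law m]_v g (flip_theta v) = \int[angle_law m]_v g v)%E.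
Proof.
move=> mg g0; apply: integral_prodm_map => //.
- by move=> i _; case: (i < m)%N => //; exact: measurable_funN.
- move=> i h _ mh h0; rewrite /angle_meas; case: (i < m)%N => //.
  exact: integral_theta_opp.
Qed.

Lemma vstep_flip_phi v : vstep (flip_phi v) = vstep v.
Proof.
suff E : axial_dir (vtheta (flip_phi v)) (vphi (flip_phi v)) =
    axial_dir (vtheta v) (vphi v).
  by rewrite /axial_step /chord_length E /vtheta /flip_phi mxE ltnn.
rewrite /axial_dir /vtheta /flip_phi mxE ltnn; congr (_ * _).
by apply: eq_bigr => i _; rewrite /vphi mxE lift_max ltn_ord cosN.
Qed.

Lemma vstep_flip_theta v : vstep (flip_theta v) = - vstep v.
Proof.
have tE : vtheta (flip_theta v) = - vtheta v by rewrite /vtheta mxE ltnn.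
have pE : vphi (flip_theta v) = vphi v.
  by apply/funext => i; rewrite /vphi mxE lift_max ltn_ord.
rewrite /axial_step /chord_length /axial_dir tE pE cosN sinN mulNr sqrrN.
by rewrite mulrN.
Qed.

Lemma vlanding_flip_phi v : vlanding v + vlanding (flip_phi v) =
  - (2 * vlanding v ord_max 0) *: south_pole m.
Proof.
have tE : vtheta (flip_phi v) = vtheta v by rewrite /vtheta mxE ltnn.
have pE i : vphi (flip_phi v) i = - vphi v i by rewrite /vphi mxE lift_max ltn_ord.
have aE : axial_dir (vtheta (flip_phi v)) (vphi (flip_phi v)) =
    axial_dir (vtheta v) (vphi v).
  by rewrite /axial_dir tE; congr (_ * _); apply: eq_bigr => i _; rewrite pE cosN.
have cE : chord_length (vtheta (flip_phi v)) (vphi (flip_phi v)) =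
    chord_length (vtheta v) (vphi v) by rewrite /chord_length aE tE.
apply/colP => j; rewrite [LHS]mxE [RHS]mxE /transverse_landing cE.
have [i ->|->] := unliftP ord_max j; last first.
  rewrite !(mxE, unlift_none, eqxx) /= tE; ring.
have le : (lift ord_max i == ord_max :> 'I_m.+1) = false.
  by apply/negbTE; rewrite eq_sym neq_lift.
rewrite !(mxE, liftK, le) /= tE pE sinN.
rewrite [in X in _ + X = _](eq_bigr (fun l => cos (vphi v l))) => [|l _]; last first.
  by rewrite pE cosN.
by rewrite oppr0 [RHS]mulr0 !add0r; ring.
Qed.

End angle_flips.

Lemma ge0_double_inj {R : realType} (x y : \bar R) : (0 <= x)%E -> (0 <= y)%E ->
  (x + x = y + y)%E -> x = y.
Proof.
by case: x => [a| |]; case: y => [b| |]//= _ _ [ab]; congr (_%:E); lra.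
Qed.

(** * The ray up to its exit *)

Section ray.
Context {R : realType} {m : nat} {disp : measure_display} {T : measurableType disp}.
Variable P : probability T R.
Variable U : 'cV[R]_m.+1 -> 'M[R]_m.+1.
Variable Sigma : {RV P >-> borel_cV R m.+1}.
Variables (Theta : nat -> {RV P >-> R}) (Phi : nat -> 'I_m -> {RV P >-> R}).
Hypothesis hU : frame_choice U.
Hypothesis hSigma : forall w, usphere (Sigma w).
Hypothesis hSigma_law : has_law P Sigma (@usphere_uniform R m.+1).
Hypothesis hTheta : forall k, has_law P (Theta k) theta_law.
Hypothesis hPhi : forall k i, has_law P (Phi k i) phi_law.
Hypothesis hind : mutually_independent P (angle_sigma_algebras Sigma Theta Phi).

Local Notation X k w := (reflection U Sigma Theta Phi k w).1.
Local Notation Y k w := (reflection U Sigma Theta Phi k w).2.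
Local Notation angles := (angles Theta Phi).
Local Notation past := (pastType Sigma Theta Phi).

(** The starting level, of index 0, is left out, as it is in [first_passage]. *)
Definition stays_below (s : R) (n : nat) (w : T) : R :=
  \prod_(i < n) (X i.+1 w <= s)%R%:R.

Lemma stays_below_ge0 s n w : 0 <= stays_below s n w.
Proof. exact: prodr_ge0. Qed.

Lemma stays_belowS s n w :
  stays_below s n.+1 w = stays_below s n w * (X n.+1 w <= s)%R%:R.
Proof. by rewrite /stays_below big_ord_recr. Qed.

Lemma measurable_chain n : measurable_fun setT (fun w : T => X n w) /\
  measurable_fun setT (fun w : T => Y n w : borel_cV R m.+1).
Proof. by apply: measurable_reflection => // *; exact: measurable_funPT. Qed.

Lemma past_measurable_chain k n : (k <= n)%N ->
  measurable_fun setT (fun w : past n => X k w) /\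
  measurable_fun setT (fun w : past n => Y k w : borel_cV R m.+1).
Proof.
move=> kn; apply: measurable_reflection => //.
- exact: past_measurable_Sigma.
- by move=> j jk; apply: (@past_measurable_Theta _ _ _ _ P); exact: leq_trans kn.
- by move=> j i jk; apply: (@past_measurable_Phi _ _ _ _ P); exact: leq_trans kn.
Qed.

Lemma past_measurable_stays_below s n :
  measurable_fun setT (fun w : past n => stays_below s n w).
Proof.
apply: measurable_prod => i _; apply: measurable_natr_bool.
by apply: measurable_fun_ler => //; have [] := past_measurable_chain (ltn_ord i).
Qed.

Lemma measurable_stays_below s n : measurable_fun setT (stays_below s n).
Proof.
apply: measurable_prod => i _; apply: measurable_natr_bool.
by apply: measurable_fun_ler => //; have [] := measurable_chain i.+1.
Qed.

(** Averaging over [flip_phi] leaves only the component of the landing point along the pole. Its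
    coefficient is moved onto [b], whose norm stays at most 1, so that an induction along the chain
    can continue with the new [b]. *)
Lemma step_mean_flip (M : 'M[R]_m.+1) b (g : R -> R) : orthogonal_mx M ->
  sqnorm b <= 1 -> measurable_fun setT g -> (forall x, 0 <= g x) ->
  (\int[angle_law m]_v ((1 + dotv b (M *m vlanding v)) * g (vstep v))%R%:E =
   \int[angle_law m]_v
     ((1 + dotv (- vlanding v ord_max 0 *: b) (M *m south_pole m)) * g (vstep v))%R%:E)%E.
Proof.
move=> oM b1 mg g0.
have mvl : measurable_fun setT (fun v : borel_cV R m.+1 => vlanding v : borel_cV R m.+1).
  exact: measurable_vlanding.
have mgv : measurable_fun setT (fun v : borel_cV R m.+1 => g (vstep v)).
  by apply: (measurableT_comp mg); exact: measurable_vstep.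
pose F (v : borel_cV R m.+1) := ((1 + dotv b (M *m vlanding v)) * g (vstep v))%:E.
pose K (v : borel_cV R m.+1) := ((1 + dotv (- vlanding v ord_max 0 *: b)
  (M *m south_pole m)) * g (vstep v))%:E.
have vl1 v : sqnorm (vlanding v) <= 1 by rewrite sqnorm_transverse_landing.
have dot1 a c : sqnorm a <= 1 -> sqnorm c <= 1 -> 0 <= 1 + dotv a (M *m c).
  move=> a1 c1; have := @dotv_le1 _ _ a (M *m c) a1.
  by rewrite sqnorm_orthogonal// => /(_ c1); rewrite ler_norml => /andP[? ?]; lra.
have mF : measurable_fun setT F.
  apply/measurable_EFinP; apply: measurable_funM => //; apply: measurable_funD => //.
  by apply: measurable_dotv => //; exact: measurable_mulmx.
have mK : measurable_fun setT K.
  apply/measurable_EFinP; apply: measurable_funM => //; apply: measurable_funD => //.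
  apply: measurable_dotv => //; apply: measurable_cVZ => //.
  by apply: measurableT_comp => //; exact: (measurableT_comp (measurable_coord ord_max 0) mvl).
have F0 v : (0 <= F v)%E by rewrite lee_fin mulr_ge0// dot1.
have K0 v : (0 <= K v)%E.
  rewrite lee_fin mulr_ge0// dot1 ?sqnorm_south_pole// sqnormZ sqrrN.
  by rewrite mulr_ile1 ?sqr_ge0 ?sqnorm_ge0// (le_trans (sqr_coord_le _ _)).
have mflip : measurable_fun setT (@flip_phi R m : borel_cV R m.+1 -> borel_cV R m.+1).
  by apply: measurable_vmap => i _; case: (i < m)%N => //; exact: measurable_funN.
change (\int[angle_law m]_v F v = \int[angle_law m]_v K v)%E.
(* Twice the left integral is the integral of [F v + F (flip_phi v)], which is [K v + K v]
   pointwise. *)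
apply: ge0_double_inj; [by apply: integral_ge0|by apply: integral_ge0|].
rewrite -{2}(integral_flip_phi mF F0).
rewrite -ge0_integralD//; last exact: (measurableT_comp mF).
rewrite -ge0_integralD//; apply: eq_integral => v _.
rewrite /F /K vstep_flip_phi -!EFinD -!mulrDl; congr (_ * _)%:E.
rewrite addrACA -dotvDr -mulmxDr vlanding_flip_phi -scalemxAr dotvZr.
rewrite [dotv (_ *: b) _]dotvC dotvZr (dotvC b); ring.
Qed.

(* That is, E[Y_n; survival, h(S_n)] = 0; the nonnegative weight 1 + b . Y_n
   avoids integrability conditions on h. *)
Lemma chain_barycenter s n b (h : R -> R) : sqnorm b <= 1 ->
  measurable_fun setT h -> (forall x, 0 <= h x) ->
  (\int[P]_w ((1 + dotv b (Y n w)) * (stays_below s n w * h (X n w)))%R%:E =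
   \int[P]_w (stays_below s n w * h (X n w))%R%:E)%E.
Proof.
elim: n b h => [|n IH] b h b1 mh h0.
  under eq_integral do rewrite /stays_below big_ord0/= mul1r EFinM muleC.
  under [RHS]eq_integral do rewrite /stays_below big_ord0/= mul1r.
  rewrite ge0_integralZl//; first 1 last.
  - apply/measurable_EFinP; apply: measurable_funD => //.
    by apply: measurable_dotv => //; exact: measurable_funPT.
  - move=> w _; rewrite lee_fin; have := @dotv_le1 _ _ b (Sigma w) b1.
    by rewrite (hSigma w : sqnorm _ = _) => /(_ (lexx _)); rewrite ler_norml => /andP[? ?]; lra.
  - by rewrite lee_fin.
  by rewrite uniform_direction_mean// integral_cst//= probability_setT.
(* The survival condition at the new step is absorbed into the test function. *)
pose h' (x : R) := (x <= s)%R%:R * h x.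
have mh' : measurable_fun setT h'.
  by apply: measurable_funM => //; apply: measurable_natr_bool; exact: measurable_fun_ler.
have h'0 x : 0 <= h' x by rewrite mulr_ge0.
have [mX mY] := past_measurable_chain (leqnn n).
have mfst : measurable_fun setT (fun p : past n * borel_cV R m.+1 => p.1).
  exact: measurable_fst.
have mstep : measurable_fun setT
    (fun p : past n * borel_cV R m.+1 => X n p.1 + vstep p.2).
  by apply: measurable_funD; [exact: (measurableT_comp mX mfst)|apply: measurable_vstep; exact: measurable_snd].
have mW : measurable_fun setT (fun p : past n * borel_cV R m.+1 =>
    stays_below s n p.1 * h' (X n p.1 + vstep p.2)).
  apply: measurable_funM; last exact: (measurableT_comp mh' mstep).
  exact: (measurableT_comp (@past_measurable_stays_below s n) mfst).
have W0 w x : 0 <= stays_below s n w * h' x by rewrite mulr_ge0 ?stays_below_ge0.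
have dot1 a c : sqnorm a <= 1 -> sqnorm c <= 1 -> 0 <= 1 + dotv a c.
  by move=> a1 c1; have := dotv_le1 a1 c1; rewrite ler_norml => /andP[? ?]; lra.
have vl1 v : sqnorm (vlanding v) <= 1 by rewrite sqnorm_transverse_landing.
have Y1 k w : sqnorm (Y k w) <= 1 by have := @usphere_reflection _ _ _ U Sigma Theta Phi hU hSigma k w; rewrite /usphere/= => ->.
have MY1 w v : sqnorm (U (Y n w) *m vlanding v) <= 1.
  by rewrite sqnorm_orthogonal//; exact: frame_orthogonal.
have mvl : measurable_fun setT
    (fun p : past n * borel_cV R m.+1 => vlanding p.2 : borel_cV R m.+1).
  by apply: measurable_vlanding; exact: measurable_snd.
pose F (p : past n * borel_cV R m.+1) := ((1 + dotv b (U (Y n p.1) *m vlanding p.2)) *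
  (stays_below s n p.1 * h' (X n p.1 + vstep p.2)))%:E.
pose K (w : past n) (v : borel_cV R m.+1) :=
  ((1 + dotv (- vlanding v ord_max 0 *: b) (Y n w)) *
  (stays_below s n w * h' (X n w + vstep v)))%:E.
have lb1 v : sqnorm (- vlanding v ord_max 0 *: b) <= 1.
  rewrite sqnormZ sqrrN.
  by rewrite mulr_ile1 ?sqr_ge0 ?sqnorm_ge0// (le_trans (sqr_coord_le _ _)).
have mF : measurable_fun setT F.
  apply/measurable_EFinP; apply: measurable_funM => //; apply: measurable_funD => //.
  apply: measurable_dotv => //; apply: measurable_mulmx => // i j.
  apply: (@measurable_comp _ _ _ _ (past n) R setT (fun w => U (Y n w) i j) setT fst) => //.
  by apply: measurable_frame => // w; exact: usphere_reflection.
have mK : measurable_fun setT (fun p : past n * borel_cV R m.+1 => K p.1 p.2).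
  apply/measurable_EFinP; apply: measurable_funM => //; apply: measurable_funD => //.
  apply: measurable_dotv; last exact: (measurableT_comp mY mfst).
  apply: measurable_cVZ => //; apply: measurableT_comp => //.
  exact: (measurableT_comp (measurable_coord ord_max 0) mvl).
transitivity (\int[P]_w F (w, angles n w))%E.
  by apply: eq_integral => w _; rewrite reflectionS stays_belowS reflectionS/= -mulrA.
rewrite (integral_past_angles hTheta hPhi hind mF); last first.
  by move=> p; rewrite lee_fin mulr_ge0// dot1.
transitivity (\int[P]_w \int[angle_law m]_v K w v)%E.
  apply: eq_integral => w _; rewrite /F /K /=.
  have := @step_mean_flip (U (Y n w)) b (fun x => stays_below s n w * h' (X n w + x)).
  rewrite frame_south_pole//; apply => //; first exact: frame_orthogonal.
  apply: measurable_funM => //; apply: (measurableT_comp mh').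
  exact: measurable_funD.
pose P' : probability (past n) R :=
  @image_measure _ _ T (past n) R P id (@measurable_pastType _ _ _ _ _ Sigma Theta Phi n).
have toP' (g : past n -> \bar R) : measurable_fun setT g -> (forall w, 0 <= g w)%E ->
    (\int[P']_w g w = \int[P]_w g w)%E.
  by move=> mg g0; rewrite ge0_integral_image.
have K0 w v : (0 <= K w v)%E by rewrite lee_fin mulr_ge0// dot1.
pose L (w : past n) (v : borel_cV R m.+1) :=
  (stays_below s n w * h' (X n w + vstep v))%:E.
have mL : measurable_fun setT (fun p : past n * borel_cV R m.+1 => L p.1 p.2).
  exact/measurable_EFinP.
have L0 w v : (0 <= L w v)%E by rewrite lee_fin.
rewrite -toP'; last 2 first.
- exact: (@measurable_integral_vcons _ _ _ _ (angle_law m) _ mK (fun p => K0 p.1 p.2)).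
- by move=> w; exact: integral_ge0.
(* With [v] integrated last, the induction hypothesis applies for each fixed [v], to the vector
   [- vlanding v ord_max 0 *: b] and the function [h' (x + vstep v)]. *)
rewrite integral_swap//.
transitivity (\int[angle_law m]_v \int[P']_w L w v)%E.
  apply: eq_integral => v _; rewrite !toP'//; last 2 first.
  - exact: (measurableT_comp mK (pair2_measurable v)).
  - exact: (measurableT_comp mL (pair2_measurable v)).
  apply: (IH _ (fun x => h' (x + vstep v))) => //.
  by apply: (measurableT_comp mh'); exact: measurable_funD.
rewrite -integral_swap// toP'; last 2 first.
- exact: (@measurable_integral_vcons _ _ _ _ (angle_law m) _ mL (fun p => L0 p.1 p.2)).
- by move=> w; exact: integral_ge0.
rewrite -(@integral_past_angles _ _ _ _ _ Sigma _ _ hTheta hPhi hind n (fun p => L p.1 p.2))//.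
by apply: eq_integral => w _; rewrite stays_belowS reflectionS/= -mulrA.
Qed.

Lemma measurable_chain_le s n : measurable [set w | X n w <= s].
Proof.
have [mX _] := measurable_chain n; rewrite -[Z in measurable Z]setTI.
exact: (measurable_fun_ler mX (measurable_cst s) measurableT (Y := [set true])).
Qed.

Lemma measurable_chain_gt s n : measurable [set w | s < X n w].
Proof.
rewrite (_ : [set w | _] = ~` [set w | X n w <= s]).
  by apply: measurableC; exact: measurable_chain_le.
by apply/seteqP; split => w /=; rewrite ltNge => /negP.
Qed.
Local Notation exit_after s n w :=
  (overshoot_exit (U (Y n w)) (s - X n w) (angles n w)).

Lemma stays_belowE s n w : stays_below s n w = [forall i : 'I_n, X i.+1 w <= s]%:R.
Proof.
have [/forallP low|/forallPn[i si]] := boolP [forall i : 'I_n, X i.+1 w <= s].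
  by apply: big1 => i _; rewrite low.
by rewrite /stays_below (bigD1 i)//= (negbTE si) mul0r.
Qed.

Lemma first_passageP s n w : reflect (first_passage U Sigma Theta Phi s w = n.+1)
  ([forall i : 'I_n, X i.+1 w <= s] && (s < X n.+1 w)).
Proof.
apply: (iffP andP).
  move=> [/forallP low high]; rewrite /first_passage; case: pselect => [h|[]]; last first.
    by exists n.+1; rewrite high.
  case: ex_minnP => -[//|k] /andP[_ hk] /(_ n.+1); rewrite high => /(_ isT).
  rewrite ltnS leq_eqVlt => /orP[/eqP -> //|kn].
  by have := low (Ordinal kn); rewrite leNgt hk.
rewrite /first_passage; case: pselect => // h.
case: ex_minnP => k /andP[_ hk] kmin kn; rewrite -kn hk; split => //.
apply/forallP => i; rewrite leNgt; apply/negP => si.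
by have := kmin i.+1 si; rewrite kn ltnS leqNgt ltn_ord.
Qed.

Definition early_at s b n : set T :=
  [set w | first_passage U Sigma Theta Phi s w = n.+1 /\ X n w <= s - b].

Lemma early_bigcup s b :
  early_last_reflection U Sigma Theta Phi s b = \bigcup_n early_at s b n.
Proof.
apply/seteqP; split => w.
  rewrite /early_last_reflection/=; case E : first_passage => [|n] /= -[] // _ Xn.
  by exists n.
by move=> [n _ [E Xn]]; rewrite /early_last_reflection/= E.
Qed.

(** Isolates the one factor that involves the next step, which is then averaged given the past. *)
Lemma early_indic s b n w : (w \in early_at s b n)%:R =
  stays_below s n w * ((X n w <= s - b)%R%:R * (s < X n.+1 w)%R%:R) :> R.
Proof.
rewrite stays_belowE -!natrM !mulnb; congr (nat_of_bool _)%:R.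
apply/idP/idP.
  by rewrite inE => -[/first_passageP/andP[-> ->] ->].
by case/and3P => low Xn high; rewrite inE; split => //; apply/first_passageP/andP.
Qed.

Lemma trivIset_early s b : trivIset setT (early_at s b).
Proof. by move=> i j _ _ [w [[+ _] [+ _]]] => -> [->]. Qed.

Lemma measurable_first_passage s n :
  measurable [set w | first_passage U Sigma Theta Phi s w = n.+1].
Proof.
rewrite (_ : [set w | _] = \bigcap_(i in [set i | (i < n)%N]) [set w | X i.+1 w <= s] `&`
  [set w | s < X n.+1 w]).
  apply: measurableI.
    by apply: bigcap_measurableType => i _; exact: measurable_chain_le.
  exact: measurable_chain_gt.
apply/seteqP; split => w /=.
  move=> /first_passageP/andP[/forallP low high]; split => // i /= im.
  exact: (low (Ordinal im)).
move=> [low high]; apply/first_passageP/andP; split => //.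
by apply/forallP => i; apply: low => /=.
Qed.

Lemma measurable_early s b n : measurable (early_at s b n).
Proof.
apply: measurableI; [exact: measurable_first_passage|exact: measurable_chain_le].
Qed.

Lemma exit_pointE s n w : first_passage U Sigma Theta Phi s w = n.+1 ->
  exit_point U Sigma Theta Phi s w = exit_after s n w.
Proof.
move=> E; rewrite /exit_point E reflectionS -[n.+1.-1]/n.
have := @frame_south_pole _ _ _ U Sigma Theta Phi hU hSigma n w.
case: (reflection U Sigma Theta Phi n w) => [x y] /= yE.
by rewrite /overshoot_exit yE (addrC x) addrK.
Qed.

(** When the level is never passed, the code 0 makes both reflection points the initial one. This
    value serves the measurability of the exit point on the whole sample space. *)
Lemma exit_point0 s w : first_passage U Sigma Theta Phi s w = 0%N ->
  exit_point U Sigma Theta Phi s w = Sigma w.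
Proof. by move=> E; rewrite /exit_point E /= !subrr scaler0 addr0. Qed.

Lemma measurable_overshoot_exit d' (T' : measurableType d')
    (A : T' -> 'M[R]_m.+1) (u : T' -> R) (v : T' -> borel_cV R m.+1) :
  (forall i j, measurable_fun setT (fun t => A t i j)) ->
  measurable_fun setT u -> measurable_fun setT v ->
  measurable_fun setT (fun t => overshoot_exit (A t) (u t) (v t) : borel_cV R m.+1).
Proof.
move=> mA mu mv.
have mS : measurable_fun setT (fun t => A t *m south_pole m : borel_cV R m.+1).
  exact: measurable_mulmx.
apply: measurable_cVD => //; apply: measurable_cVZ.
  by apply: measurable_funM => //; apply: measurable_funV; exact: measurable_vstep.
apply: measurable_cVB => //; apply: measurable_mulmx => //; exact: measurable_vlanding.
Qed.

Lemma measurable_exit_after s n :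
  measurable_fun setT (fun w => exit_after s n w : borel_cV R m.+1).
Proof.
have [mX mY] := measurable_chain n.
apply: measurable_overshoot_exit.
- by move=> i j; apply: measurable_frame => // w; exact: usphere_reflection.
- exact: measurable_funB.
- by apply: measurable_angles => *; exact: measurable_funPT.
Qed.

Lemma measurable_exit_point s :
  measurable_fun setT (exit_point U Sigma Theta Phi s : T -> borel_cV R m.+1).
Proof.
pose D n := [set w | first_passage U Sigma Theta Phi s w = n].
have mD n : measurable (D n).
  case: n => [|n]; last exact: measurable_first_passage.
  rewrite (_ : D 0%N = ~` \bigcup_n D n.+1).
    by apply: measurableC; apply: bigcup_measurable => n _; exact: measurable_first_passage.
  apply/seteqP; split => w; rewrite /D/=; first by move=> E [n _] /=; rewrite E.
  by case E : first_passage => [//|n] []; exists n.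
have -> : setT = \bigcup_n D n by apply/seteqP; split => // w _; exists (first_passage U Sigma Theta Phi s w).
apply/measurable_fun_bigcup => // -[|n].
  apply: (eq_measurable_fun (Sigma : T -> borel_cV R m.+1)).
    by move=> w; rewrite inE => Dw; rewrite exit_point0.
  by apply: measurable_funTS; exact: measurable_funPT.
apply: (eq_measurable_fun (fun w => exit_after s n w : borel_cV R m.+1)).
  by move=> w; rewrite inE => Dw; rewrite (exit_pointE Dw).
by apply: measurable_funTS; exact: measurable_exit_after.
Qed.

(* Up to a constant factor, the asymptotic probability that a step jumps
   over the gap [s - x], when [s - x >= b]. *)
Definition exit_weight (s b x : R) : R := (x <= s - b)%R%:R * (s - x) ^- m.+2.

Definition open_ball_integral (f : borel_cV R m.+1 -> R) : \bar R :=
  (\int[vol m.+1]_p ((sqnorm p < 1)%R%:R * f p)%R%:E)%E.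

Definition weight_mean (s b : R) n : \bar R :=
  (\int[P]_w (stays_below s n w * exit_weight s b (X n w))%R%:E)%E.

Lemma exit_weight_ge0 (s b : R) x : 0 <= b -> 0 <= exit_weight s b x.
Proof.
move=> b0; rewrite /exit_weight; have [xs|_] := boolP (x <= s - b); last by rewrite mul0r.
by rewrite mul1r invr_ge0 exprn_ge0//; lra.
Qed.

Lemma measurable_exit_weight (s b : R) : measurable_fun setT (exit_weight s b).
Proof.
apply: measurable_funM.
  by apply: measurable_natr_bool; exact: measurable_fun_ler.
by apply: measurable_funV; apply: measurable_funX; exact: measurable_funB.
Qed.

Lemma weight_mean_ge0 (s b : R) n : 0 <= b -> (0 <= weight_mean s b n)%E.
Proof.
move=> b0; apply: integral_ge0 => w _.
by rewrite lee_fin mulr_ge0 ?stays_below_ge0 ?exit_weight_ge0.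
Qed.

(** * Exit right after a given reflection *)

Section exit_integrals.
Variable f : borel_cV R m.+1 -> R.
Hypotheses (mf : measurable_fun setT f) (f0 : forall p, 0 <= f p).

Lemma chain_sqnorm_le1 n w : sqnorm (Y n w) <= 1.
Proof.
by have := usphere_reflection Theta Phi hU hSigma n w; rewrite /usphere/= => ->.
Qed.

Lemma exit_mean_integrand_ge0 n w p :
  0 <= (sqnorm p < 1)%R%:R * (1 - dotv (Y n w) p) * f p.
Proof.
rewrite mulr_ge0//; have [p1|p1] := ltP (sqnorm p) 1; last by rewrite mul0r.
rewrite mul1r subr_ge0 (le_trans (ler_norm _))// dotv_le1 ?(ltW p1)//.
exact: chain_sqnorm_le1.
Qed.

Lemma measurable_exit_mean_integrand n :
  measurable_fun setT (fun q : T * borel_cV R m.+1 =>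
    (sqnorm q.2 < 1)%R%:R * (1 - dotv (Y n q.1) q.2) * f q.2).
Proof.
have [_ mY] := measurable_chain n.
have m2 : measurable_fun setT (fun q : T * borel_cV R m.+1 => q.2) by exact: measurable_snd.
apply: measurable_funM; last exact: (measurableT_comp mf m2).
apply: measurable_funM.
  apply: measurable_natr_bool; apply: measurable_fun_ltr => //.
  exact: measurable_sqnorm.
apply: measurable_funB => //; apply: measurable_dotv => //.
exact: (measurableT_comp mY measurable_fst).
Qed.

Lemma measurable_exit_mean n :
  measurable_fun setT (fun w => exit_mean f (Y n w)).
Proof.
apply: (@measurable_integral_vcons _ _ T _ (vol m.+1) (fun q : T * borel_cV R m.+1 =>
    ((sqnorm q.2 < 1)%R%:R * (1 - dotv (Y n q.1) q.2) * f q.2)%:E)).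
  by apply/measurable_EFinP; exact: measurable_exit_mean_integrand.
by move=> q; rewrite lee_fin exit_mean_integrand_ge0.
Qed.

Lemma exit_mean_ge0 n w : (0 <= exit_mean f (Y n w))%E.
Proof.
by apply: integral_ge0 => p _; rewrite lee_fin exit_mean_integrand_ge0.
Qed.

(** After swapping the integrals, for fixed [p] in the ball the factor [1 - Y . p] averages out by
    [chain_barycenter] with [b = - p]. Here the dependence on the last reflection point
    disappears. *)
Lemma integral_exit_mean s n (h : R -> R) : measurable_fun setT h -> (forall x, 0 <= h x) ->
  (\int[P]_w ((stays_below s n w * h (X n w))%R%:E * exit_mean f (Y n w)) =
   (\int[P]_w (stays_below s n w * h (X n w))%R%:E) * open_ball_integral f)%E.
Proof.
move=> mh h0; have [mX mY] := measurable_chain n.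
have mW : measurable_fun setT (fun w => stays_below s n w * h (X n w)).
  apply: measurable_funM; first exact: measurable_stays_below.
  exact: (measurableT_comp mh mX).
have W0 w : 0 <= stays_below s n w * h (X n w) by rewrite mulr_ge0 ?stays_below_ge0.
have mE := measurable_exit_mean_integrand n.
pose G w (p : borel_cV R m.+1) := (stays_below s n w * h (X n w) *
  ((sqnorm p < 1)%R%:R * (1 - dotv (Y n w) p) * f p))%:E.
transitivity (\int[P]_w \int[vol m.+1]_p G w p)%E.
  apply: eq_integral => w _; rewrite -ge0_integralZl//; last 3 first.
  - apply/measurable_EFinP; exact: (measurableT_comp mE (pair1_measurable w)).
  - by move=> p _; rewrite lee_fin exit_mean_integrand_ge0.
  - by rewrite lee_fin.
rewrite integral_swap; first last.
- by move=> w p; rewrite lee_fin mulr_ge0// exit_mean_integrand_ge0.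
- apply/measurable_EFinP; apply: measurable_funM => //.
  exact: (measurableT_comp mW measurable_fst).
have mO : measurable_fun setT (fun p : borel_cV R m.+1 => (sqnorm p < 1)%R%:R * f p).
  apply: measurable_funM => //; apply: measurable_natr_bool.
  by apply: measurable_fun_ltr => //; exact: measurable_sqnorm_id.
rewrite muleC -ge0_integralZr//; last 3 first.
- exact/measurable_EFinP.
- by move=> p _; rewrite lee_fin mulr_ge0.
- by apply: integral_ge0 => w _; rewrite lee_fin.
apply: eq_integral => p _; rewrite /G.
have [p1|p1] := ltP (sqnorm p) 1; last first.
  by rewrite mul0r mul0e; apply: integral0_eq => w _; rewrite !mul0r mulr0.
have Np1 : sqnorm (- p) <= 1 by rewrite -scaleN1r sqnormZ sqrrN expr1n mul1r ltW.
rewrite -(chain_barycenter s n Np1 mh h0) mul1r -ge0_integralZl//; last 3 first.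
- apply/measurable_EFinP; apply: measurable_funM => //.
  by apply: measurable_funD => //; exact: measurable_dotv.
- move=> w _; rewrite lee_fin mulr_ge0//.
  by have := dotv_le1 Np1 (chain_sqnorm_le1 n w); rewrite ler_norml => /andP[? ?]; lra.
- by rewrite lee_fin.
apply: eq_integral => w _; rewrite -EFinM (dotvC (- p)) dotvNr; congr (_%:E).
by rewrite mul1r mulrC [RHS]mulrA (mulrC (f p)).
Qed.

Lemma past_frame n i j : measurable_fun setT (fun w : past n => U (Y n w) i j).
Proof.
have [_ mY] := past_measurable_chain (leqnn n).
by apply: measurable_frame => // w; exact: usphere_reflection.
Qed.

Definition exit_integrand (s b : R) n (q : past n * borel_cV R m.+1) : \bar R :=
  (stays_below s n q.1 * ((X n q.1 <= s - b)%R%:R *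
    ((s < X n q.1 + vstep q.2)%R%:R *
     f (overshoot_exit (U (Y n q.1)) (s - X n q.1) q.2))))%R%:E.

Lemma exit_integrand_ge0 (s b : R) n q : (0 <= @exit_integrand s b n q)%E.
Proof. by rewrite lee_fin !mulr_ge0// stays_below_ge0. Qed.

Lemma measurable_exit_integrand (s b : R) n : measurable_fun setT (@exit_integrand s b n).
Proof.
have [mX mY] := past_measurable_chain (leqnn n).
have mfst : measurable_fun setT (fun p : past n * borel_cV R m.+1 => p.1).
  exact: measurable_fst.
have msnd : measurable_fun setT (fun p : past n * borel_cV R m.+1 => p.2).
  exact: measurable_snd.
have mX1 : measurable_fun setT (fun p : past n * borel_cV R m.+1 => X n p.1).
  exact: (measurableT_comp mX mfst).
apply/measurable_EFinP; apply: measurable_funM.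
  exact: (measurableT_comp (@past_measurable_stays_below s n) mfst).
apply: measurable_funM.
  by apply: measurable_natr_bool; exact: measurable_fun_ler.
apply: measurable_funM.
  apply: measurable_natr_bool; apply: measurable_fun_ltr => //.
  by apply: measurable_funD => //; exact: measurable_vstep.
apply: (measurableT_comp mf); apply: measurable_overshoot_exit => //.
- move=> i j; apply: (@measurable_comp _ _ _ _ (past n) R setT
    (fun w => U (Y n w) i j) setT fst) => //; exact: past_frame.
- exact: measurable_funB.
Qed.

Lemma integral_early_at (s b : R) n :
  (\int[P]_(w in early_at s b n) (f (exit_point U Sigma Theta Phi s w))%:E =
   \int[P]_w \int[angle_law m]_v @exit_integrand s b n (w, v))%E.
Proof.
rewrite -(integral_past_angles hTheta hPhi hind (@measurable_exit_integrand s b n)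
  (@exit_integrand_ge0 s b n)).
rewrite integral_mkcond; apply: eq_integral => w _; rewrite /exit_integrand/=.
rewrite !mulrA -(mulrA (stays_below s n w)).
have -> : X n w + vstep (angles n w) = X n.+1 w by rewrite reflectionS.
rewrite -early_indic patchE; case: ifPn => [|_]; last by rewrite mul0r.
by rewrite inE => -[E _]; rewrite mul1r (exit_pointE E).
Qed.

Lemma measurable_integral_exit (s b : R) n :
  measurable_fun setT (fun w : T => \int[angle_law m]_v @exit_integrand s b n (w, v))%E.
Proof.
exact: (measurableT_comp (@measurable_integral_vcons _ _ _ _ (angle_law m) _
  (@measurable_exit_integrand s b n) (@exit_integrand_ge0 s b n))
  (@measurable_pastType _ _ _ _ _ Sigma Theta Phi n)).
Qed.

Lemma integral_exit_overshoot (s b : R) n w : X n w <= s - b ->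
  (\int[angle_law m]_v @exit_integrand s b n (w, v) =
   (stays_below s n w)%:E * \int[angle_law m]_v ((s - X n w < vstep v)%R%:R *
     f (overshoot_exit (U (Y n w)) (s - X n w) v))%R%:E)%E.
Proof.
move=> Xn; rewrite -ge0_integralZl//; last 3 first.
- apply/measurable_EFinP; apply: measurable_funM.
    by apply: measurable_natr_bool; apply: measurable_fun_ltr => //; exact: measurable_vstep.
  by apply: (measurableT_comp mf); exact: measurable_overshoot_exit.
- by move=> v _; rewrite lee_fin mulr_ge0.
- by rewrite lee_fin stays_below_ge0.
apply: eq_integral => v _; rewrite /exit_integrand/= Xn mul1r -EFinM.
by rewrite ltrBlDl.
Qed.

Let rescale (a u : R) (J : \bar R) : 0 < u ->
  (a%:E * J = (a / u)%:E * (u%:E * J))%E.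
Proof. by move=> u0; rewrite muleA -EFinM divfK// gt_eqF. Qed.

(** The one-step bound for the gap [u = s - X n w], whose factor [u ^- m.+2] is the one in
    [exit_weight]. *)
Lemma exit_step_le (s b : R) n w : 0 < b ->
  (\int[angle_law m]_v @exit_integrand s b n (w, v) <=
   (slope_cst m)%:E * ((stays_below s n w * exit_weight s b (X n w))%R%:E *
     exit_mean f (Y n w)))%E.
Proof.
move=> b0; have [Xn|XnF] := boolP (X n w <= s - b); last first.
  rewrite integral0_eq; last first.
    by move=> v _; rewrite /exit_integrand/= (negbTE XnF) mul0r mulr0.
  by rewrite /exit_weight (negbTE XnF) mul0r mulr0 mul0e mule0.
have u0 : 0 < s - X n w by lra.
rewrite integral_exit_overshoot// /exit_weight Xn mul1r.
have := overshoot_le (frame_orthogonal Theta Phi hU hSigma n w) mf f0 u0.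
rewrite frame_south_pole// => H.
rewrite muleCA (rescale _ _ (exprn_gt0 m.+2 u0)) lee_wpmul2l//.
by rewrite lee_fin divr_ge0 ?stays_below_ge0 ?exprn_ge0// ltW.
Qed.

Lemma exit_step_ge (s b : R) n w : 0 < b ->
  ((slope_cst m * (b ^+ 2 / (b ^+ 2 + 4)) ^+ m.+2)%R%:E *
     ((stays_below s n w * exit_weight s b (X n w))%R%:E * exit_mean f (Y n w)) <=
   \int[angle_law m]_v @exit_integrand s b n (w, v))%E.
Proof.
move=> b0; have [Xn|XnF] := boolP (X n w <= s - b); last first.
  rewrite integral0_eq; last first.
    by move=> v _; rewrite /exit_integrand/= (negbTE XnF) mul0r mulr0.
  by rewrite /exit_weight (negbTE XnF) mul0r mulr0 mul0e mule0.
have u0 : 0 < s - X n w by lra.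
rewrite integral_exit_overshoot// /exit_weight Xn mul1r.
have := overshoot_ge (frame_orthogonal Theta Phi hU hSigma n w) mf f0 u0.
rewrite frame_south_pole// => H.
rewrite muleCA (rescale _ _ (exprn_gt0 m.+2 u0)) lee_wpmul2l//.
  by rewrite lee_fin divr_ge0 ?stays_below_ge0 ?exprn_ge0// ltW.
apply: le_trans H; rewrite lee_wpmul2r ?exit_mean_ge0// lee_fin.
(* [x / (x + 4)] increases with [x >= 0], so the damping factor at the actual gap is at least the
   one at [b]. *)
rewrite ler_wpM2l ?(ltW (slope_cst_gt0 _))//.
have B0 : 0 < b ^+ 2 + 4 by rewrite ltr_wpDl ?sqr_ge0.
have D0 : 0 < (s - X n w) ^+ 2 + 4 by rewrite ltr_wpDl ?sqr_ge0.
rewrite ler_pXn2r ?nnegrE ?divr_ge0 ?sqr_ge0 ?(ltW B0) ?(ltW D0)//.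
rewrite ler_pdivrMr// mulrAC ler_pdivlMr//.
have : b ^+ 2 <= (s - X n w) ^+ 2 by rewrite ler_pXn2r ?nnegrE ?(ltW b0) ?(ltW u0)//; lra.
by set x := (s - _) ^+ 2; set y := b ^+ 2 => yx; nra.
Qed.

Lemma early_at_le (s b : R) n : 0 < b ->
  (\int[P]_(w in early_at s b n) (f (exit_point U Sigma Theta Phi s w))%:E <=
   (slope_cst m)%:E * (weight_mean s b n * open_ball_integral f))%E.
Proof.
move=> b0; have [mX _] := measurable_chain n.
have mh := measurable_exit_weight s b.
have h0 x : 0 <= exit_weight s b x by exact/exit_weight_ge0/ltW.
have mW : measurable_fun setT (fun w =>
    (stays_below s n w * exit_weight s b (X n w))%R%:E * exit_mean f (Y n w))%E.
  apply: emeasurable_funM; last exact: measurable_exit_mean.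
  apply/measurable_EFinP; apply: measurable_funM; first exact: measurable_stays_below.
  exact: (measurableT_comp mh mX).
have W0 w : (0 <= (stays_below s n w * exit_weight s b (X n w))%R%:E *
    exit_mean f (Y n w))%E.
  by rewrite mule_ge0 ?exit_mean_ge0// lee_fin mulr_ge0 ?stays_below_ge0.
rewrite integral_early_at /weight_mean -integral_exit_mean// -ge0_integralZl//; last first.
  by rewrite lee_fin ltW// slope_cst_gt0.
apply: ge0_le_integral => //.
- by move=> w _; apply: integral_ge0 => v _; exact: exit_integrand_ge0.
- exact: measurable_integral_exit.
- exact: measurable_funeM.
- by move=> w _; exact: exit_step_le.
Qed.

Lemma early_at_ge (s b : R) n : 0 < b ->
  ((slope_cst m * (b ^+ 2 / (b ^+ 2 + 4)) ^+ m.+2)%R%:E *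
     (weight_mean s b n * open_ball_integral f) <=
   \int[P]_(w in early_at s b n) (f (exit_point U Sigma Theta Phi s w))%:E)%E.
Proof.
move=> b0; have [mX _] := measurable_chain n.
have mh := measurable_exit_weight s b.
have h0 x : 0 <= exit_weight s b x by exact/exit_weight_ge0/ltW.
have mW : measurable_fun setT (fun w =>
    (stays_below s n w * exit_weight s b (X n w))%R%:E * exit_mean f (Y n w))%E.
  apply: emeasurable_funM; last exact: measurable_exit_mean.
  apply/measurable_EFinP; apply: measurable_funM; first exact: measurable_stays_below.
  exact: (measurableT_comp mh mX).
have W0 w : (0 <= (stays_below s n w * exit_weight s b (X n w))%R%:E *
    exit_mean f (Y n w))%E.
  by rewrite mule_ge0 ?exit_mean_ge0// lee_fin mulr_ge0 ?stays_below_ge0.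
have c0 : 0 <= slope_cst m * (b ^+ 2 / (b ^+ 2 + 4)) ^+ m.+2.
  by rewrite mulr_ge0 ?(ltW (slope_cst_gt0 _))// exprn_ge0// divr_ge0 ?addr_ge0 ?sqr_ge0.
rewrite integral_early_at /weight_mean -integral_exit_mean// -ge0_integralZl//.
apply: ge0_le_integral => //.
- by move=> w _; rewrite mule_ge0.
- exact: measurable_funeM.
- exact: measurable_integral_exit.
- by move=> w _; exact: exit_step_ge.
Qed.

End exit_integrals.

(** The open and the closed ball differ by the sphere, a null set. *)
Lemma open_ball_integralE (f : borel_cV R m.+1 -> R) : measurable_fun setT f ->
  (open_ball_integral f =
   \int[vol m.+1]_p ((p \in (@uball R m.+1))%:R * f p)%R%:E)%E.
Proof.
move=> mf; apply: (@eq_integral_conull _ _ _ _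
  (~` [set v : borel_cV R m.+1 | sqnorm v = 1])).
- by apply: measurableC; exact: measurable_sqnorm_level.
- by rewrite setCK; exact: vol_sqnorm_level.
- apply/measurable_EFinP; apply: measurable_funM => //; apply: measurable_natr_bool.
  by apply: measurable_fun_ltr => //; exact: measurable_sqnorm_id.
- apply/measurable_EFinP; apply: measurable_funM => //.
  exact: (measurable_indic (@measurable_uball R m.+1)).
- move=> p /= p1; congr ((nat_of_bool _)%:R * _)%:E.
  by apply/idP/idP; rewrite inE /uball/=; [exact: ltW|rewrite lt_neqAle => ->; rewrite andbT; exact/eqP].
Qed.

Lemma open_ball_integral1 :
  open_ball_integral (cst 1%R) = vol m.+1 (@uball R m.+1).
Proof.
rewrite open_ball_integralE//; under eq_integral do rewrite mulr1.
rewrite integral_indic ?setIT//; exact: measurable_uball.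
Qed.

Lemma open_ball_integral1_gt0 : (0 < open_ball_integral (cst 1%R))%E.
Proof. by rewrite open_ball_integral1; exact: vol_uball_gt0. Qed.

(** Otherwise almost surely no first step lands at or below [s - b]. By the symmetry [flip_theta],
    almost no step exceeds [|s| + b], so the lower bound for overshoots makes the exit mean of 1
    vanish at the initial point, and averaging gives the ball volume 0. The first reflection is used
    because the starting level 0 need not lie below [s - b]. *)
Lemma weight_mean1_gt0 (s b : R) : 0 < b -> (0 < weight_mean s b 1)%E.
Proof.
move=> b0; rewrite lt_def weight_mean_ge0 ?(ltW b0)// andbT; apply/negP => /eqP W0.
have mh := measurable_exit_weight s b.
have h0 x : 0 <= exit_weight s b x by exact/exit_weight_ge0/ltW.
pose g (v : borel_cV R m.+1) : \bar R := (exit_weight s b (vstep v))%:E.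
have mvs : measurable_fun setT (fun v : borel_cV R m.+1 => vstep v).
  exact: measurable_vstep.
have mg : measurable_fun setT g.
  by apply/measurable_EFinP; exact: (measurableT_comp mh).
have g0 v : (0 <= g v)%E by rewrite lee_fin.
have mflip : measurable_fun setT (@flip_theta R m : borel_cV R m.+1 -> borel_cV R m.+1).
  by apply: measurable_vmap => i _; case: (i < m)%N => //; exact: measurable_funN.
have gE : (\int[angle_law m]_v g (flip_theta v) = 0)%E.
  rewrite integral_flip_theta//.
  transitivity (\int[P]_w \int[angle_law m]_v g v)%E.
    by rewrite integral_cst//= probability_setT mule1.
  have <- := @integral_past_angles _ _ _ _ _ Sigma _ _ hTheta hPhi hind 0
    (fun p => g p.2); last 2 first.
  - exact: (measurableT_comp mg measurable_snd).
  - by [].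
  rewrite -[RHS]W0; apply: eq_integral => w _.
  rewrite stays_belowS /stays_below big_ord0 mul1r reflectionS/= add0r /g.
  rewrite /exit_weight mulrA -natrM mulnb; congr ((nat_of_bool _)%:R * _)%:E.
  by apply/idP/andP => [xs|[] //]; split => //; lra.
(* A step below [- u] lands below [s - b], whatever the sign of [s]. *)
pose u : R := `|s| + b.
have u0 : 0 < u by rewrite ltr_wpDl.
pose e (v : borel_cV R m.+1) : \bar R := ((u < vstep v)%R%:R)%:E.
have me : measurable_fun setT e.
  by apply/measurable_EFinP; apply: measurable_natr_bool; exact: measurable_fun_ltr.
have eE : (\int[angle_law m]_v e v = 0)%E.
  have mgf := measurableT_comp mg mflip.
  have /ae_eq_integral_abs : (\int[angle_law m]_v `|g (flip_theta v)| = 0)%E.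
    by under eq_integral do rewrite gee0_abs//.
  move=> /(_ measurableT mgf) G0.
  rewrite -[RHS](integral0 (angle_law m) setT).
  apply: ae_eq_integral => //.
  apply: filterS G0 => v /= /(_ I) gv _; rewrite /e.
  have [uv|//] := ltP u (vstep v); exfalso.
  move: gv; rewrite /g vstep_flip_theta /exit_weight.
  have sle := ler_norm (- s); rewrite normrN in sle.
  rewrite (_ : - vstep v <= s - b); last by rewrite /u in uv; lra.
  rewrite mul1r => -[] /eqP; rewrite invr_eq0 expf_eq0/= => /eqP.
  by rewrite /u in uv; lra.
have em0 w : exit_mean (cst 1) (Y 0 w) = 0%E.
  have := @overshoot_ge _ _ (U (Y 0 w)) (cst 1) u.
  move=> /(_ (frame_orthogonal Theta Phi hU hSigma 0 w) (measurable_cst _) (fun=> ler01) u0).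
  under eq_integral do rewrite mulr1.
  rewrite [in leRHS]eE mule0 frame_south_pole//.
  have c0 : 0 < slope_cst m * (u ^+ 2 / (u ^+ 2 + 4)) ^+ m.+2.
    by rewrite mulr_gt0 ?slope_cst_gt0// exprn_gt0// divr_gt0 ?addr_gt0 ?exprn_gt0.
  rewrite -lee_pdivlMl// mule0 => em.
  by apply/eqP; rewrite eq_le em (exit_mean_ge0 (f := cst 1) (fun=> ler01)).
have := @integral_exit_mean (cst 1) (measurable_cst _) (fun=> ler01) 0 0 (cst 1)
  (measurable_cst _) (fun=> ler01).
rewrite integral0_eq; last by move=> w _; rewrite em0 mule0.
have -> : (\int[P]_w (stays_below 0 0 w * cst 1 (X 0 w))%:E = 1)%E.
  transitivity (\int[P]_w (cst 1 w : \bar R))%E.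
    by apply: eq_integral => w _; rewrite /stays_below big_ord0 mul1r.
  by rewrite integral_cst//= probability_setT mule1.
rewrite mul1e => I0.
by have := open_ball_integral1_gt0; rewrite -I0 ltxx.
Qed.

Lemma weight_sum_gt0 (s b : R) : 0 < b ->
  (0 < \sum_(0 <= n <oo) weight_mean s b n)%E.
Proof.
move=> b0; apply: lt_le_trans (weight_mean1_gt0 s b0) _.
have W0 n : (0 <= weight_mean s b n)%E by exact/weight_mean_ge0/ltW.
apply: le_trans (_ : \sum_(0 <= n < 2) weight_mean s b n <= _)%E.
  by rewrite big_nat_recr//= leeDr// sume_ge0.
exact: nneseries_lim_ge.
Qed.

(** * Summation over the index of the last reflection *)

Section exit_sums.
Variable f : borel_cV R m.+1 -> R.
Hypotheses (mf : measurable_fun setT f) (f0 : forall p, 0 <= f p).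
Hypothesis fI : open_ball_integral f \is a fin_num.
Variables (s b : R).
Hypothesis b0 : 0 < b.

Let early := early_last_reflection U Sigma Theta Phi s b.

Lemma measurable_early_last_reflection : measurable early.
Proof.
rewrite /early early_bigcup; apply: bigcup_measurable => n _; exact: measurable_early.
Qed.

Let integral_earlyE : (\int[P]_(w in early) (f (exit_point U Sigma Theta Phi s w))%:E =
  \sum_(0 <= n <oo) \int[P]_(w in early_at s b n) (f (exit_point U Sigma Theta Phi s w))%:E)%E.
Proof.
rewrite /early early_bigcup ge0_integral_bigcup//.
- by move=> n; exact: measurable_early.
- apply: measurable_funTS; apply/measurable_EFinP.
  exact: (measurableT_comp mf (measurable_exit_point s)).
- by move=> w _; rewrite lee_fin.
- exact: trivIset_early.
Qed.

Let scaled_sum (c : R) :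
  (\sum_(0 <= n <oo) c%:E * (weight_mean s b n * open_ball_integral f) =
   c%:E * (open_ball_integral f * \sum_(0 <= n <oo) weight_mean s b n))%E.
Proof.
rewrite -(fineK fI) muleA -EFinM -nneseriesZl; last first.
  by move=> n _; exact/weight_mean_ge0/ltW.
by apply: eq_eseriesr => n _; rewrite (muleC (weight_mean _ _ _)) muleA -EFinM.
Qed.

Let I0 : (0 <= open_ball_integral f)%E.
Proof. by apply: integral_ge0 => p _; rewrite lee_fin mulr_ge0. Qed.

Lemma integral_early_le :
  (\int[P]_(w in early) (f (exit_point U Sigma Theta Phi s w))%:E <=
   (slope_cst m)%:E * (open_ball_integral f * \sum_(0 <= n <oo) weight_mean s b n))%E.
Proof.
rewrite integral_earlyE -scaled_sum; apply: lee_nneseries => n _.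
  by move=> _; apply: integral_ge0 => w _; rewrite lee_fin.
exact: early_at_le.
Qed.

Lemma integral_early_ge :
  ((slope_cst m * (b ^+ 2 / (b ^+ 2 + 4)) ^+ m.+2)%R%:E *
     (open_ball_integral f * \sum_(0 <= n <oo) weight_mean s b n) <=
   \int[P]_(w in early) (f (exit_point U Sigma Theta Phi s w))%:E)%E.
Proof.
rewrite integral_earlyE -scaled_sum; apply: lee_nneseries => n _.
  move=> _; rewrite mule_ge0 ?mule_ge0 ?weight_mean_ge0 ?(ltW b0)// lee_fin.
  by rewrite mulr_ge0 ?(ltW (slope_cst_gt0 _))// exprn_ge0// divr_ge0 ?addr_ge0 ?sqr_ge0.
exact: early_at_ge.
Qed.

End exit_sums.

(** The bounds for [f] and for the constant 1 share [slope_cst m] and the sum of weights [W], which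
    cancel in the quotient; one damping factor is lost on either side. *)
Lemma conditional_mean_bounds (s b : R) (f : borel_cV R m.+1 -> R) : 0 < b ->
  measurable_fun setT f -> (forall p, 0 <= f p) ->
  open_ball_integral f \is a fin_num ->
  let early := early_last_reflection U Sigma Theta Phi s b in
  let r := (b ^+ 2 / (b ^+ 2 + 4)) ^+ m.+2 in
  let q := fine (open_ball_integral f) / fine (vol m.+1 (@uball R m.+1)) in
  exists2 j : R,
    (((fine (P early))^-1)%:E * \int[P]_(w in early)
       (f (exit_point U Sigma Theta Phi s w))%:E = j%:E)%E &
    q * r <= j <= q / r.
Proof.
move=> b0 mf f0 fI early r q.
set W := (\sum_(0 <= n <oo) weight_mean s b n)%E.
have W0 : (0 < W)%E := weight_sum_gt0 s b0.
have I1 : open_ball_integral (cst 1%R) = (fine (vol m.+1 (@uball R m.+1)))%:E.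
  rewrite open_ball_integral1 fineK// ge0_fin_numE ?measure_ge0//.
  exact: vol_uball_lty.
have i1 : 0 < fine (vol m.+1 (@uball R m.+1)).
  by rewrite -lte_fin -I1; exact: open_ball_integral1_gt0.
have r0 : 0 < r by rewrite exprn_gt0// divr_gt0 ?addr_gt0 ?exprn_gt0.
have c0 := @slope_cst_gt0 R m.
have mE : measurable early := measurable_early_last_reflection s b.
have PE : (\int[P]_(w in early) ((cst 1 : borel_cV R m.+1 -> R)
    (exit_point U Sigma Theta Phi s w))%:E = P early)%E.
  transitivity (\int[P]_(w in early) (cst 1 w : \bar R))%E; first by [].
  by rewrite integral_cst// mul1e.
have pge := @integral_early_ge (cst 1) (measurable_cst _) (fun=> ler01) _ s b b0.
have ple := @integral_early_le (cst 1) (measurable_cst _) (fun=> ler01) _ s b b0.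
rewrite PE I1 -/W in pge ple.
have {}pge := pge isT; have {}ple := ple isT.
have jge := @integral_early_ge f mf f0 fI s b b0.
have jle := @integral_early_le f mf f0 fI s b b0.
rewrite -/W -(fineK fI) in jge jle.
have Pfin : P early \is a fin_num by exact: fin_num_measure.
rewrite -/r -/early in jge pge.
have i0 : 0 <= fine (open_ball_integral f).
  by rewrite fine_ge0// integral_ge0// => p _; rewrite lee_fin mulr_ge0.
move: pge ple jge jle; rewrite -(fineK Pfin).
move: W0; rewrite {}/W {}/q; set W := (\sum_(0 <= n <oo) _)%E.
move: (fine (P early)) (fine (vol _ _)) i1 (fine (open_ball_integral f)) i0 => p i1 i1p i i0.
move: (slope_cst m) c0 r r0 => c c0 r r0.
(* An infinite sum of weights would make the lower bound for [P early] infinite. *)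
case: W => [a| |]//; last first.
  by move=> _; rewrite gt0_muley ?lte_fin// gt0_muley ?lte_fin ?mulr_gt0.
rewrite lte_fin => a0; rewrite -!EFinM !lee_fin => pge ple.
have p0 : 0 < p by rewrite (lt_le_trans _ pge)// !mulr_gt0.
have J0 : (0 <= \int[P]_(w in early) (f (exit_point U Sigma Theta Phi s w))%:E)%E.
  by apply: integral_ge0 => w _; rewrite lee_fin.
move: J0; rewrite -/early; case: (\int[P]_(w in early) _)%E => [j| |]//.
rewrite !lee_fin => J0 jge jle; exists (p^-1 * j); first by rewrite EFinM.
rewrite (mulrC p^-1) ler_pdivlMr// ler_pdivrMr//; apply/andP; split.
  apply: le_trans jge; apply: le_trans (ler_wpM2l _ ple) _.
    by rewrite mulr_ge0 ?divr_ge0// ltW.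
  rewrite le_eqVlt; apply/orP; left; apply/eqP.
  by field; rewrite gt_eqF.
apply: le_trans jle _; apply: le_trans (ler_wpM2l _ pge); last first.
  by rewrite !divr_ge0// ltW.
rewrite le_eqVlt; apply/orP; left; apply/eqP.
by field; rewrite !gt_eqF.
Qed.

End ray.

(** * Weak convergence of the exit law *)

Section set_function_integral.
Import HBSimple HBNNSimple.
Context {R : realType}.

(** The integral is built from simple functions, whose level sets are measurable. The conditional
    law and the uniform law are bare set functions, and this lets measures take their place. *)
Lemma eq_integral_set_function d (T : measurableType d)
    (mu nu : set T -> \bar R) (D : set T) (f : T -> \bar R) :
  (forall A, measurable A -> mu A = nu A) ->
  integral mu D f = integral nu D f.
Proof.
move=> munu; rewrite /integral /=.
have E (h : {nnsfun T >-> R}) : sintegral mu h = sintegral nu h.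
  by apply: eq_fsbigr => x _; rewrite munu//; exact: measurable_funPTI.
by congr (ereal_sup _ - ereal_sup _)%E; apply: eq_imagel => h _; exact: E.
Qed.

Section restricted_image.
Context d d' (T : measurableType d) (T' : measurableType d').
Variables (mu : {measure set T -> \bar R}) (B : set T) (X : T -> T') (c : R).
Hypotheses (mB : measurable B) (mX : measurable_fun setT X) (c0 : 0 <= c).

Let rho (w : T) : R := c * \1_B w.

Let mrho : measurable_fun setT rho.
Proof. by apply: measurable_funM => //; exact: measurable_indic. Qed.

Let rho0 w : 0 <= rho w. Proof. by rewrite mulr_ge0. Qed.

(** The image under [X] of the measure with density [c] on [B]; it represents both the conditional
    law and the uniform law on the ball. *)
Lemma scaled_restriction_measure : exists nu : {measure set T' -> \bar R},
  (forall A, measurable A -> nu A = mu (X @^-1` A `&` B) * c%:E)%E /\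
  (forall f, measurable_fun setT f -> (forall y, 0 <= f y)%E ->
    (\int[nu]_y f y = c%:E * \int[mu]_(w in B) f (X w))%E).
Proof.
exists (image_measure (dens mu mrho rho0) mX); split.
  move=> A mA; have mXA : measurable (X @^-1` A) by rewrite -[Z in measurable Z]setTI; exact: mX.
  transitivity (\int[mu]_(w in X @^-1` A) (c%:E * (\1_B w)%:E))%E; first by [].
  have mI : measurable_fun (X @^-1` A) (EFin \o \1_B : T -> \bar R).
    by apply/measurable_EFinP; apply: measurable_funTS; exact: measurable_indic.
  rewrite ge0_integralZl//.
  by rewrite integral_indic// setIC muleC.
move=> f mf f0; rewrite ge0_integral_image// ge0_integral_dens//; last first.
  exact: (measurableT_comp mf).
rewrite [in RHS]integral_mkcond -ge0_integralZl//; last 2 first.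
- apply/(measurable_restrictT _ mB); apply: measurable_funTS.
  exact: (measurableT_comp mf).
- by move=> w _; rewrite patchE; case: ifP.
apply: eq_integral => w _; rewrite /rho patchE indicE EFinM -muleA.
by case: (w \in B); rewrite ?mul1e ?mul0e.
Qed.

End restricted_image.

Lemma integral_cond_law d (T : measurableType d) (P : probability T R) d'
    (T' : measurableType d') (B : set T) (X : T -> T') : measurable B ->
  measurable_fun setT X ->
  exists nu : {measure set T' -> \bar R},
  (forall f : T' -> \bar R, integral (cond_law P B X) setT f = \int[nu]_y f y)%E /\
  (forall f, measurable_fun setT f -> (forall y, 0 <= f y)%E ->
    (\int[nu]_y f y = ((fine (P B))^-1)%:E * \int[P]_(w in B) f (X w))%E).
Proof.
move=> mB mX; have c0 : 0 <= (fine (P B))^-1 by rewrite invr_ge0 fine_ge0.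
have [nu [nuE nuI]] := scaled_restriction_measure P mB mX c0.
exists nu; split => // f; apply: eq_integral_set_function => A mA.
by rewrite nuE.
Qed.

Lemma integral_uball_uniform n : exists nu : {measure set (borel_cV R n) -> \bar R},
  (forall f : borel_cV R n -> \bar R,
    integral (@uball_uniform R n : set (borel_cV R n) -> _) setT f = \int[nu]_y f y)%E /\
  (forall f, measurable_fun setT f -> (forall y, 0 <= f y)%E ->
    (\int[nu]_y f y = ((fine (vol n (@uball R n)))^-1)%:E *
      \int[vol n]_(p in @uball R n) f p)%E).
Proof.
have mB := @measurable_uball R n.
have c0 : 0 <= (fine (vol n (@uball R n)))^-1 by rewrite invr_ge0 fine_ge0.
have [nu [nuE nuI]] := scaled_restriction_measure (vol n) mB (@measurable_id _ _ setT) c0.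
exists nu; split => // f; apply: eq_integral_set_function => A mA.
rewrite nuE// /uball_uniform !volumeE//; exact: measurableI.
Qed.

End set_function_integral.

(** The ratio equals [(1 + 4 * beta^-2)^-1] as soon as [beta s > 0]. *)
Lemma damping_cvg {R : realType} (beta : R -> R) k :
  beta s @[s --> +oo] --> +oo ->
  ((beta s) ^+ 2 / ((beta s) ^+ 2 + 4)) ^+ k @[s --> +oo] --> (1 : R).
Proof.
move=> hb.
have bpos : \forall s \near +oo, 0 < beta s by move/cvgryPgt : hb; exact.
have hbV : (beta s)^-1 @[s --> +oo] --> (0 : R) by exact/(gtr0_cvgV0 bpos).
have hbV2 : (1 + 4 * ((beta s)^-1) ^+ 2)^-1 ^+ k @[s --> +oo] --> (1 : R).
  have one : (1 + 4 * (0 : R) ^+ 2)^-1 ^+ k = 1.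
    by rewrite expr0n mulr0 addr0 invr1 expr1n.
  rewrite -[X in _ --> X]one.
  apply: (@cvg_comp _ _ _ (fun s => (1 + 4 * (beta s)^-1 ^+ 2)^-1) (fun x : R => x ^+ k));
    last exact: exprn_continuous.
  apply: cvgV; first by rewrite expr0n mulr0 addr0 oner_neq0.
  apply: cvgD; [exact: cvg_cst|apply: cvgM; first exact: cvg_cst].
  apply: (@cvg_comp _ _ _ (fun s => (beta s)^-1) (fun x : R => x ^+ 2)) hbV _.
  exact: exprn_continuous.
apply: cvg_trans hbV2; apply: near_eq_cvg.
near=> s; congr (_ ^+ k).
have b0 : 0 < beta s by near: s.
have B0 : 0 < (beta s) ^+ 2 + 4 by rewrite ltr_wpDl ?sqr_ge0.
have b2 : 0 < (beta s) ^+ 2 by rewrite exprn_gt0.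
by rewrite exprVn; field; rewrite !gt_eqF// addrC.
Unshelve. all: by end_near. Qed.

(** * Passage to the limit *)

Section weak_limit.
Context {R : realType} {m : nat} {disp : measure_display} {T : measurableType disp}.
Variable P : probability T R.
Variable U : 'cV[R]_m.+1 -> 'M[R]_m.+1.
Variable Sigma : {RV P >-> borel_cV R m.+1}.
Variables (Theta : nat -> {RV P >-> R}) (Phi : nat -> 'I_m -> {RV P >-> R}).
Hypothesis hU : frame_choice U.
Hypothesis hSigma : forall w, usphere (Sigma w).
Hypothesis hSigma_law : has_law P Sigma (@usphere_uniform R m.+1).
Hypothesis hTheta : forall k, has_law P (Theta k) theta_law.
Hypothesis hPhi : forall k i, has_law P (Phi k i) phi_law.
Hypothesis hind : mutually_independent P (angle_sigma_algebras Sigma Theta Phi).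
Variable beta : R -> R.
Hypothesis hbeta : beta s @[s --> +oo] --> +oo.

Let early s := early_last_reflection U Sigma Theta Phi s (beta s).
Let exit s : T -> borel_cV R m.+1 := exit_point U Sigma Theta Phi s.
Let mE s : measurable (early s).
Proof. exact: measurable_early_last_reflection. Qed.
Let mY s : measurable_fun setT (exit s).
Proof. exact: measurable_exit_point. Qed.

(** A squeeze between [q * r s] and [q / r s], where [r s] tends to 1. The bounds compare integrals
    of nonnegative functions, hence the sign condition on [f]. *)
Lemma exit_law_cvg_ge0 (f : borel_cV R m.+1 -> R) (M : R) :
  measurable_fun setT f -> (forall p, 0 <= f p <= M) ->
  exists2 l : R,
    integral (@uball_uniform R m.+1 : set (borel_cV R m.+1) -> _) setT (EFin \o f) = l%:E &
    integral (cond_law P (early s) (exit s)) setT (EFin \o f) @[s --> +oo] --> l%:E.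
Proof.
move=> mf fM; have f0 p : 0 <= f p by have /andP[] := fM p.
have mEf : measurable_fun setT (EFin \o f) by exact/measurable_EFinP.
have Ef0 p : (0 <= (EFin \o f) p)%E by rewrite /= lee_fin.
pose I1 := open_ball_integral (cst (1 : R) : borel_cV R m.+1 -> R).
have I1fin : I1 \is a fin_num.
  rewrite /I1 open_ball_integral1 ge0_fin_numE ?measure_ge0//; exact: vol_uball_lty.
have M0 : 0 <= M by have /andP[] := fM 0; exact: le_trans.
have fI : open_ball_integral f \is a fin_num.
  rewrite ge0_fin_numE; last by apply: integral_ge0 => p _; rewrite lee_fin mulr_ge0.
  apply: (@le_lt_trans _ _ (M%:E * I1)%E); last first.
    by rewrite -(fineK I1fin) -EFinM ltry.
  rewrite /I1 /open_ball_integral -ge0_integralZl//; last 2 first.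
  - apply/measurable_EFinP; apply: measurable_funM => //; apply: measurable_natr_bool.
    by apply: measurable_fun_ltr => //; exact: measurable_sqnorm_id.
  - by move=> p _; rewrite lee_fin mulr_ge0.
  apply: ge0_le_integral => //.
  - by move=> p _; rewrite lee_fin mulr_ge0.
  - apply/measurable_EFinP; apply: measurable_funM => //; apply: measurable_natr_bool.
    by apply: measurable_fun_ltr => //; exact: measurable_sqnorm_id.
  - apply/measurable_EFinP; apply: measurable_funM => //; apply: measurable_funM => //.
    apply: measurable_natr_bool.
    by apply: measurable_fun_ltr => //; exact: measurable_sqnorm_id.
  - move=> p _; rewrite -EFinM lee_fin mulr1 mulrC ler_wpM2r//.
    by have /andP[] := fM p.
pose q := fine (open_ball_integral f) / fine (vol m.+1 (@uball R m.+1)).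
exists q.
  have [nu [nuE nuI]] := @integral_uball_uniform R m.+1.
  rewrite nuE nuI//.
  have -> : (\int[vol m.+1]_(p in @uball R m.+1) (EFin \o f) p = open_ball_integral f)%E.
    rewrite open_ball_integralE// integral_mkcond; apply: eq_integral => p _.
    by rewrite patchE; case: ifP => _; rewrite ?mul1r ?mul0r.
  by rewrite -(fineK fI) -EFinM mulrC.
pose r s := ((beta s) ^+ 2 / ((beta s) ^+ 2 + 4)) ^+ m.+2.
have r1 : r s @[s --> +oo] --> (1 : R) by exact: damping_cvg.
have bpos : \forall s \near +oo, 0 < beta s by move/cvgryPgt : hbeta; exact.
have bounds s : 0 < beta s -> exists2 j : R,
    integral (cond_law P (early s) (exit s)) setT (EFin \o f) = j%:E &
    q * r s <= j <= q / r s.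
  move=> b0; have [nu [nuE nuI]] := integral_cond_law P (mE s) (mY s).
  have [j jE jb] := conditional_mean_bounds hU hSigma hSigma_law hTheta hPhi hind
    s b0 mf f0 fI.
  by exists j => //; rewrite nuE nuI.
apply/fine_cvgP; split.
  by near=> s; have [|j -> _] := bounds s; [near: s|].
apply: (@squeeze_cvgr _ _ _ _ (fun s => q * r s) (fun s => q / r s)).
- by near=> s => /=; have [|j -> jb] := bounds s; [near: s|].
- by rewrite -[X in _ --> X]mulr1; apply: cvgM => //; exact: cvg_cst.
- rewrite -[X in _ --> X]divr1; apply: cvgM; first exact: cvg_cst.
  by apply: cvgV => //; rewrite oner_neq0.
Unshelve. all: by end_near. Qed.

(** The positive and negative parts of a bounded continuous function are bounded and measurable, and
    their limits are subtracted. *)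
Lemma exit_law_weakly_cvg : weakly_cvg
  (fun s => cond_law P (early s) (exit s)) (@uball_uniform R m.+1).
Proof.
move=> f cf [M0 fM0]; pose M : R := M0; have fM p : `|f p| <= M := fM0 p.
have mf : measurable_fun setT (f : borel_cV R m.+1 -> R) by exact: continuous_measurable_cV.
pose fp (p : borel_cV R m.+1) : R := Num.max (f p) 0.
pose fn (p : borel_cV R m.+1) : R := Num.max (- f p) 0.
pose Ef (p : borel_cV R m.+1) : \bar R := (f p)%:E.
have fpE : (Ef^\+ = EFin \o fp)%E by apply/funext => p; rewrite funeposE/= EFin_max.
have fnE : (Ef^\- = EFin \o fn)%E by apply/funext => p; rewrite funenegE/= EFin_max.
have bp p : 0 <= fp p <= M.
  rewrite le_max lexx orbT ge_max (le_trans (ler_norm _) (fM p))/=.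
  exact: le_trans (fM 0).
have bn p : 0 <= fn p <= M.
  rewrite le_max lexx orbT ge_max (le_trans (ler_norm _)) ?normrN//=.
  exact: le_trans (fM 0).
have mfp : measurable_fun setT fp by exact: measurable_maxr.
have mfn : measurable_fun setT fn.
  by apply: measurable_maxr => //; exact: measurableT_comp.
have [lp lpE hp] := exit_law_cvg_ge0 mfp bp.
have [ln lnE hn] := exit_law_cvg_ge0 mfn bn.
have split_cond s : integral (cond_law P (early s) (exit s)) setT Ef =
    (integral (cond_law P (early s) (exit s)) setT (EFin \o fp) -
     integral (cond_law P (early s) (exit s)) setT (EFin \o fn))%E.
  have [nu [nuE _]] := integral_cond_law P (mE s) (mY s).
  by rewrite !nuE integralE fpE fnE.
have split_ball : integral (@uball_uniform R m.+1 : set (borel_cV R m.+1) -> _) setT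
    Ef = (lp%:E - ln%:E)%E.
  have [nu [nuE _]] := @integral_uball_uniform R m.+1.
  by rewrite -lpE -lnE !nuE integralE fpE fnE.
rewrite [X in _ --> X]split_ball.
rewrite (_ : (fun s => _) = (fun s =>
    integral (cond_law P (early s) (exit s)) setT (EFin \o fp) -
    integral (cond_law P (early s) (exit s)) setT (EFin \o fn))%E); last first.
  by apply/funext => s; exact: split_cond.
exact: cvgeB.
Qed.

End weak_limit.
Theorem theorem6p4 (R : realType) (d : nat) (disp : measure_display)
    (T : measurableType disp) (P : probability T R)
    (U : 'cV[R]_d.-2.+1 -> 'M[R]_d.-2.+1)
    (Sigma : {RV P >-> borel_cV R d.-2.+1})
    (Theta : nat -> {RV P >-> R}) (Phi : nat -> 'I_d.-2 -> {RV P >-> R})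
    (hd : (3 <= d)%N)
    (hU : frame_choice U)
    (hSigma : forall w, usphere (Sigma w))
    (hSigma_law : has_law P Sigma (@usphere_uniform R d.-2.+1))
    (hTheta : forall k, has_law P (Theta k) theta_law)
    (hPhi : forall k i, has_law P (Phi k i) phi_law)
    (hind : mutually_independent P (angle_sigma_algebras Sigma Theta Phi))
    (beta : R -> R)
    (hbeta : beta s @[s --> +oo] --> +oo) :
  weakly_cvg
    (fun s => cond_law P (early_last_reflection U Sigma Theta Phi s (beta s))
                (exit_point U Sigma Theta Phi s))
    (@uball_uniform R d.-2.+1).
Proof.
exact: (exit_law_weakly_cvg hU hSigma hSigma_law hTheta hPhi hind hbeta).
Qed.
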